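(* Let $\mathcal{D}\subset\mathcal{M}$ be an inclusion of von Neumann algebras. Let $\omega$ be a normal state on $\mathcal{M}$, and let $z$ be the support projection of $\omega_{|\mathcal{D}}$ in $\mathcal{D}$. If $\omega(ax)=\omega(xa)$ for every $a\in\mathcal{D}$, $x\in\mathcal{M}$, then there is an $\omega$-preserving normal idempotent contractive completely positive $\mathcal{D}$-module map $\mathbb{E}_\omega$ from $\mathcal{M}$ onto an ideal in $\mathcal{D}$, with $\mathrm{supp}(\mathbb{E}_\omega)\le z$. We have $\mathbb{E}_\omega(\mathcal{M})=z\mathcal{D}$. Indeed there is a unique $\omega$-preserving normal idempotent contractive $\mathcal{D}$-module map $E$ from $\mathcal{M}$ onto a $*$-subalgebra of $\mathcal{D}$ with $\mathrm{supp}(E)\le z$.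
   Context: The inclusion $\mathcal{D}\subset\mathcal{M}$ is unital. The support projection of the normal state $\omega_{|\mathcal{D}}$ in $\mathcal{D}$ is the complement of the largest projection $q\in\mathcal{D}$ with $\omega(q)=0$. For a normal positive map $E$ on $\mathcal{M}$, $\mathrm{supp}(E)$ is the complement of the largest projection $p\in\mathcal{M}$ with $E(p)=0$. Normal means weak* continuous; $\omega$-preserving means $\omega\circ E=\omega$. A $\mathcal{D}$-module map is a linear map with $E(dx)=dE(x)$ and $E(xd)=E(x)d$ for $d\in\mathcal{D}$, $x\in\mathcal{M}$. *)

(* Defs.v *)
From HB Require Import structures.
From mathcomp Require Import all_boot all_order all_algebra.
From mathcomp Require Import sesquilinear complex.
From mathcomp Require Import all_classical all_reals all_analysis.
Set Implicit Arguments.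
Unset Strict Implicit.
Unset Printing Implicit Defensive.
Import Order.TTheory GRing.Theory Num.Theory numFieldNormedType.Exports.
Local Open Scope classical_set_scope.
Local Open Scope ring_scope.

(* MathComp-Analysis attaches the norm topology to a [numClosedFieldType];
   naming the structure makes that topology available on the concrete R[i]. *)
Definition Cplx (R : realType) : numClosedFieldType := R[i].

(* [{dot H for Num.conj}]: positive definite hermitian forms, linear in the
   first argument and conjugate-linear in the second. *)
Definition hilbert_product (R : realType) (H : completeNormedModType (Cplx R))
    (dot : {dot H for Num.conj}) : Prop :=
  forall u : H, dot u u = `|u| ^+ 2.

Section OperatorAlgebras.
Context {R : realType} {H : completeNormedModType (Cplx R)}.
Context (dot : {dot H for Num.conj}).

(* Operators are plain functions on H, with the pointwise vector space
   structure and composition as product; B(H) is the following set. *)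
Definition bounded_ops : set (H -> H) := [set T | linear T /\ continuous T].

Definition is_adjoint (S T : H -> H) : Prop :=
  forall u v, dot (S u) v = dot u (T v).

(* [0 <= c] in R[i] means that c is real and nonnegative. *)
Definition positive_op (T : H -> H) : Prop := forall u, 0 <= dot (T u) u.

Definition op_le (S T : H -> H) : Prop := positive_op (T - S).

Definition is_projection (p : H -> H) : Prop := p \o p = p /\ is_adjoint p p.

Definition opnorm (T : H -> H) : R :=
  sup [set complex.Re `|T u| | u in [set u : H | `|u| <= 1]].

Definition star_subalgebra (A : set (H -> H)) : Prop :=
  [/\ A `<=` bounded_ops, A 0,
      forall (c : Cplx R) S T, A S -> A T -> A (c *: S + T),
      forall S T, A S -> A T -> A (S \o T)
    & forall S, A S -> exists2 T, A T & is_adjoint T S].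

Definition commutant (A : set (H -> H)) : set (H -> H) :=
  [set T | bounded_ops T /\ forall S, A S -> T \o S = S \o T].

(* Since a commutant contains the identity, so does every von Neumann algebra
   on H, and an inclusion of two of them is unital. *)
Definition von_neumann (A : set (H -> H)) : Prop :=
  star_subalgebra A /\ commutant (commutant A) = A.

(* The weak* topology of B(H), that is of the dual of the trace class: the
   coarsest one that makes T |-> \sum_n <T xi_n, eta_n> continuous for all
   square-summable sequences xi and eta. The weak* topology of a von Neumann
   algebra M on H is its restriction to M. *)
Definition square_summable : set (nat -> H) :=
  [set xi : nat -> H | cvgn (series (fun n => `|xi n| ^+ 2 : Cplx R))].

Definition vector_functionals (T : H -> H) :
    prod_topology (fun _ : square_summable * square_summable => Cplx R) :=
  fun e => limn (series (fun n => dot (T (val e.1 n)) (val e.2 n) : Cplx R)).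

Definition weak_star : Type := initial_topology vector_functionals.
HB.instance Definition _ :=
  Topological.copy weak_star (initial_topology vector_functionals).

Definition normal_on (T : topologicalType) (M : set (H -> H))
    (f : (H -> H) -> T) : Prop :=
  {within (M : set weak_star), continuous (f : weak_star -> T)}.

Definition linear_on (V : lmodType (Cplx R)) (M : set (H -> H))
    (f : (H -> H) -> V) : Prop :=
  forall (c : Cplx R) S T, M S -> M T -> f (c *: S + T) = c *: f S + f T.

Definition normal_state (M : set (H -> H)) (w : (H -> H) -> Cplx R) : Prop :=
  [/\ linear_on (V := (Cplx R)^o) M w,
      forall T, M T -> positive_op T -> 0 <= w T,
      w idfun = 1
    & normal_on M w].

Definition largest_null_projection (V : zmodType) (A : set (H -> H))
    (f : (H -> H) -> V) (q : H -> H) : Prop :=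
  [/\ A q, is_projection q, f q = 0
    & forall p, A p -> is_projection p -> f p = 0 -> op_le p q].

Definition is_support (V : zmodType) (A : set (H -> H))
    (f : (H -> H) -> V) (s : H -> H) : Prop :=
  exists2 q, largest_null_projection A f q & s = idfun - q.

Definition module_map (D M : set (H -> H)) (E : (H -> H) -> (H -> H)) : Prop :=
  linear_on M E /\
  forall d x, D d -> M x -> E (d \o x) = d \o E x /\ E (x \o d) = E x \o d.

(* A matrix over B(H) acts on the direct sum H^n. *)
Definition positive_mx (n : nat) (x : 'M[H -> H]_n) : Prop :=
  forall u : 'I_n -> H, 0 <= \sum_i \sum_j dot (x i j (u j)) (u i).

Definition completely_positive (M : set (H -> H))
    (E : (H -> H) -> (H -> H)) : Prop :=
  forall (n : nat) (x : 'M[H -> H]_n),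
    (forall i j, M (x i j)) -> positive_mx x -> positive_mx (map_mx E x).

Definition is_ideal (D J : set (H -> H)) : Prop :=
  [/\ J `<=` D, J 0,
      forall (c : Cplx R) S T, J S -> J T -> J (c *: S + T)
    & forall d T, D d -> J T -> J (d \o T) /\ J (T \o d)].

(* A map on M is represented by a function on all H -> H, of which only the
   values on M matter. Positivity is not required; the last clause asks
   that the support of E exist and lie below z. *)
Definition preserving_normal_projection (D M : set (H -> H))
    (w : (H -> H) -> Cplx R) (z : H -> H) (E : (H -> H) -> (H -> H)) : Prop :=
  [/\ module_map D M E,
      forall x, M x -> w (E x) = w x,
      normal_on (T := weak_star) M E
        /\ (forall x, M x -> opnorm (E x) <= opnorm x),
      forall x, M x -> E (E x) = E x
    & exists2 s, is_support M E s & op_le s z].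

Definition onto_star_subalgebra (D M : set (H -> H))
    (E : (H -> H) -> (H -> H)) : Prop :=
  E @` M `<=` D /\ star_subalgebra (E @` M).

End OperatorAlgebras.

(* Main.v *)
Require Import Defs.
From HB Require Import structures.
From mathcomp Require Import all_boot all_order all_algebra.
From mathcomp Require Import sesquilinear complex.
From mathcomp Require Import all_classical all_reals all_analysis.
From mathcomp Require Import ring lra.
Set Implicit Arguments.
Unset Strict Implicit.
Unset Printing Implicit Defensive.
Import Order.TTheory GRing.Theory Num.Theory numFieldNormedType.Exports.
Local Open Scope classical_set_scope.
Local Open Scope ring_scope.

(* Amplify H to K = l2(H), where D and M act diagonally. Weak* continuity at 0
   bounds w by a vector functional on positive operators, and a Radon-Nikodym
   argument then makes w the vector state <. y, y> of some y in K.

   Let N be the commutant of D on K, P the projection onto the closure of D y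
   and z the projection onto the closure of N y; z is the support of w on D,
   and traciality makes it central. Traciality also gives b P x y = P x b y for
   x in M and self-adjoint b in P N P, whence |e P x y| <= |x| |e y| for e in N.
   So e y |-> e P x y extends to an operator E(x) that commutes with N, hence
   lies in z D, and E(x) is characterised by w(E(x) d) = w(x d) for d in D. The
   algebraic properties of E and its uniqueness follow from this.

   For normality and complete positivity, finitely many vectors v_i of K can be
   replaced by vectors m_i such that <E(x) v_j, v_i> = <x m_j, m_i> for all x. *)

(** * Complex numbers *)

(** E(x) y = P x y is how an expectation preserving a trace looks in the GNS space, although here w
    is tracial only between D and M. The obstacle is boundedness: e in N does not commute with x, so
    that e y -> e P x y is not visibly well defined. A self-adjoint b in P N P can be moved past P
    x, which gives |b P x y| = |P x b y| <= |x| |b y|. A general e enters only through P e* e P, and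
    this is a sum of squares of such b.

    The amplification serves twice. It turns a series of vector functionals into one vector
    functional. Moreover K contains countably many orthogonal copies of itself on which the diagonal
    operators act alike, so that a square-summable sequence of vectors can be packed into a single
    vector.

    By means of the m_i, a vector functional composed with E is again a vector functional on M, and
    normality is immediate. For uniqueness, support below z forces E'(1 - z) = 0 and hence values in
    z D; the module property and preservation of w then give the characterising equations. *)

Section ComplexNumbers.
Context {R : realType}.
Local Notation C := (Cplx R).

Definition re (c : C) : R := complex.Re c.
Definition toC (r : R) : C := real_complex R r.
Definition cn (c : C) : R := re `|c|.

Lemma reD (a b : C) : re (a + b) = re a + re b.
Proof. by case: a b => [? ?] [? ?]. Qed.
Lemma reN (a : C) : re (- a) = - re a.
Proof. by case: a => [? ?]. Qed.
Lemma reB (a b : C) : re (a - b) = re a - re b.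
Proof. by rewrite reD reN. Qed.
Lemma re0 : re 0 = 0. Proof. by []. Qed.
Lemma re_sum (I : Type) (s : seq I) (F : I -> C) :
  re (\sum_(i <- s) F i) = \sum_(i <- s) re (F i).
Proof. by elim/big_rec2: _ => [|i y x _ <-]; rewrite ?re0 ?reD. Qed.
Lemma re_conj (a : C) : re (a^*) = re a.
Proof. by case: a. Qed.
Lemma toCK (r : R) : re (toC r) = r. Proof. by []. Qed.
Lemma toCD (a b : R) : toC (a + b) = toC a + toC b.
Proof. by rewrite /toC rmorphD. Qed.
Lemma toCM (a b : R) : toC (a * b) = toC a * toC b.
Proof. by rewrite /toC rmorphM. Qed.
Lemma toC0 : toC 0 = 0. Proof. by []. Qed.
Lemma toC1 : toC 1 = 1. Proof. by []. Qed.
Lemma toC_conj (r : R) : (toC r)^* = toC r.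
Proof. by rewrite /toC; apply: conjc_real. Qed.
Lemma re_toCM (r : R) (c : C) : re (toC r * c) = r * re c.
Proof. by case: c => [a b] /=; rewrite /re/= mul0r subr0. Qed.
Lemma ge0_toC (c : C) : 0 <= c -> c = toC (re c).
Proof.
by case: c => a b; rewrite lecE /= => /andP[/eqP -> _].
Qed.
Lemma toC_ge0 (r : R) : (0 <= toC r) = (0 <= r).
Proof. by rewrite /toC -ler0c. Qed.
Lemma re_ge0 (c : C) : 0 <= c -> 0 <= re c.
Proof. by move=> h; rewrite -toC_ge0 -ge0_toC. Qed.
Lemma toC_inj (a b : R) : toC a = toC b -> a = b.
Proof. by move=> [->]. Qed.
Lemma toC_le (a b : R) : (toC a <= toC b) = (a <= b).
Proof. exact: lecR. Qed.
Lemma toCN (a : R) : toC (- a) = - toC a.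
Proof. by rewrite /toC rmorphN. Qed.
Lemma norm_re_le (c : C) : toC `|re c| <= `|c|.
Proof.
rewrite normc_def /re /= lecR -sqrtr_sqr ler_sqrt ?lerDl ?sqr_ge0 //.
by rewrite addr_ge0 ?sqr_ge0.
Qed.
Lemma toC_re_eq (c : C) : c^* = c -> c = toC (re c).
Proof.
case: c => a b [] h; rewrite /toC /re /= -complexr0; congr (_ +i* _)%C.
by move: h => /= h; lra.
Qed.

Lemma normE (c : C) : `|c| = toC (cn c).
Proof. by rewrite /cn -ge0_toC. Qed.
Lemma cn_ge0 c : 0 <= cn c.
Proof. by rewrite re_ge0. Qed.
Lemma cn_leD (a b : C) : cn (a + b) <= cn a + cn b.
Proof. by have := ler_normD a b; rewrite !normE -toCD toC_le. Qed.
Lemma cnM (a b : C) : cn (a * b) = cn a * cn b.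
Proof. by have := normrM a b; rewrite !normE -toCM => /toC_inj. Qed.
Lemma cnN (a : C) : cn (- a) = cn a.
Proof. by rewrite /cn normrN. Qed.
Lemma cn_conj (a : C) : cn (a^*) = cn a.
Proof. by rewrite /cn norm_conjC. Qed.
Lemma cn0 : cn 0 = 0. Proof. by rewrite /cn normr0. Qed.
Lemma cn_eq0 (a : C) : cn a = 0 -> a = 0.
Proof. by move=> h; apply/eqP; rewrite -normr_eq0 normE h toC0. Qed.
Lemma cn_toC (r : R) : 0 <= r -> cn (toC r) = r.
Proof. by move=> h; rewrite /cn ger0_norm ?toC_ge0. Qed.
Lemma cnK (c : C) : c * c^* = toC (cn c ^+ 2).
Proof. by rewrite -normCK normE expr2 -toCM expr2. Qed.
Lemma re_le_cn (c : C) : `|re c| <= cn c.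
Proof.
by rewrite -toC_le -normE norm_re_le.
Qed.
Lemma re_le (c : C) : re c <= cn c.
Proof. exact: le_trans (ler_norm _) (re_le_cn c). Qed.
Lemma conj_of_real (g h : C) :
  (g + h)^* = g + h -> ('i * (g - h))^* = 'i * (g - h) -> h = g^*.
Proof.
rewrite rmorphM rmorphD rmorphB /= conjCi mulNr -mulrN => e1.
move=> /(mulfI (neq0Ci _)) e2.
have : (h - g^*) *+ 2 = (h + g) - (g - h) - g^* *+ 2 by ring.
rewrite [h + g]addrC -e1 -e2.
have -> : g^* + h^* - - (g^* - h^*) - g^* *+ 2 = 0 by ring.
by move=> /eqP; rewrite mulrn_eq0 /= subr_eq0 => /eqP.
Qed.

(* Test with t = - g^* / (1 + b). *)
Lemma quadratic_ge0 (g : C) (b : R) : 0 <= b ->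
  (forall t : C, 0 <= re (t * g) *+ 2 + cn t ^+ 2 * b) -> g = 0.
Proof.
move=> b0 h; apply: cn_eq0; apply/eqP; rewrite eq_le cn_ge0 andbT leNgt.
apply/negP => g0.
have r0 : 0 < (1 + b)^-1 by rewrite invr_gt0; lra.
have := h (toC (- (1 + b)^-1) * g^*).
rewrite -mulrA [_ * g]mulrC cnK re_toCM toCK cnM cn_conj.
rewrite [toC (- _)]toCN cnN (cn_toC (ltW r0)) exprMn.
set r := (1 + b)^-1 in r0 *; set q := cn g ^+ 2.
have q0 : 0 < q by rewrite exprn_gt0.
have rb : r * (1 + b) = 1 by rewrite mulVf//; lra.
have -> : - r * q *+ 2 + r ^+ 2 * q * b = (r * q) * (r * (1 + b) - 2 - r).
  by rewrite -mulr_natl; ring.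
rewrite rb; have rq : 0 < r * q by rewrite mulr_gt0.
rewrite pmulr_rge0//; lra.
Qed.

(** The discriminant argument behind all Cauchy-Schwarz inequalities below, for forms that may be
    degenerate. If b > 0 the minimiser is t = - g^* / b; if b = 0, a large multiple of - g^* is a
    contradiction unless g = 0. *)
Lemma psd_CS (a b : R) (g : C) : 0 <= a -> 0 <= b ->
  (forall t : C, 0 <= a + re (t * g) *+ 2 + cn t ^+ 2 * b) ->
  cn g ^+ 2 <= a * b.
Proof.
move=> a0 b0 h; have [b1|b1] := eqVneq b 0.
  rewrite b1 mulr0; have [->|g0] := eqVneq (cn g) 0; first by rewrite expr0n.
  have q0 : 0 < cn g ^+ 2 by rewrite exprn_gt0// lt_def g0 cn_ge0.
  have r0 : 0 <= (a + 1) / cn g ^+ 2 by rewrite divr_ge0 ?sqr_ge0 ?addr_ge0.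
  have := h (- (toC ((a + 1) / cn g ^+ 2) * g^*)).
  rewrite mulNr reN -mulrA [_ * g]mulrC cnK re_toCM toCK mulfVK ?gt_eqF//.
  by rewrite b1 mulr0; lra.
have bp : 0 < b by rewrite lt_def b1.
have := h (- (toC b^-1 * g^*)).
rewrite mulNr reN -mulrA [_ * g]mulrC cnK re_toCM toCK cnN cnM cn_conj.
rewrite cn_toC ?invr_ge0// exprMn; set q := cn g ^+ 2 => hh.
have : 0 <= (a + - (b^-1 * q) *+ 2 + b^-1 ^+ 2 * q * b) * b.
  by rewrite mulr_ge0.
have -> : (a + - (b^-1 * q) *+ 2 + b^-1 ^+ 2 * q * b) * b = a * b - q.
  by rewrite -mulr_natl; field.
lra.
Qed.

End ComplexNumbers.

(** * Hilbert spaces and the Riesz lemma *)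

(* Both H and its amplification are instances; cl, lim_to and nrm below are
   the real-valued counterparts of the topology of H. *)
Record hilbert (R : realType) := Hilbert {
  hsort :> lmodType (Cplx R);
  ip : hsort -> hsort -> Cplx R;
  ipPl : forall a u v w, ip (a *: u + v) w = a * ip u w + ip v w;
  ipC : forall u v, ip v u = (ip u v)^*;
  ip_ge0 : forall u, 0 <= ip u u;
  ip_def : forall u, ip u u = 0 -> u = 0;
  ip_complete : forall f : nat -> hsort,
    (forall e : R, 0 < e -> exists N, forall m n, (N <= m)%N -> (N <= n)%N ->
      re (ip (f m - f n) (f m - f n)) < e) ->
    exists l, forall e : R, 0 < e -> exists N, forall n, (N <= n)%N ->
      re (ip (f n - l) (f n - l)) < e }.

Section InnerProduct.
Context {R : realType} {V : hilbert R}.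
Local Notation C := (Cplx R).
Implicit Types (u v w : V) (a : C).

Definition nsq u : R := re (ip u u).
Definition nrm u : R := Num.sqrt (nsq u).

Lemma ip_nsq u : ip u u = toC (nsq u).
Proof. by rewrite -ge0_toC ?ip_ge0. Qed.
Lemma ipDl u v w : ip (u + v) w = ip u w + ip v w.
Proof. by rewrite -[u in LHS]scale1r ipPl mul1r. Qed.
Lemma ip0l w : ip (0 : V) w = 0.
Proof.
have /eqP := ipDl 0 0 w; rewrite addr0 -subr_eq0 opprD addrA subrr add0r.
by rewrite oppr_eq0 => /eqP.
Qed.
Lemma ipZl a u w : ip (a *: u) w = a * ip u w.
Proof. by rewrite -[a *: u]addr0 ipPl ip0l addr0. Qed.
Lemma ipNl u w : ip (- u) w = - ip u w.
Proof. by rewrite -scaleN1r ipZl mulN1r. Qed.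
Lemma ipBl u v w : ip (u - v) w = ip u w - ip v w.
Proof. by rewrite ipDl ipNl. Qed.
Lemma ipDr u v w : ip w (u + v) = ip w u + ip w v.
Proof. by rewrite ipC ipDl rmorphD /= -!ipC. Qed.
Lemma ip0r w : ip w (0 : V) = 0.
Proof. by rewrite ipC ip0l rmorph0. Qed.
Lemma ipZr a u w : ip w (a *: u) = a^* * ip w u.
Proof. by rewrite ipC ipZl rmorphM /= -ipC. Qed.
Lemma ipNr u w : ip w (- u) = - ip w u.
Proof. by rewrite ipC ipNl rmorphN /= -ipC. Qed.
Lemma ipBr u v w : ip w (u - v) = ip w u - ip w v.
Proof. by rewrite ipDr ipNr. Qed.
Lemma ip_suml (I : Type) (s : seq I) (F : I -> V) w :
  ip (\sum_(i <- s) F i) w = \sum_(i <- s) ip (F i) w.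
Proof. by elim/big_rec2: _ => [|i y x _ <-]; rewrite ?ip0l ?ipDl. Qed.
Lemma ip_sumr (I : Type) (s : seq I) (F : I -> V) w :
  ip w (\sum_(i <- s) F i) = \sum_(i <- s) ip w (F i).
Proof. by elim/big_rec2: _ => [|i y x _ <-]; rewrite ?ip0r ?ipDr. Qed.

Lemma nsq_ge0 u : 0 <= nsq u.
Proof. by rewrite re_ge0 ?ip_ge0. Qed.
Lemma nsq_eq0 u : nsq u = 0 -> u = 0.
Proof. by move=> h; apply: ip_def; rewrite ip_nsq h. Qed.
Lemma nsqD u v : nsq (u + v) = nsq u + re (ip u v) *+ 2 + nsq v.
Proof.
rewrite /nsq ipDl !ipDr !reD [ip v u]ipC re_conj -/(nsq u) -mulr_natl; ring.
Qed.
Lemma nsqZ a u : nsq (a *: u) = cn a ^+ 2 * nsq u.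
Proof. by rewrite /nsq ipZl ipZr mulrA cnK re_toCM. Qed.
Lemma nsqN u : nsq (- u) = nsq u.
Proof. by rewrite /nsq ipNl ipNr opprK. Qed.
Lemma nsqB u v : nsq (u - v) = nsq u - re (ip u v) *+ 2 + nsq v.
Proof. by rewrite nsqD nsqN ipNr reN mulNrn. Qed.
Lemma parallelogram u v : nsq (u + v) + nsq (u - v) = (nsq u + nsq v) *+ 2.
Proof. by rewrite nsqD nsqB; ring. Qed.
Lemma nsqD_le u v : nsq (u + v) <= (nsq u + nsq v) *+ 2.
Proof. by rewrite -parallelogram lerDl nsq_ge0. Qed.

Lemma nrm_ge0 u : 0 <= nrm u. Proof. exact: sqrtr_ge0. Qed.
Lemma nrm_sqr u : nrm u ^+ 2 = nsq u.
Proof. by rewrite sqr_sqrtr ?nsq_ge0. Qed.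
Lemma nrm_eq0 u : nrm u = 0 -> u = 0.
Proof. by move=> h; apply: nsq_eq0; rewrite -nrm_sqr h expr0n. Qed.
Lemma nsq0 : nsq 0 = 0. Proof. by rewrite /nsq ip0l. Qed.
Lemma nrm0 : nrm 0 = 0. Proof. by rewrite /nrm nsq0 sqrtr0. Qed.
Lemma nrmN u : nrm (- u) = nrm u. Proof. by rewrite /nrm nsqN. Qed.
Lemma nrm_distC u v : nrm (u - v) = nrm (v - u).
Proof. by rewrite -nrmN opprB. Qed.
Lemma nrmZ a u : nrm (a *: u) = cn a * nrm u.
Proof. by rewrite /nrm nsqZ sqrtrM ?sqr_ge0// sqrtr_sqr ger0_norm// cn_ge0. Qed.

Lemma CS u v : cn (ip u v) <= nrm u * nrm v.
Proof.
rewrite -(@ler_pXn2r _ 2) ?nnegrE ?mulr_ge0 ?cn_ge0 ?nrm_ge0//.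
rewrite exprMn !nrm_sqr.
apply: psd_CS => [||t]; rewrite ?nsq_ge0//.
have := nsq_ge0 (u + t^* *: v).
by rewrite nsqD ipZr conjCK nsqZ cn_conj.
Qed.

Lemma nrmD u v : nrm (u + v) <= nrm u + nrm v.
Proof.
rewrite -(@ler_pXn2r _ 2) ?nnegrE ?addr_ge0 ?nrm_ge0// nrm_sqr nsqD sqrrD.
rewrite !nrm_sqr lerD2r lerD2l lerMn2r /=.
exact: le_trans (re_le _) (CS _ _).
Qed.
Lemma nrmB u v w : nrm (u - w) <= nrm (u - v) + nrm (v - w).
Proof. by apply: le_trans (nrmD _ _); rewrite addrA subrK. Qed.
Lemma nrm_le_nsq u (c : R) : 0 <= c -> (nrm u <= c) = (nsq u <= c ^+ 2).
Proof.
by move=> c0; rewrite -nrm_sqr ler_pXn2r ?nnegrE ?nrm_ge0.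
Qed.
Lemma nrm_lt_nsq u (c : R) : 0 <= c -> (nrm u < c) = (nsq u < c ^+ 2).
Proof.
by move=> c0; rewrite -nrm_sqr ltr_pXn2r ?nnegrE ?nrm_ge0.
Qed.
Lemma ip_eqP u v : (forall w, ip u w = ip v w) -> u = v.
Proof.
move=> h; apply/eqP; rewrite -subr_eq0; apply/eqP/ip_def.
by rewrite ipBl h subrr.
Qed.

Definition cl (Z : V -> Prop) u :=
  forall e : R, 0 < e -> exists2 s, Z s & nrm (u - s) < e.
Definition lin_set (Z : V -> Prop) :=
  Z 0 /\ forall a s t, Z s -> Z t -> Z (a *: s + t).

Lemma sub_cl (Z : V -> Prop) u : Z u -> cl Z u.
Proof. by move=> Zu e e0; exists u; rewrite ?subrr ?nrm0. Qed.
Lemma cl_sub (Z Z' : V -> Prop) u :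
  (forall s, Z s -> cl Z' s) -> cl Z u -> cl Z' u.
Proof.
move=> ZZ' Zu e e0.
have e2 : 0 < e / 2 by lra.
have [s Zs us] := Zu _ e2; have [t Zt st] := ZZ' _ Zs _ e2.
by exists t => //; apply: le_lt_trans (nrmB _ s _) _; lra.
Qed.
Lemma cl_lin (Z : V -> Prop) : lin_set Z -> lin_set (cl Z).
Proof.
move=> [Z0 ZD]; split; first exact: sub_cl.
move=> a s t Zs Zt e e0.
have a0 := cn_ge0 a.
have d0 : 0 < e / (2 * (cn a + 1)) by rewrite divr_gt0//; lra.
have e2 : 0 < e / 2 by lra.
have [s' Zs' ss'] := Zs _ d0; have [t' Zt' tt'] := Zt _ e2.
exists (a *: s' + t'); first exact: ZD.
rewrite opprD addrACA -scalerBr; apply: le_lt_trans (nrmD _ _) _.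
have : cn a * nrm (s - s') <= e / 2; last by rewrite nrmZ; lra.
apply: le_trans (ler_wpM2l a0 (ltW ss')) _.
rewrite mulrA ler_pdivrMr; last by lra.
by have := mulr_ge0 a0 (ltW e0); nra.
Qed.

Lemma cl_ext (Z : V -> Prop) (f : V -> C) (c : R) u :
  (forall s, Z s -> f s = 0) ->
  (forall s t, cn (f s - f t) <= c * nrm (s - t)) -> cl Z u -> f u = 0.
Proof.
move=> fZ fc Zu; apply: cn_eq0; apply/eqP; rewrite eq_le cn_ge0 andbT.
apply/ler_addgt0Pr => e e0; rewrite add0r.
have c0 : 0 < `|c| + 1 by rewrite ltr_wpDl.
have [s Zs us] := Zu _ (divr_gt0 e0 c0).
have := fc u s; rewrite (fZ s Zs) subr0 => /le_trans; apply.
move: us; rewrite ltr_pdivlMr// => us.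
have := ler_norm c; have := nrm_ge0 (u - s); nra.
Qed.
Lemma cl_orth (Z : V -> Prop) u v :
  (forall s, Z s -> ip s v = 0) -> cl Z u -> ip u v = 0.
Proof.
move=> h; apply: (@cl_ext Z (fun s => ip s v) (nrm v)) => // s t.
by rewrite -ipBl mulrC; apply: CS.
Qed.
Lemma cl_orth_eq0 (Z : V -> Prop) u :
  (forall s, Z s -> ip s u = 0) -> cl Z u -> u = 0.
Proof. by move=> h Zu; apply: ip_def; exact: cl_orth h Zu. Qed.

(** A vector in the closure of [Z] can be tested against [Z] alone: approximate the second factor in
    <u, u> = <u, u - s> + <u, s>. *)
Lemma cl_nrm_le (Z : V -> Prop) u (c : R) : 0 <= c -> cl Z u ->
  (forall s, Z s -> cn (ip u s) <= c * nrm s) -> nrm u <= c.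
Proof.
move=> c0 Zu h; have [n0|n0] := eqVneq (nrm u) 0; first by rewrite n0.
have u0 : 0 < nrm u by rewrite lt_def n0 nrm_ge0.
rewrite -(ler_pM2l u0) -expr2 nrm_sqr; apply/ler_addgt0Pr => e e0.
(* The error terms are |u| |u - s| and c |u - s|, the latter from |s| <= |u| + |u - s|. *)
have k0 : 0 < nrm u + c + 1 by rewrite ltr_wpDl// addr_ge0 ?nrm_ge0.
have [s Zs] := Zu _ (divr_gt0 e0 k0); rewrite ltr_pdivlMr// => us.
have -> : nsq u = re (ip u (u - s)) + re (ip u s) by rewrite -reD -ipDr subrK.
have h1 := le_trans (re_le _) (CS u (u - s)).
have h2 := le_trans (re_le _) (h _ Zs).
have su : nrm s <= nrm u + nrm (u - s).
  by have := nrmD u (- (u - s)); rewrite nrmN opprB addrC subrK.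
have := ler_wpM2l c0 su; have := nrm_ge0 (u - s); nra.
Qed.

Lemma inv_small (e : R) : 0 < e ->
  exists N, forall n, (N <= n)%N -> n.+1%:R^-1 < e.
Proof.
move=> e0; exists (Num.bound e^-1) => n Nn.
rewrite invf_plt ?posrE//.
apply: lt_le_trans (archi_boundP _) _; first by rewrite invr_ge0 ltW.
by rewrite ler_nat (leq_trans Nn).
Qed.

Definition lim_to (f : nat -> V) l :=
  forall e : R, 0 < e -> exists N, forall n, (N <= n)%N -> nrm (f n - l) < e.

Lemma complete (f : nat -> V) :
  (forall e : R, 0 < e -> exists N, forall m n, (N <= m)%N -> (N <= n)%N ->
      nrm (f m - f n) < e) -> exists l, lim_to f l.
Proof.
move=> h; have [|l hl] := @ip_complete _ V f.
  move=> e e0; have se : 0 < Num.sqrt e by rewrite sqrtr_gt0.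
  have [N hN] := h _ se; exists N => m n Nm Nn.
  by have := hN _ _ Nm Nn; rewrite nrm_lt_nsq ?sqrtr_ge0// sqr_sqrtr// ltW.
exists l => e e0; have [|N hN] := hl (e ^+ 2); first by rewrite exprn_gt0.
by exists N => n /hN; rewrite -nrm_lt_nsq// ltW.
Qed.

(* Minimise |v|^2 - 2 Re c over the relation: by the parallelogram law the
   first components of a minimising sequence converge, and their limit
   represents the functional. *)
Lemma riesz (G : V -> C -> Prop) (k : R) :
  G 0 0 ->
  (forall a v c v' c', G v c -> G v' c' -> G (a *: v + v') (a * c + c')) ->
  (forall v c, G v c -> cn c <= k * nrm v) ->
  exists s, cl (fun v => exists c, G v c) s /\ forall v c, G v c -> c = ip v s.
Proof.
move=> G0 GD Gk.
pose Q v (c : C) := nsq v - re c *+ 2.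
pose S : set R := [set r | exists v c, G v c /\ r = Q v c].
have Sinf : has_inf S.
  split; first by exists (Q 0 0), 0, 0.
  exists (- k ^+ 2) => _ [v [c [Gvc ->]]].
  have := le_trans (re_le c) (Gk _ _ Gvc); rewrite /Q -nrm_sqr -mulr_natl.
  by have := sqr_ge0 (nrm v - k); nra.
pose m := inf S.
have Qm v c : G v c -> m <= Q v c.
  by move=> Gvc; apply: ge_inf; [case: Sinf|exists v, c].
have /choice [p hp] : forall n : nat, exists p : V * C,
    G p.1 p.2 /\ Q p.1 p.2 < m + n.+1%:R^-1.
  move=> n; have n0 : (0 : R) < n.+1%:R^-1 by rewrite invr_gt0.
  by have [_ [v [c [Gvc ->]]] lt] := inf_adherent n0 Sinf; exists (v, c).
pose vn n := (p n).1; pose cc n := (p n).2.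
have Gn n : G (vn n) (cc n) by case: (hp n).
have Qn n : Q (vn n) (cc n) < m + n.+1%:R^-1 by case: (hp n).
have par v c v' c' : G v c -> G v' c' ->
    nsq (v - v') <= (Q v c + Q v' c' - m *+ 2) *+ 2.
  move=> Gv Gv'.
  have GV : G (v + v') (c + c') by have := GD 1 _ _ _ _ Gv Gv'; rewrite scale1r mul1r.
  (* The midpoint of the two pairs lies in the relation, so its value of [Q] is at least [m]. *)
  have := Qm _ _ (GD (toC 2^-1) _ _ _ _ GV G0).
  rewrite !addr0 /Q nsqZ re_toCM cn_toC ?invr_ge0// reD.
  have := parallelogram v v'; lra.
have [|s vs] := @complete vn.
  move=> e e0; have e4 : 0 < e ^+ 2 / 4 by rewrite divr_gt0 ?exprn_gt0.
  have [N hN] := inv_small e4; exists N => i j Ni Nj.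
  rewrite nrm_lt_nsq ?ltW//; apply: le_lt_trans (par _ _ _ _ (Gn i) (Gn j)) _.
  have := lt_trans (Qn i) (_ : _ < m + e ^+ 2 / 4).
  have := lt_trans (Qn j) (_ : _ < m + e ^+ 2 / 4).
  by rewrite !ltrD2l => /(_ (hN _ Nj)) h1 /(_ (hN _ Ni)) h2; lra.
exists s; split.
  move=> e e0; have [N hN] := vs _ e0; exists (vn N); first by exists (cc N).
  by rewrite nrm_distC; apply: hN.
move=> v c Gvc; apply/eqP; rewrite eq_sym -subr_eq0; apply/eqP.
(* First variation at the minimum: moving [vn n] by [t *: v] cannot bring [Q] below [m], and [Q] at
   [vn n] is already close to [m]. The factor [b] absorbs the replacement of [vn n] by its limit
   [s]. *)
apply: (@quadratic_ge0 _ _ (nsq v)) => [|t]; first exact: nsq_ge0.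
apply/ler_addgt0Pr => e e0.
pose b := cn t * nrm v + 1.
have b0 : 0 < b by rewrite ltr_wpDl// mulr_ge0 ?cn_ge0 ?nrm_ge0.
have e2 : 0 < e / 2 by lra.
have e4 : 0 < e / (4 * b) by rewrite divr_gt0//; lra.
have [N1 h1] := inv_small e2; have [N2 h2] := vs _ e4.
pose n := maxn N1 N2; have {}h1 := h1 n (leq_maxl _ _).
have {}h2 := h2 n (leq_maxr _ _).
have Qn' : Q (vn n) (cc n) < m + e / 2 by apply: lt_trans (Qn n) _; rewrite ltrD2l.
move: Qn'; have := Qm _ _ (GD t _ _ _ _ Gvc (Gn n)).
rewrite /Q nsqD nsqZ reD mulrBr reB ipZl.
have -> : ip v (vn n) = ip v s + ip v (vn n - s) by rewrite -ipDr addrC subrK.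
rewrite mulrDr reD.
have : re (t * ip v (vn n - s)) <= e / 4.
  apply: le_trans (re_le _) _; rewrite cnM.
  apply: (@le_trans _ _ (b * nrm (vn n - s))).
    have := CS v (vn n - s); have := cn_ge0 t; have := nrm_ge0 (vn n - s).
    by rewrite /b; nra.
  have -> : e / 4 = b * (e / (4 * b)) by field; rewrite gt_eqF.
  by rewrite ler_pM2l// ltW.
lra.
Qed.

End InnerProduct.

(** * Limits and bounded operators *)

Section Limits.
Context {R : realType}.
Local Notation C := (Cplx R).
Implicit Types (F G : nat -> C) (s t : C).

Definition clim F s :=
  forall e : R, 0 < e -> exists N, forall n, (N <= n)%N -> cn (F n - s) < e.
Definition hassum F s := clim (fun n => \sum_(k < n) F k) s.

Lemma clim_eq F s t : clim F s -> clim F t -> s = t.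
Proof.
move=> Fs Ft; apply/eqP; rewrite -subr_eq0; apply/eqP/cn_eq0.
apply/eqP; rewrite eq_le cn_ge0 andbT; apply/ler_addgt0Pr => e e0; rewrite add0r.
have e2 : 0 < e / 2 by lra.
have [N1 h1] := Fs _ e2; have [N2 h2] := Ft _ e2.
have {}h1 := h1 _ (leq_maxl N1 N2); have {}h2 := h2 _ (leq_maxr N1 N2).
have -> : s - t = (F (maxn N1 N2) - t) - (F (maxn N1 N2) - s) by ring.
have := cn_leD (F (maxn N1 N2) - t) (- (F (maxn N1 N2) - s)); rewrite cnN; lra.
Qed.
Lemma climD F G s t : clim F s -> clim G t -> clim (fun n => F n + G n) (s + t).
Proof.
move=> Fs Gt e e0; have e2 : 0 < e / 2 by lra.
have [N1 h1] := Fs _ e2; have [N2 h2] := Gt _ e2.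
exists (maxn N1 N2) => n; rewrite geq_max => /andP[/h1 {}h1 /h2 {}h2].
rewrite opprD addrACA; apply: le_lt_trans (cn_leD _ _) _; lra.
Qed.
Lemma climZ F s (a : C) : clim F s -> clim (fun n => a * F n) (a * s).
Proof.
move=> Fs e e0; have a0 := cn_ge0 a.
have d0 : 0 < e / (cn a + 1) by rewrite divr_gt0//; lra.
have [N h] := Fs _ d0; exists N => n /h; rewrite -mulrBr cnM ltr_pdivlMr; last lra.
by have := cn_ge0 (F n - s); nra.
Qed.
Lemma clim_conj F s : clim F s -> clim (fun n => (F n)^*) (s^*).
Proof.
by move=> h e /h[N {}h]; exists N => n /h; rewrite -rmorphB cn_conj.
Qed.
Lemma eq_clim F G s : F =1 G -> clim F s -> clim G s.
Proof. by move=> /funext ->. Qed.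
Lemma clim_le F s (B : R) : (forall n, re (F n) <= B) -> clim F s -> re s <= B.
Proof.
move=> FB Fs; apply/ler_addgt0Pr => e /Fs[N /(_ N (leqnn N))].
have := re_le_cn (F N - s); rewrite reB => /ler_normlP[h1 h2] h3.
by have := FB N; lra.
Qed.
Lemma clim_ge F s (B : R) : (forall n, B <= re (F n)) -> clim F s -> B <= re s.
Proof.
move=> FB Fs; apply/ler_addgt0Pr => e /Fs[N /(_ N (leqnn N))].
have := re_le_cn (F N - s); rewrite reB => /ler_normlP[h1 h2] h3.
by have := FB N; lra.
Qed.
Lemma hassum_eq F s t : hassum F s -> hassum F t -> s = t.
Proof. exact: clim_eq. Qed.
Lemma eq_hassum F G s : F =1 G -> hassum F s -> hassum G s.
Proof. by move=> /funext ->. Qed.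
Lemma hassumD F G s t :
  hassum F s -> hassum G t -> hassum (fun n => F n + G n) (s + t).
Proof.
by move=> Fs Gt; apply: eq_clim (climD Fs Gt) => n; rewrite big_split.
Qed.
Lemma hassumZ F s (a : C) : hassum F s -> hassum (fun n => a * F n) (a * s).
Proof.
by move=> Fs; apply: eq_clim (climZ a Fs) => n; rewrite mulr_sumr.
Qed.
Lemma hassum_conj F s : hassum F s -> hassum (fun n => (F n)^*) (s^*).
Proof.
by move=> Fs; apply: eq_clim (clim_conj Fs) => n; rewrite rmorph_sum.
Qed.
Lemma hassum0 : hassum (fun=> 0) 0.
Proof. by move=> e e0; exists 0%N => n _; rewrite big1// subrr cn0. Qed.
Lemma hassum_sum (I : Type) (r : seq I) (F : I -> nat -> C) (s : I -> C) :
  (forall i, hassum (F i) (s i)) ->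
  hassum (fun k => \sum_(i <- r) F i k) (\sum_(i <- r) s i).
Proof.
move=> h; elim: r => [|i r IH].
  by rewrite big_nil; apply: eq_hassum hassum0 => k; rewrite big_nil.
rewrite big_cons; apply: eq_hassum (hassumD (h i) IH) => k.
by rewrite big_cons.
Qed.
Lemma hassum_partial_le F s n : (forall k, 0 <= re (F k)) -> hassum F s ->
  \sum_(k < n) re (F k) <= re s.
Proof.
move=> F0 Fs; rewrite -re_sum leNgt; apply/negP => lt.
have := Fs _ (lt_le_trans (_ : 0 < re (\sum_(k < n) F k) - re s) (lexx _)).
rewrite subr_gt0 => /(_ lt)[N /(_ (maxn N n) (leq_maxl _ _))].
have := re_le_cn (\sum_(k < maxn N n) F k - s).
rewrite reB => /ler_normlP[_ h2] h3.
have : re (\sum_(k < n) F k) <= re (\sum_(k < maxn N n) F k).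
  rewrite !re_sum -!(big_mkord xpredT (fun k => re (F k))).
  rewrite (big_cat_nat (leq0n n) (leq_maxr N n)) /= lerDl.
  by apply: sumr_ge0 => k _.
lra.
Qed.

Lemma mono_bounded (s : nat -> R) (B : R) :
  (forall m n, (m <= n)%N -> s m <= s n) -> (forall n, s n <= B) ->
  exists L, [/\ L <= B, forall n, s n <= L &
    forall e, 0 < e -> exists N, forall n, (N <= n)%N -> L - e < s n].
Proof.
move=> ms sB; pose S : set R := [set s n | n in setT].
have Ss : has_sup S.
  by split; [exists (s 0%N), 0%N|exists B => _ [n _ <-]].
exists (sup S); split.
- by apply: ge_sup => [|_ [n _ <-]//]; exists (s 0%N), 0%N.
- by move=> n; apply: ub_le_sup; [case: Ss|exists n].
- move=> e e0; have [_ [N _ <-] lt] := sup_adherent e0 Ss.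
  by exists N => n Nn; apply: lt_le_trans lt (ms _ _ Nn).
Qed.
Lemma mono_sum (x : nat -> R) : (forall k, 0 <= x k) ->
  forall m n, (m <= n)%N -> \sum_(k < m) x k <= \sum_(k < n) x k.
Proof.
move=> x0 m n mn; rewrite -!(big_mkord xpredT x) (big_cat_nat (leq0n m) mn) /=.
by rewrite lerDl; apply: sumr_ge0.
Qed.
Lemma bounded_sum_tail (x : nat -> R) (B : R) : (forall k, 0 <= x k) ->
  (forall n, \sum_(k < n) x k <= B) ->
  forall e, 0 < e -> exists N, forall m n, (N <= m)%N -> (m <= n)%N ->
    \sum_(m <= k < n) x k < e.
Proof.
move=> x0 xB e e0; have [L [_ Lu Ll]] := mono_bounded (mono_sum x0) xB.
have [N hN] := Ll _ e0; exists N => m n Nm mn.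
have := hN _ Nm; have := Lu n; rewrite -!(big_mkord xpredT x).
by rewrite (big_cat_nat (leq0n m) mn) /=; lra.
Qed.
Lemma bounded_sum_to0 (x : nat -> R) (B : R) : (forall k, 0 <= x k) ->
  (forall n, \sum_(k < n) x k <= B) ->
  forall e, 0 < e -> exists N, forall n, (N <= n)%N -> x n < e.
Proof.
move=> x0 xB e e0; have [N hN] := bounded_sum_tail x0 xB e0.
by exists N => n Nn; have := hN _ _ Nn (leqnSn n); rewrite big_nat1.
Qed.

End Limits.

Section Operators.
Context {R : realType}.
Local Notation C := (Cplx R).

Definition lin (V W : hilbert R) (T : V -> W) :=
  forall (a : C) u v, T (a *: u + v) = a *: T u + T v.
Definition bnd (V W : hilbert R) (c : R) (T : V -> W) :=
  0 <= c /\ forall u, nrm (T u) <= c * nrm u.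
Definition bop (V W : hilbert R) (T : V -> W) := lin T /\ exists c, bnd c T.
Definition adj (V W : hilbert R) (S : V -> W) (T : W -> V) :=
  forall u v, ip (S u) v = ip u (T v).

Section LinearMaps.
Context {V W X : hilbert R}.
Implicit Types (S T : V -> W) (u v : V).

Lemma linD T u v : lin T -> T (u + v) = T u + T v.
Proof. by move=> lT; have := lT 1 u v; rewrite !scale1r. Qed.
Lemma lin0 T : lin T -> T 0 = 0.
Proof.
move=> lT; have /eqP := linD 0 0 lT; rewrite addr0 -subr_eq0 opprD addrA subrr.
by rewrite add0r oppr_eq0 => /eqP.
Qed.
Lemma linZ T a u : lin T -> T (a *: u) = a *: T u.
Proof. by move=> lT; have := lT a u 0; rewrite (lin0 lT) !addr0. Qed.
Lemma linN T u : lin T -> T (- u) = - T u.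
Proof. by move=> lT; rewrite -scaleN1r linZ// scaleN1r. Qed.
Lemma linB T u v : lin T -> T (u - v) = T u - T v.
Proof. by move=> lT; rewrite linD// linN. Qed.
Lemma lin_sum T (I : Type) (r : seq I) (F : I -> V) : lin T ->
  T (\sum_(i <- r) F i) = \sum_(i <- r) T (F i).
Proof.
by move=> lT; elim/big_rec2: _ => [|i y x _ <-]; rewrite ?lin0 ?linD.
Qed.
Lemma bop_lin T : bop T -> lin T. Proof. by case. Qed.
Lemma bop_id : bop (fun u : V => u).
Proof. by split=> //; exists 1; split=> // u; rewrite mul1r. Qed.
Lemma bop_comb (a : C) S T : bop S -> bop T -> bop (fun u => a *: S u + T u).
Proof.
move=> [lS [c [c0 Sc]]] [lT [d [d0 Td]]]; split=> [b u v|].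
  rewrite lS lT !scalerDr !scalerA mulrC addrACA; congr (_ + _ + _).
exists (cn a * c + d); split; first by rewrite addr_ge0 ?mulr_ge0 ?cn_ge0.
move=> u; apply: le_trans (nrmD _ _) _; rewrite nrmZ mulrDl lerD//.
by rewrite -mulrA ler_wpM2l ?cn_ge0.
Qed.
Lemma bop0 : bop (fun _ : V => 0 : W).
Proof.
split=> [a u v|]; first by rewrite scaler0 addr0.
by exists 0; split=> // u; rewrite nrm0 mul0r.
Qed.
Lemma bopZ (a : C) S : bop S -> bop (fun u => a *: S u).
Proof.
move=> bS; have := bop_comb a bS bop0.
by congr bop; apply: funext => u; rewrite addr0.
Qed.
Lemma bop_comp (S : W -> X) T : bop S -> bop T -> bop (fun u => S (T u)).
Proof.
move=> [lS [c [c0 Sc]]] [lT [d [d0 Td]]]; split=> [b u v|]; first by rewrite lT lS.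
exists (c * d); split; first exact: mulr_ge0.
by move=> u; apply: le_trans (Sc _) _; rewrite -mulrA ler_wpM2l.
Qed.
Lemma adjC S (T : W -> V) : adj S T -> adj T S.
Proof. by move=> h u v; rewrite ipC -h -ipC. Qed.
Lemma adj_lin S (T : W -> V) : adj S T -> lin S.
Proof.
by move=> h a u v; apply: ip_eqP => w; rewrite h !ipPl !h.
Qed.
End LinearMaps.

Section Adjoints.
Context {V W X : hilbert R}.
Implicit Types (S T : V -> W) (u v : V).

Lemma adj_bnd S (T : W -> V) c : adj S T -> bnd c S -> bnd c T.
Proof.
move=> h [c0 Sc]; split=> // v.
have [n0|n0] := eqVneq (nrm (T v)) 0; first by rewrite n0 mulr_ge0 ?nrm_ge0.
have Tv0 : 0 < nrm (T v) by rewrite lt_def n0 nrm_ge0.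
rewrite -(ler_pM2l Tv0) -expr2 nrm_sqr /nsq -h.
apply: le_trans (re_le _) _; apply: le_trans (CS _ _) _.
by rewrite mulrA [_ * c]mulrC ler_wpM2r ?nrm_ge0.
Qed.
Lemma adj_bop S (T : W -> V) : adj S T -> bop S -> bop T.
Proof.
move=> h [_ [c cS]]; split; last by exists c; apply: adj_bnd cS.
exact: adj_lin (adjC h).
Qed.
Lemma adj_comb (a : C) S T (S' T' : W -> V) : adj S S' -> adj T T' ->
  adj (fun u => a *: S u + T u) (fun w => a^* *: S' w + T' w).
Proof.
by move=> hS hT u v; rewrite ipPl hS hT ipDr ipZr conjCK.
Qed.
Lemma adj_comp (S : W -> X) (S' : X -> W) T (T' : W -> V) :
  adj S S' -> adj T T' -> adj (fun u => S (T u)) (fun x => T' (S' x)).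
Proof. by move=> hS hT u v; rewrite hS hT. Qed.
Lemma adj_eq S (T T' : W -> V) : adj S T -> adj S T' -> T =1 T'.
Proof. by move=> h h' v; apply: ip_eqP => u; rewrite ipC -h h' -ipC. Qed.

Lemma cl_map T (Z : V -> Prop) (Z' : W -> Prop) u : bop T ->
  (forall s, Z s -> cl Z' (T s)) -> cl Z u -> cl Z' (T u).
Proof.
move=> [lT [c [c0 Tc]]] ZZ' Zu; apply: (@cl_sub _ _ (fun t => exists2 s, Z s & t = T s)).
  by move=> _ [s Zs ->]; apply: ZZ'.
move=> e e0; have d0 : 0 < e / (c + 1) by rewrite divr_gt0//; lra.
have [s Zs us] := Zu _ d0; exists (T s); first by exists s.
rewrite -linB//; apply: le_lt_trans (Tc _) _.
move: us; rewrite ltr_pdivlMr; last lra.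
by have := nrm_ge0 (u - s); nra.
Qed.
Lemma bop_ext S T (Z : V -> Prop) u : bop S -> bop T ->
  (forall s, Z s -> S s = T s) -> cl Z u -> S u = T u.
Proof.
move=> bS bT ST Zu; apply: ip_eqP => w; apply/eqP; rewrite -subr_eq0; apply/eqP.
have [lD [c [c0 Dc]]] := bop_comb (-1) bT bS.
apply: (@cl_ext _ _ Z (fun s => ip (S s) w - ip (T s) w) (c * nrm w)) => //.
  by move=> s /ST ->; rewrite subrr.
move=> s t; have := Dc (s - t); set x := _ *: _ + _ => hx.
have -> : ip (S s) w - ip (T s) w - (ip (S t) w - ip (T t) w) = ip x w.
  rewrite /x ipDl ipZl (linB s t (bop_lin bS)) (linB s t (bop_lin bT)) !ipBl; ring.
apply: le_trans (CS _ _) _; rewrite mulrAC ler_wpM2r ?nrm_ge0//.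
Qed.

Lemma lim_bop T (f : nat -> V) u : bop T -> lim_to f u -> lim_to (fun n => T (f n)) (T u).
Proof.
move=> [lT [c [c0 Tc]]] fu e e0.
have d0 : 0 < e / (c + 1) by rewrite divr_gt0//; lra.
have [N h] := fu _ d0; exists N => n /h; rewrite -linB// ltr_pdivlMr; last lra.
by have := Tc (f n - u); have := nrm_ge0 (f n - u); nra.
Qed.
Lemma lim_ip (f g : nat -> V) u v : lim_to f u -> lim_to g v ->
  clim (fun n => ip (f n) (g n)) (ip u v).
Proof.
move=> fu gv e e0.
have d1 : 0 < e / (2 * (nrm v + 1)).
  by rewrite divr_gt0// mulr_gt0// ltr_wpDl// nrm_ge0.
have d2 : 0 < e / (2 * (nrm u + 1)).
  by rewrite divr_gt0// mulr_gt0// ltr_wpDl// nrm_ge0.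
have [N1 h1] := fu _ d1; have [N2 h2] := gv _ d2; have [N3 h3] := gv _ ltr01.
exists (maxn N1 (maxn N2 N3)) => n.
rewrite !geq_max => /andP[/h1 {}h1 /andP[/h2 {}h2 /h3 {}h3]].
have -> : ip (f n) (g n) - ip u v = ip (f n - u) (g n) + ip u (g n - v).
  by rewrite ipBl ipBr; ring.
apply: le_lt_trans (cn_leD _ _) _.
apply: le_lt_trans (lerD (CS _ _) (CS _ _)) _.
have gn : nrm (g n) <= nrm v + 1.
  have := nrmD (g n - v) v; rewrite subrK; lra.
move: h1 h2; rewrite ltr_pdivlMr; last by rewrite mulr_gt0// ltr_wpDl// nrm_ge0.
rewrite ltr_pdivlMr; last by rewrite mulr_gt0// ltr_wpDl// nrm_ge0.
have := nrm_ge0 (f n - u); have := nrm_ge0 (g n - v); have := nrm_ge0 u.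
have := nrm_ge0 v; nra.
Qed.
Lemma adj_exists T : bop T -> exists T' : W -> V, adj T T'.
Proof.
move=> [lT [c [c0 Tc]]].
have /choice[T' hT'] : forall w, exists s, forall v, ip (T v) w = ip v s.
  move=> w; have [|a v d v' d'|v d|s [_ hs]] :=
      @riesz _ V (fun v d => d = ip (T v) w) (c * nrm w).
  - by rewrite lin0// ip0l.
  - by move=> -> ->; rewrite lT ipPl.
  - by move=> ->; apply: le_trans (CS _ _) _; rewrite mulrAC ler_wpM2r ?nrm_ge0.
  - by exists s => v; apply: hs.
by exists T' => u v; apply: hT'.
Qed.

End Adjoints.

(** * Orthogonal projections, and operators defined on a subspace *)

Section Projections.
Context {V : hilbert R}.
Implicit Types (Z : V -> Prop) (P T : V -> V).

(** The orthogonal projection onto the closure of [Z]; for a linear set [Z], linearity,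
    self-adjointness and the bound 1 are consequences. *)
Definition is_proj Z P :=
  (forall u, cl Z (P u)) /\ forall u s, Z s -> ip s (P u) = ip s u.

Lemma proj_exists Z : lin_set Z -> exists P, is_proj Z P.
Proof.
move=> [Z0 ZD].
have /choice[P hP] : forall u, exists s, cl Z s /\ forall v, Z v -> ip v u = ip v s.
  move=> u; have [|a v d v' d'|v d|s [cs hs]] :=
      @riesz _ V (fun v d => Z v /\ d = ip v u) (nrm u).
  - by rewrite ip0l.
  - by move=> [Zv ->] [Zv' ->]; rewrite ipPl; split=> //; apply: ZD.
  - by move=> [_ ->]; rewrite mulrC; apply: CS.
  - exists s; split; last by move=> v Zv; apply: hs.
    by apply: cl_sub cs => v [_ [Zv _]]; apply: sub_cl.
by exists P; split=> [u|u s Zs]; have [] := hP u => // _ ->.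
Qed.

Section Proj.
Variables (Z : V -> Prop) (P : V -> V).
Hypotheses (ZP : is_proj Z P) (Zl : lin_set Z).

Lemma proj_ip u s : cl Z s -> ip s (P u) = ip s u.
Proof.
move=> Zs; apply/eqP; rewrite -subr_eq0 -ipBr; apply/eqP.
by apply: cl_orth Zs => t Zt; rewrite ipBr ZP.2// subrr.
Qed.
Lemma proj_uniq u v : cl Z v -> (forall s, Z s -> ip s v = ip s u) -> P u = v.
Proof.
move=> Zv h; apply/eqP; rewrite -subr_eq0; apply/eqP.
apply: (@cl_orth_eq0 _ _ Z) => [s Zs|]; first by rewrite ipBr ZP.2// h// subrr.
rewrite addrC -scaleN1r; apply: (cl_lin Zl).2 => //; exact: ZP.1.
Qed.
Lemma proj_id u : cl Z u -> P u = u.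
Proof. by move=> Zu; apply: proj_uniq. Qed.
Lemma proj_idem u : P (P u) = P u.
Proof. by apply: proj_id; apply: ZP.1. Qed.
Lemma proj_adj : adj P P.
Proof.
move=> u v; rewrite -(proj_ip v (ZP.1 u)) [LHS]ipC.
by rewrite (proj_ip u (ZP.1 v)) -ipC.
Qed.
Lemma proj_bnd : bnd 1 P.
Proof.
split=> // u; rewrite mul1r nrm_le_nsq ?nrm_ge0// nrm_sqr.
have : nsq (P u) = re (ip (P u) u) by rewrite /nsq proj_ip//; apply: ZP.1.
by have := nsq_ge0 (u - P u); rewrite nsqB [ip u _]ipC re_conj; lra.
Qed.
Lemma proj_bop : bop P.
Proof. by split; [apply: adj_lin proj_adj|exists 1; apply: proj_bnd]. Qed.
(** Invariance of [Z] under the adjoint makes the orthogonal complement invariant under [S], so [S]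
    respects the decomposition. *)
Lemma proj_comm (S S' : V -> V) : bop S -> adj S S' ->
  (forall s, Z s -> cl Z (S s)) -> (forall s, Z s -> Z (S' s)) ->
  forall u, P (S u) = S (P u).
Proof.
move=> bS SS' ZS ZS' u; apply: proj_uniq.
  by apply: (cl_map (Z := Z)) => //; apply: ZP.1.
move=> s Zs; have S'S := adjC SS'.
by rewrite -!S'S ZP.2//; apply: ZS'.
Qed.
End Proj.

(* T is obtained as the adjoint of the operator T* that the Riesz lemma
   provides from <b, v> = <a, T* v> for all pairs (a, b) of the relation. *)
Lemma ext_op (G : V -> V -> Prop) (c : R) : 0 <= c -> G 0 0 ->
  (forall a u u' v v', G u u' -> G v v' -> G (a *: u + v) (a *: u' + v')) ->
  (forall u u', G u u' -> nrm u' <= c * nrm u) ->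
  exists T, [/\ lin T, bnd c T, forall u u', G u u' -> T u = u',
    forall u, (forall a b, G a b -> ip a u = 0) -> T u = 0 &
    forall S S', bop S -> adj S S' -> (forall a b, G a b -> G (S a) (S b)) ->
      (forall a b, G a b -> G (S' a) (S' b)) -> forall u, T (S u) = S (T u)].
Proof.
move=> c0 G0 GD Gc; pose Z a := exists b, G a b.
have Zlin : lin_set Z.
  split; first by exists 0.
  by move=> a s t [s' ss'] [t' tt']; exists (a *: s' + t'); apply: GD.
have /choice[T' hT'] : forall v, exists s,
    cl Z s /\ forall a b, G a b -> ip b v = ip a s.
  move=> v; have [|a u d u' d'|u d|s [cs hs]] :=
      @riesz _ V (fun a d => exists b, G a b /\ d = ip b v) (c * nrm v).
  - by exists 0; rewrite ip0l.
  - move=> [b [Gub ->]] [b' [Gub' ->]]; exists (a *: b + b').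
    by rewrite ipPl; split=> //; apply: GD.
  - move=> [b [Gub ->]]; apply: le_trans (CS _ _) _.
    by rewrite mulrAC ler_wpM2r ?nrm_ge0//; apply: Gc.
  - exists s; split; last by move=> a b Gab; apply: hs; exists b.
    by apply: cl_sub cs => a [_ [b [Gab _]]]; apply: sub_cl; exists b.
have T'Z v : cl Z (T' v) by have [] := hT' v.
have T'G v a b : G a b -> ip b v = ip a (T' v) by have [_] := hT' v; apply.
have T'eq v w : cl Z w -> (forall a b, G a b -> ip b v = ip a w) -> T' v = w.
  move=> Zw h; apply/eqP; rewrite -subr_eq0; apply/eqP.
  apply: (@cl_orth_eq0 _ _ Z) => [s [b Gsb]|].
    by rewrite ipBr -(T'G _ _ _ Gsb) -(h _ _ Gsb) subrr.
  by rewrite addrC -scaleN1r; apply: (cl_lin Zlin).2.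
have lT' : lin T'.
  move=> a u v; apply: T'eq; first exact: (cl_lin Zlin).2.
  by move=> x y Gxy; rewrite !ipDr !ipZr !(T'G _ _ _ Gxy).
have bT' : bnd c T'.
  split=> // v; apply: (cl_nrm_le (mulr_ge0 c0 (nrm_ge0 v)) (T'Z v)) => s [b Gsb].
  rewrite ipC cn_conj -(T'G _ _ _ Gsb); apply: le_trans (CS _ _) _.
  by rewrite mulrAC ler_wpM2r ?nrm_ge0//; apply: Gc.
have [T hT] := adj_exists (conj lT' (ex_intro _ c bT')).
have TT' u v : ip (T u) v = ip u (T' v) by rewrite ipC -hT -ipC.
have T'Z0 u v : (forall a b, G a b -> ip a u = 0) -> ip (T' v) u = 0.
  by move=> h; apply: (@cl_orth _ _ Z) (T'Z v) => a [b /h].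
exists T; split.
- exact: adj_lin (adjC hT).
- exact: adj_bnd hT bT'.
- by move=> u u' Gu; apply: ip_eqP => v; rewrite TT' -(T'G _ _ _ Gu).
- by move=> u hu; apply: ip_eqP => v; rewrite TT' ip0l ipC T'Z0// conjC0.
move=> S S' bS SS' GS GS' u.
have bS' := adj_bop SS' bS.
(* Commutation is checked on the adjoint, whose values are determined by their inner products with
   the domain of [G]. *)
have T'S' v : T' (S' v) = S' (T' v).
  apply: T'eq; first apply: (cl_map (Z := Z)) (T'Z v) => //.
    by move=> s [b Gsb]; apply: sub_cl; exists (S' b); apply: GS'.
  by move=> a b Gab; rewrite -!SS' (T'G _ _ _ (GS _ _ Gab)).
by apply: ip_eqP => v; rewrite TT' SS' -T'S' -TT' -SS'.
Qed.

End Projections.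
End Operators.

(** * Positive operators as sums of squares *)

Section SumsOfSquares.
Context {R : realType} {V : hilbert R}.
Local Notation C := (Cplx R).
Implicit Types (a e P S T : V -> V) (u v : V).

Lemma bopB S T : bop S -> bop T -> bop (fun u => S u - T u).
Proof.
move=> bS bT; have := bop_comb (-1) bT bS.
by congr bop; apply: funext => u; rewrite scaleN1r addrC.
Qed.
Lemma adj_idem_bnd P : adj P P -> (forall u, P (P u) = P u) -> bnd 1 P.
Proof.
move=> PP Pi; split=> // u; rewrite mul1r nrm_le_nsq ?nrm_ge0// nrm_sqr.
have : nsq (P u) = re (ip (P u) u) by rewrite /nsq PP Pi -PP.
by have := nsq_ge0 (u - P u); rewrite nsqB [ip u _]ipC re_conj; lra.
Qed.

(* Since A_(k+1) = A_k - A_k^2, the squares A_k^2 telescope and sum up to a;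
   this decomposition does the work of a square root of a. *)
Definition sosq a k : V -> V := iter k (fun T u => T u - T (T u)) a.

(* Positivity: A - A^2 = A(1-A)A + (1-A)A(1-A). *)
Lemma sosq_spec a : bop a -> adj a a -> (forall u, 0 <= re (ip (a u) u)) ->
  (forall u, re (ip (a u) u) <= nsq u) -> forall k, let A := sosq a k in
  [/\ bop A, adj A A, forall u, 0 <= re (ip (A u) u) &
      forall u, re (ip (A u) u) <= nsq u].
Proof.
move=> ba aa a0 a1; elim=> [|k] //=; rewrite -/(sosq a k).
set A := sosq a k => -[bA AA A0 A1]; split.
- by apply: bopB => //; apply: bop_comp.
- by move=> u v; rewrite ipBl ipBr !AA.
- move=> u; have := A0 (u - A u); have := A1 (A u).
  rewrite (linB u (A u) (bop_lin bA)) !ipBl !ipBr !reB [ip (A (A u)) u]AA.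
  rewrite -/(nsq (A u)); lra.
- move=> u; rewrite ipBl reB [ip (A (A u)) u]AA -/(nsq (A u)).
  by have := nsq_ge0 (A u); have := A1 u; lra.
Qed.

Lemma sosq_comm a S k u : lin S -> (forall u, S (a u) = a (S u)) ->
  S (sosq a k u) = sosq a k (S u).
Proof.
move=> lS Sa; elim: k u => [|k IH] u; first exact: Sa.
by rewrite /= -!/(sosq a k) linB// !IH.
Qed.

(** After n terms the remainder is <A_n u, v>. It tends to 0 because |A_n u|^2 is the general term
    of a series with partial sums at most <a u, u>. *)
Lemma sosq_hassum a u v : bop a -> adj a a -> (forall u, 0 <= re (ip (a u) u)) ->
  (forall u, re (ip (a u) u) <= nsq u) ->
  hassum (fun k => ip (sosq a k u) (sosq a k v)) (ip (a u) v).
Proof.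
move=> ba aa a0 a1; have hs := sosq_spec ba aa a0 a1.
have tel n w : \sum_(k < n) ip (sosq a k u) (sosq a k w) =
    ip (a u) w - ip (sosq a n u) w.
  elim: n => [|n IH]; first by rewrite big_ord0 subrr.
  have [_ AA _ _] := hs n.
  rewrite big_ord_recr /= IH -/(sosq a n) ipBl
    [ip (sosq a n (sosq a n u)) w]AA; ring.
have tel' n : \sum_(k < n) nsq (sosq a k u) = re (ip (a u) u) - re (ip (sosq a n u) u).
  have := congr1 re (tel n u); rewrite re_sum reB => <-; exact: eq_bigr.
have bd n : \sum_(k < n) nsq (sosq a k u) <= re (ip (a u) u).
  by rewrite tel'; have [_ _ A0 _] := hs n; rewrite gerBl.
move=> e e0; have v0 : 0 < nrm v + 1 by rewrite ltr_wpDl ?nrm_ge0.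
have d0 : 0 < (e / (nrm v + 1)) ^+ 2 by rewrite exprn_gt0// divr_gt0.
have [N hN] := bounded_sum_to0 (fun k => nsq_ge0 (sosq a k u)) bd d0.
exists N => n /hN; rewrite -nrm_lt_nsq; last by rewrite ltW// divr_gt0.
rewrite ltr_pdivlMr// => h; rewrite tel addrAC subrr add0r cnN.
apply: le_lt_trans (CS _ _) _; have := nrm_ge0 (sosq a n u); nra.
Qed.

(** The decomposition of P e* e P. Dividing by (c + 1)^2, with c a bound of [e], puts it between 0
    and 1, and c + 1 never vanishes. Each A_k is a polynomial in P e* e P without constant term,
    hence is absorbed by [P] and commutes with whatever commutes with [P], [e] and [e']. *)
Lemma sos_form e e' P : bop e -> adj e e' -> adj P P -> (forall u, P (P u) = P u) ->
  exists A : nat -> V -> V, [/\ forall k, bop (A k) /\ adj (A k) (A k),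
    forall k u, P (A k u) = A k u, forall k u, A k (P u) = A k u,
    forall S, lin S -> (forall u, S (P u) = P (S u)) ->
      (forall u, S (e u) = e (S u)) -> (forall u, S (e' u) = e' (S u)) ->
      forall k u, S (A k u) = A k (S u) &
    forall u v, hassum (fun k => ip (A k u) (A k v)) (ip (e (P u)) (e (P v)))].
Proof.
move=> be ee' PP Pi; have [le [c [c0 ec]]] := be.
have P1 := adj_idem_bnd PP Pi; have lP := adj_lin PP.
have bP : bop P by split=> //; exists 1.
have be' := adj_bop ee' be; have le' := bop_lin be'.
pose s := c + 1; have s0 : 0 < s by rewrite /s; lra.
pose a u := toC (s ^- 2) *: P (e' (e (P u))).
have e'e := adjC ee'.
have ba : bop a by apply: bopZ; do 3! apply: bop_comp => //.
have aa : adj a a.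
  by move=> u v; rewrite ipZl ipZr toC_conj PP e'e ee' PP.
have auv u v : ip (a u) v = toC (s ^- 2) * ip (e (P u)) (e (P v)).
  by rewrite ipZl PP e'e.
have s2 : 0 <= s ^- 2 by rewrite invr_ge0 sqr_ge0.
have a0 u : 0 <= re (ip (a u) u).
  by rewrite auv re_toCM -/(nsq _) mulr_ge0 ?nsq_ge0.
have a1 u : re (ip (a u) u) <= nsq u.
  rewrite auv re_toCM -/(nsq _) mulrC ler_pdivrMr ?exprn_gt0//.
  have := ec (P u); have := P1.2 u; rewrite mul1r => h1 h2.
  have h3 : nrm (e (P u)) <= s * nrm u.
    by have := nrm_ge0 (P u); have := nrm_ge0 u; rewrite /s; nra.
  rewrite mulrC -!nrm_sqr -exprMn ler_pXn2r ?nnegrE ?mulr_ge0 ?nrm_ge0//.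
  exact: ltW.
have hs := sosq_spec ba aa a0 a1.
exists (fun k u => toC s *: sosq a k u); split.
- move=> k; have [bA AA _ _] := hs k; split; first exact: bopZ.
  by move=> u v; rewrite ipZl ipZr toC_conj AA.
- move=> k u; rewrite linZ//; congr (_ *: _).
  elim: k u => [|k IH] u; first by rewrite /sosq /= /a linZ// Pi.
  by rewrite /= -/(sosq a k) linB// !IH.
- move=> k u; congr (_ *: _).
  elim: k u => [|k IH] u; first by rewrite /sosq /= /a Pi.
  by rewrite /= -/(sosq a k) !IH.
- move=> S lS SP Se Se' k u; rewrite linZ// sosq_comm// => v.
  by rewrite /a linZ// SP Se' Se SP.
- move=> u v; have -> : ip (e (P u)) (e (P v)) = toC (s ^+ 2) * ip (a u) v.
    by rewrite auv mulrA -toCM mulfV ?toC1 ?mul1r// expf_neq0// gt_eqF.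
  apply: eq_hassum (hassumZ (toC (s ^+ 2)) (sosq_hassum u v ba aa a0 a1)) => k.
  by rewrite ipZl ipZr toC_conj mulrA -toCM -expr2.
Qed.

(** Isometries with pairwise orthogonal ranges, as in the Cuntz relations; the sum of the S_k f_k
    stores a whole sequence f in one vector. *)
Definition isometries (S S' : nat -> V -> V) := [/\ forall k, bop (S k),
  forall k, adj (S k) (S' k) &
  forall i j u, S' i (S j u) = if i == j then u else 0].

Section Isometries.
Variables S S' : nat -> V -> V.
Hypothesis SS' : isometries S S'.

Lemma isometries_ip i j u v : ip (S i u) (S j v) = if i == j then ip u v else 0.
Proof.
by have [_ h h'] := SS'; rewrite h h'; case: (i == j); rewrite ?ip0r.
Qed.

Lemma isometries_sum_ip (r : seq nat) (f g : nat -> V) : uniq r ->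
  ip (\sum_(k <- r) S k (f k)) (\sum_(k <- r) S k (g k)) =
  \sum_(k <- r) ip (f k) (g k).
Proof.
move=> ur; rewrite ip_suml; apply: eq_big_seq => i ir.
rewrite ip_sumr (bigD1_seq i)//= isometries_ip eqxx big1 ?addr0// => j ji.
by rewrite isometries_ip eq_sym (negbTE ji).
Qed.

Lemma Ssum_exists (f : nat -> V) (B : R) : (forall n, \sum_(k < n) nsq (f k) <= B) ->
  exists m, lim_to (fun n => \sum_(k < n) S k (f k)) m.
Proof.
move=> fB; apply: complete => e e0.
have e2 : 0 < e ^+ 2 by rewrite exprn_gt0.
have [N hN] := bounded_sum_tail (fun k => nsq_ge0 (f k)) fB e2.
suff H m n : (N <= m)%N -> (m <= n)%N ->
    nrm (\sum_(k < m) S k (f k) - \sum_(k < n) S k (f k)) < e.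
  exists N => m n Nm Nn; case: (leqP m n) => mn; first exact: H.
  by rewrite nrm_distC; apply: H => //; apply: ltnW.
move=> Nm mn; rewrite -!(big_mkord xpredT (fun k => S k (f k))).
rewrite (big_cat_nat (leq0n m) mn) /= opprD addrA subrr add0r nrmN.
rewrite nrm_lt_nsq ?ltW// /nsq isometries_sum_ip ?iota_uniq// re_sum.
exact: hN.
Qed.

(** An operator that commutes with the isometries acts block by block, so a series of vector
    functionals becomes a single one. *)
Lemma Ssum_ip (x : V -> V) (f g : nat -> V) u v : bop x ->
  (forall k w, x (S k w) = S k (x w)) ->
  lim_to (fun n => \sum_(k < n) S k (f k)) u ->
  lim_to (fun n => \sum_(k < n) S k (g k)) v ->
  hassum (fun k => ip (x (f k)) (g k)) (ip (x u) v).
Proof.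
move=> bx xS fu gv; apply: eq_clim (lim_ip (lim_bop bx fu) gv) => n.
rewrite (lin_sum _ _ (bop_lin bx)).
under eq_bigr do rewrite xS.
rewrite -(big_mkord xpredT (fun k => S k (x (f k)))).
rewrite -(big_mkord xpredT (fun k => S k (g k))).
by rewrite isometries_sum_ip ?iota_uniq// big_mkord.
Qed.

End Isometries.
End SumsOfSquares.

(** * Algebras of operators and vector states *)

Section StarAlgebras.
Context {R : realType} {K : hilbert R}.
Local Notation C := (Cplx R).
Implicit Types (a : C) (S T P : K -> K) (A : set (K -> K)) (u v : K).

(* The adjoint, and 0 if there is none. *)
Definition dag T : K -> K := xget (fun=> 0) [set T' | adj T T'].

Lemma dagP T : bop T -> adj T (dag T).
Proof.
by move=> /adj_exists[T' TT']; rewrite /dag; case: xgetP => [? _ //|/(_ T' TT')].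
Qed.
Lemma dagE T T' : adj T T' -> dag T = T'.
Proof.
move=> h; apply/funext; apply: (adj_eq _ h).
by rewrite /dag; case: xgetP => [? _|/(_ T' h)].
Qed.
Lemma dag_bop T : bop T -> bop (dag T).
Proof. by move=> h; apply: (adj_bop (dagP h)). Qed.
Lemma dagK T : bop T -> dag (dag T) = T.
Proof. by move=> h; apply/dagE/adjC/dagP. Qed.
Lemma ip_dagr T u v : bop T -> ip u (dag T v) = ip (T u) v.
Proof. by move=> h; rewrite dagP. Qed.
Lemma ip_dagl T u v : bop T -> ip (dag T u) v = ip u (T v).
Proof. by move=> h; rewrite (adjC (dagP h)). Qed.

Definition star_alg A := [/\ forall T, A T -> bop T, A (fun u => u),
  forall a S T, A S -> A T -> A (fun u => a *: S u + T u),
  forall S T, A S -> A T -> A (fun u => S (T u)) & forall S, A S -> A (dag S)].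

Definition cmt A : set (K -> K) :=
  [set T | bop T /\ forall S, A S -> forall u, T (S u) = S (T u)].

Definition orb A u : K -> Prop := fun v => exists2 T, A T & v = T u.

Lemma star_alg0 A : star_alg A -> A (fun=> 0).
Proof.
move=> [_ A1 AD _ _]; have := AD (-1) _ _ A1 A1.
by congr (A _); apply/funext => u; rewrite scaleN1r addNr.
Qed.
Lemma star_algZ A a T : star_alg A -> A T -> A (fun u => a *: T u).
Proof.
move=> sA AT; have [_ _ AD _ _] := sA; have := AD a _ _ AT (star_alg0 sA).
by congr (A _); apply/funext => u; rewrite addr0.
Qed.
Lemma star_algB A S T : star_alg A -> A S -> A T -> A (fun u => S u - T u).
Proof.
move=> [_ _ AD _ _] AS AT; have := AD (-1) _ _ AT AS.
by congr (A _); apply/funext => u; rewrite scaleN1r addrC.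
Qed.
Lemma star_alg_sum A (I : Type) (r : seq I) (F : I -> K -> K) : star_alg A ->
  (forall i, A (F i)) -> A (fun u => \sum_(i <- r) F i u).
Proof.
move=> sA AF; elim: r => [|i r IH].
  have := star_alg0 sA; congr (A _); apply/funext => u; by rewrite big_nil.
have [_ _ AD _ _] := sA; have := AD 1 _ _ (AF i) IH.
by congr (A _); apply/funext => u; rewrite scale1r big_cons.
Qed.

Lemma cmt_alg A : star_alg A -> star_alg (cmt A).
Proof.
move=> [Ab A1 AD AM As]; split.
- by move=> T [].
- by split; [apply: bop_id|].
- move=> a S T [bS cS] [bT cT]; split; first exact: bop_comb.
  by move=> X AX u; rewrite cS// cT// (bop_lin (Ab _ AX)).
- move=> S T [bS cS] [bT cT]; split; first exact: bop_comp.
  by move=> X AX u; rewrite cT// cS.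
- move=> S [bS cS]; split; first exact: dag_bop.
  move=> X AX u; apply: ip_eqP => v; have bX := Ab _ AX.
  rewrite ip_dagl// -[X in ip (X _) (S v)](dagK bX) ip_dagl; last exact: dag_bop.
  rewrite -cS; last exact: As.
  by rewrite -ip_dagl// -[RHS]ip_dagr// .
Qed.

Lemma orb_lin A u : star_alg A -> lin_set (orb A u).
Proof.
move=> sA; split; first by exists (fun=> 0) => //; apply: star_alg0.
have [_ _ AD _ _] := sA => a s t [S AS ->] [T AT ->].
by exists (fun u => a *: S u + T u) => //; apply: AD.
Qed.

Lemma orb_proj_comm A u P : star_alg A -> is_proj (orb A u) P -> cmt A P.
Proof.
move=> sA pP; have oL := orb_lin u sA; have [Ab _ _ AM As] := sA.
split=> [|S AS v]; first exact: proj_bop pP.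
apply: (proj_comm pP oL (Ab _ AS) (dagP (Ab _ AS))).
- by move=> _ [T AT ->]; apply: sub_cl; exists (fun u => S (T u)) => //; apply: AM.
- by move=> _ [T AT ->]; exists (fun u => dag S (T u)) => //; apply: AM => //; apply: As.
Qed.

Lemma orb_self A u : star_alg A -> orb A u u.
Proof. by move=> [_ A1 _ _ _]; exists (fun u => u). Qed.

(** An operator of [A] that kills [u] kills its orbit under the commutant, hence the closure: [P]
    plays the role of the support of [u] in [A]. *)
Lemma supp_kill A u P T : star_alg A -> is_proj (orb (cmt A) u) P ->
  A T -> T u = 0 -> forall v, T (P v) = 0.
Proof.
move=> sA pP AT Tu v; have [Ab _ _ _ _] := sA.
apply: (bop_ext (Ab _ AT) bop0 _ (pP.1 v)) => _ [S [bS cS] ->].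
by rewrite -cS// Tu (lin0 (bop_lin bS)).
Qed.

Lemma cl_lim (Z : K -> Prop) u : cl Z u ->
  exists f : nat -> K, (forall n, Z (f n)) /\ lim_to f u.
Proof.
move=> Zu; have /choice[f hf] : forall n : nat, exists s, Z s /\ nrm (u - s) < n.+1%:R^-1.
  move=> n; have n0 : (0 : R) < n.+1%:R^-1 by rewrite invr_gt0.
  by have [s Zs us] := Zu _ n0; exists s.
exists f; split=> [n|e e0]; first by case: (hf n).
have [N hN] := inv_small e0; exists N => n /hN; rewrite nrm_distC.
by apply: lt_trans; case: (hf n).
Qed.

End StarAlgebras.

(** * Radon-Nikodym theorem for functionals dominated by a vector state *)

Section VectorState.
Context {R : realType} {K : hilbert R}.
Local Notation C := (Cplx R).
Variables (M : set (K -> K)) (w : (K -> K) -> C) (y : K).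
Variables (S S' : nat -> K -> K).
Hypothesis sM : star_alg M.
Hypothesis wl : forall a X Y, M X -> M Y -> w (fun u => a *: X u + Y u) = a * w X + w Y.
Hypothesis w0 : forall X, M X -> (forall u, 0 <= ip (X u) u) -> 0 <= w X.
Hypothesis wy : forall X, M X -> (forall u, 0 <= ip (X u) u) ->
  re (w X) <= re (ip (X y) y).
Hypothesis SS' : isometries S S'.
Hypothesis MS : forall k x, M x -> forall u, x (S k u) = S k (x u).

Let Mb X : M X -> bop X. Proof. by case: sM => h _ _ _ _; apply: h. Qed.
Let M1 : M (fun u => u). Proof. by case: sM. Qed.
Let MD a X Y : M X -> M Y -> M (fun u => a *: X u + Y u).
Proof. by case: sM => _ _ h _ _; apply: h. Qed.
Let MM X Y : M X -> M Y -> M (fun u => X (Y u)).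
Proof. by case: sM => _ _ _ h _; apply: h. Qed.
Let Ms X : M X -> M (dag X). Proof. by case: sM => _ _ _ _; apply. Qed.

(** The GNS form of [w]. *)
Let B X Y := w (fun u => dag Y (X u)).

Let BPl a X Y Z : M X -> M Y -> M Z ->
  B (fun u => a *: X u + Y u) Z = a * B X Z + B Y Z.
Proof.
move=> MX MY MZ; rewrite /B -wl; [|exact: MM (Ms MZ) _..].
congr w; apply/funext => u; exact: (bop_lin (dag_bop (Mb MZ))).
Qed.
Let BPr a X Y Z : M X -> M Y -> M Z ->
  B Z (fun u => a *: X u + Y u) = a^* * B Z X + B Z Y.
Proof.
move=> MX MY MZ; rewrite /B -wl; [|exact: MM (Ms _) MZ..].
by rewrite (dagE (adj_comb a (dagP (Mb MX)) (dagP (Mb MY)))).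
Qed.
Let sq_pos X : M X -> forall u, 0 <= ip (dag X (X u)) u.
Proof. by move=> MX u; rewrite ip_dagl ?ip_ge0//; apply: Mb. Qed.
Let Bge0 X : M X -> 0 <= B X X.
Proof. by move=> MX; apply: w0; [apply: MM => //; exact: Ms|exact: sq_pos]. Qed.
Let Bley X : M X -> re (B X X) <= nsq (X y).
Proof.
move=> MX; rewrite /nsq -[in leRHS](ip_dagl _ _ (Mb MX)).
by apply: wy; [apply: MM => //; exact: Ms|exact: sq_pos].
Qed.
Let Bconj X Y : M X -> M Y -> B Y X = (B X Y)^*.
Proof.
move=> MX MY; have real Z : M Z -> (B Z Z)^* = B Z Z.
  by move=> MZ; rewrite (ge0_toC (Bge0 MZ)) toC_conj.
apply: conj_of_real.
  have -> : B X Y + B Y X = B (fun u => 1 *: X u + Y u) (fun u => 1 *: X u + Y u)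
      - B X X - B Y Y.
    rewrite BPl ?BPr//; last exact: MD.
    by rewrite conjC1; ring.
  by rewrite !rmorphB /= !real//; exact: MD.
have -> : 'i * (B X Y - B Y X) =
    B (fun u => 'i *: X u + Y u) (fun u => 'i *: X u + Y u) - B X X - B Y Y.
  rewrite BPl ?BPr//; last exact: MD.
  have ii : 'i * 'i = -1 :> C by rewrite -expr2 sqrCi.
  (* The added term is 0; with it the identity is polynomial in i. *)
  transitivity ('i * (B X Y - B Y X) - ('i * 'i + 1) * B X X).
    by rewrite ii; ring.
  by rewrite conjCi; ring.
by rewrite !rmorphB /= !real//; exact: MD.
Qed.
Let BCS X Y : M X -> M Y -> cn (B X Y) <= nrm (X y) * nrm (Y y).
Proof.
move=> MX MY.
rewrite -(@ler_pXn2r _ 2) ?nnegrE ?mulr_ge0 ?cn_ge0 ?nrm_ge0//.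
apply: (@le_trans _ _ (re (B X X) * re (B Y Y))); last first.
  rewrite exprMn !nrm_sqr ler_pM ?re_ge0 ?Bge0 ?Bley//.
rewrite mulrC; apply: psd_CS => [||t]; rewrite ?re_ge0 ?Bge0//.
have := re_ge0 (Bge0 (MD t MX MY)).
rewrite BPl ?BPr//; last exact: MD.
rewrite (Bconj MX MY) !mulrDr !reD mulrA cnK re_toCM -rmorphM re_conj; lra.
Qed.

(** By domination B(X, Y) = <T X y, Y y> with 0 <= T <= 1, and T commutes with [M]. Writing T as a
    sum of squares A_k^2 of operators commuting with [M] gives w(x) as the sum of the <x A_k y, A_k
    y>; the isometries pack the A_k y into one vector. *)
Lemma vector_state : exists z, forall x, M x -> w x = ip (x z) z.
Proof.
have oL := orb_lin y sM; have [p hp] := proj_exists oL.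
have sX X : M X -> exists s, cl (orb M y) s /\
    forall Y, M Y -> ip s (Y y) = B X Y.
  move=> MX; have [|a v d v' d'|v d|s [cs hs]] := @riesz _ K
      (fun v d => exists Y, [/\ M Y, v = Y y & d = B Y X]) (nrm (X y)).
  - exists (fun=> 0); split=> //; first exact: star_alg0.
    have := BPl (-1) M1 M1 MX; rewrite mulN1r addNr => <-; congr B.
    by apply/funext => u; rewrite scaleN1r addNr.
  - move=> [Y [MY -> ->]] [Y' [MY' -> ->]]; exists (fun u => a *: Y u + Y' u).
    by split=> //; [exact: MD|rewrite BPl].
  - by move=> [Y [MY -> ->]]; rewrite mulrC; apply: BCS.
  - exists s; split.
      by apply: cl_sub cs => v [_ [Y [MY -> _]]]; apply: sub_cl; exists Y.
    move=> Y MY; rewrite ipC -(hs (Y y) (B Y X)); first by rewrite -Bconj.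
    by exists Y.
have [|||T [lT bT TE T0 Tc]] := @ext_op _ K (fun u s => exists X,
    [/\ M X, u = X y, cl (orb M y) s & forall Y, M Y -> ip s (Y y) = B X Y]) 1 ler01.
- exists (fun=> 0); split=> //; [exact: star_alg0|exact: (cl_lin oL).1|].
  move=> Y MY; rewrite ip0l; have := BPl (-1) M1 M1 MY.
  rewrite mulN1r addNr => <-; congr B.
  by apply/funext => u; rewrite scaleN1r addNr.
- move=> a u u' v v' [X [MX -> cX hX]] [X' [MX' -> cX' hX']].
  exists (fun u => a *: X u + X' u); split=> //; first exact: MD.
    exact: (cl_lin oL).2.
  by move=> Y MY; rewrite BPl// ipPl hX// hX'.
- move=> u u' [X [MX -> cX hX]]; rewrite mul1r.
  apply: (cl_nrm_le (nrm_ge0 _) cX) => _ [Y MY ->]; rewrite hX//; exact: BCS.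
have TX X : M X -> cl (orb M y) (T (X y)) /\
    forall Y, M Y -> ip (T (X y)) (Y y) = B X Y.
  move=> MX; have [s [cs hs]] := sX X MX.
  by rewrite (TE (X y) s)//; exists X.
have TM x : M x -> forall u, x (T u) = T (x u).
  have st x' : M x' -> forall a b,
      (exists X, [/\ M X, a = X y, cl (orb M y) b & forall Y, M Y -> ip b (Y y) = B X Y]) ->
      exists X, [/\ M X, x' a = X y, cl (orb M y) (x' b) &
        forall Y, M Y -> ip (x' b) (Y y) = B X Y].
    move=> Mx' a b [X [MX -> cX hX]]; exists (fun u => x' (X u)); split=> //.
    - exact: MM.
    - apply: cl_map cX; first exact: Mb.
      by move=> _ [Y MY ->]; apply: sub_cl; exists (fun u => x' (Y u)) => //; exact: MM.
    - move=> Y MY; rewrite -(ip_dagr _ _ (Mb Mx')).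
      rewrite (hX (fun u => dag x' (Y u))); last exact: MM (Ms Mx') MY.
      rewrite /B (dagE (adj_comp (adjC (dagP (Mb Mx'))) (dagP (Mb MY)))).
      by [].
  move=> Mx u; apply/esym.
  exact: (Tc x (dag x) (Mb Mx) (dagP (Mb Mx)) (st _ Mx) (st _ (Ms Mx))).
have bT' : bop T by split=> //; exists 1.
have Tp u : T (p u) = T u.
  apply/eqP; rewrite -subr_eq0 -linB//; apply/eqP/T0 => a b [X [MX -> _ _]].
  by rewrite ipBr hp.2 ?subrr//; exists X.
have pT u : p (T u) = T u.
  apply: (proj_id hp oL); rewrite -Tp; apply: (cl_map bT' _ (hp.1 u)).
  by move=> _ [X MX ->]; case: (TX X MX).
have pp := proj_adj hp; have bp := proj_bop hp.
(* Hermitian symmetry of [B] gives equality on the orbit of [y]; off its closure both sides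
   vanish. *)
have TpT u : T u = p (dag T (p u)).
  rewrite -Tp; apply: (@bop_ext _ _ _ T (fun u => p (dag T u))) (hp.1 u) => //.
    by apply: bop_comp => //; exact: dag_bop.
  move=> _ [X MX ->]; have [cX hX] := TX X MX; apply/esym/(proj_uniq hp oL) => //.
  move=> _ [Y MY ->]; have [cY hY] := TX Y MY.
  by rewrite ip_dagr// hY// ipC hX// -Bconj.
have TT : adj T T.
  move=> u v; rewrite {1}TpT pp ip_dagl// pp Tp -pp.
  by rewrite pp pT.
have T1 u : re (ip (T u) u) <= nsq u.
  rewrite -nrm_sqr expr2; apply: le_trans (re_le _) (le_trans (CS _ _) _).
  by rewrite ler_wpM2r ?nrm_ge0//; have := bT.2 u; rewrite mul1r.
(* [T] lives on the closure of the orbit, where <T X y, X y> = B(X, X) is nonnegative. *)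
have Tge0 u : 0 <= re (ip (T u) u).
  rewrite -pT -Tp pp; have [f [fM fu]] := cl_lim (hp.1 u).
  apply: clim_ge (lim_ip (lim_bop bT' fu) fu) => n.
  have [X MX ->] := fM n; have [_ ->//] := TX X MX.
  by rewrite re_ge0// Bge0.
have hs u v := sosq_hassum u v bT' TT Tge0 T1.
have [|z hz] := Ssum_exists SS' (f := fun k => sosq T k y) (B := re (ip (T y) y)).
  move=> n; have := @hassum_partial_le _ _ _ n _ (hs y y).
  by apply=> k; rewrite re_ge0// ip_ge0.
exists z => x Mx.
have -> : w x = ip (T (x y)) y.
  have [_ ->//] := TX x Mx; rewrite /B; congr w.
  by rewrite (dagE (T' := fun u => u)).
apply: hassum_eq (hs (x y) y) _.
have MS' k u := MS k Mx u.
pose A k := sosq T k y.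
apply: eq_hassum (Ssum_ip SS' (f := A) (g := A) (Mb Mx) MS' hz hz) => k.
by rewrite /A (sosq_comm _ _ (bop_lin (Mb Mx)) (TM x Mx)).
Qed.

End VectorState.

(** * The conditional expectation *)

Section Expectation.
Context {R : realType} {K : hilbert R}.
Local Notation C := (Cplx R).
Variables (D M : set (K -> K)) (y : K) (S S' : nat -> K -> K).
Hypothesis sD : star_alg D.
Hypothesis sM : star_alg M.
Hypothesis DM : D `<=` M.
Hypothesis DD : cmt (cmt D) `<=` D.
Hypothesis tr : forall a x, D a -> M x -> ip (a (x y)) y = ip (x (a y)) y.
Hypothesis SS' : isometries S S'.
Hypothesis MS : forall k x, M x -> forall u, x (S k u) = S k (x u).
Variables (P z : K -> K).
Hypothesis hP : is_proj (orb D y) P.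
Hypothesis hz : is_proj (orb (cmt D) y) z.

Local Notation N := (cmt D).

Let sN : star_alg N := cmt_alg sD.
Let Mb X : M X -> bop X. Proof. by case: sM => h _ _ _ _; apply: h. Qed.
Let Db X : D X -> bop X. Proof. by case: sD => h _ _ _ _; apply: h. Qed.
Let Nb X : N X -> bop X. Proof. by case. Qed.
Let D1 : D (fun u => u). Proof. by case: sD. Qed.
Let DC a X Y : D X -> D Y -> D (fun u => a *: X u + Y u).
Proof. by case: sD => _ _ h _ _; apply: h. Qed.
Let Dm X Y : D X -> D Y -> D (fun u => X (Y u)).
Proof. by case: sD => _ _ _ h _; apply: h. Qed.
Let Ds X : D X -> D (dag X). Proof. by case: sD => _ _ _ _; apply. Qed.
Let Mm X Y : M X -> M Y -> M (fun u => X (Y u)).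
Proof. by case: sM => _ _ _ h _; apply: h. Qed.
Let Nm X Y : N X -> N Y -> N (fun u => X (Y u)).
Proof. by case: sN => _ _ _ h _; apply: h. Qed.
Let Ns X : N X -> N (dag X). Proof. by case: sN => _ _ _ _; apply. Qed.
Let Nc X Y u : N X -> D Y -> X (Y u) = Y (X u).
Proof. by move=> [_ h] DY; apply: h. Qed.
Let Dr X u v : D X -> ip u (dag X v) = ip (X u) v.
Proof. by move=> DX; rewrite ip_dagr//; exact: Db. Qed.
Let Dl X u v : D X -> ip (dag X u) v = ip u (X v).
Proof. by move=> DX; rewrite ip_dagl//; exact: Db. Qed.
Let Mr X u v : M X -> ip u (dag X v) = ip (X u) v.
Proof. by move=> MX; rewrite ip_dagr//; exact: Mb. Qed.
Let oD : lin_set (orb D y) := orb_lin y sD.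
Let oN : lin_set (orb N y) := orb_lin y sN.
Let PN : N P := orb_proj_comm sD hP.
Let PP := proj_adj hP.
Let zz := proj_adj hz.
Let zb := proj_bop hz.
Let Py d : D d -> P (d y) = d y.
Proof. by move=> Dd; apply: (proj_id hP oD); apply: sub_cl; exists d. Qed.
Let P1 : P y = y. Proof. exact: Py D1. Qed.

Lemma supp_in : D z.
Proof. by apply/DD/(orb_proj_comm sN hz). Qed.
Let Dz := supp_in.

Lemma supp_y : z y = y.
Proof. by apply: (proj_id hz oN); apply: sub_cl; apply: orb_self. Qed.
Let zy := supp_y.

(** With q = 1 - z, traciality gives |q d y|^2 = <d* q d y, y> = <q d d* y, y>, which is 0 because q
    y = 0. *)
Lemma supp_orb d : D d -> z (d y) = d y.
Proof.
move=> Dd; pose q u := u - z u.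
have Dq : D q by apply: star_algB.
have qq u v : ip (q u) v = ip u (q v) by rewrite ipBl ipBr zz.
have qi u : q (q u) = q u.
  by rewrite /q (linB _ _ (bop_lin zb)) (proj_idem hz oN) subrr subr0.
have : ip (q (d y)) (q (d y)) = 0.
  rewrite -qq qi -(ip_dagl _ _ (Db Dd)) (tr (Ds Dd) (x := fun u => q (d u))).
    by rewrite qq /q zy subrr ip0r.
  exact/DM/Dm.
by move/ip_def/eqP; rewrite subr_eq0 => /eqP.
Qed.

(** z d - d kills [y], hence the range of [z], so z d z = d z. The same identity for d* yields z d z
    = z d. *)
Lemma supp_central d u : D d -> z (d u) = d (z u).
Proof.
have half d' : D d' -> forall v, z (d' (z v)) = d' (z v).
  move=> Dd v; apply/eqP; rewrite -subr_eq0; apply/eqP.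
  have Dq : D (fun w => z (d' w) - d' w) by apply: star_algB => //; exact: Dm.
  by apply: (supp_kill sD hz Dq); rewrite supp_orb// subrr.
move=> Dd; rewrite -(half _ Dd); apply: ip_eqP => v.
rewrite !zz -!(ip_dagr _ _ (Db Dd)) -(half _ (Ds Dd)).
by rewrite [RHS]zz (proj_idem hz oN).
Qed.

(** Testing with e = d* gives d* y = 0; then d* vanishes on the range of [z], that is d* z = 0, and
    d = z d = 0. *)
Lemma faithful d : D d -> (forall u, z (d u) = d u) ->
  (forall e, D e -> ip (d (e y)) y = 0) -> forall u, d u = 0.
Proof.
move=> Dd zd h u.
have dy : dag d y = 0.
  by apply: ip_def; rewrite ip_dagr ?h//; [exact: Ds|exact: Db].
have dz v : dag d (z v) = 0 := supp_kill sD hz (Ds Dd) dy v.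
apply: ip_eqP => v; rewrite -zd zz -(ip_dagr _ _ (Db Dd)) dz.
by rewrite ip0l ip0r.
Qed.

(* This determines T: it is the value at x of the expectation onto z D. *)
Definition cexp (x T : K -> K) := [/\ D T, forall u, z (T u) = T u &
  forall d, D d -> ip (T (d y)) y = ip (x (d y)) y].

Lemma cexp_uniq x T T' : cexp x T -> cexp x T' -> T = T'.
Proof.
move=> [DT zT hT] [DT' zT' hT']; apply/funext => u; apply/eqP.
rewrite -subr_eq0; apply/eqP; apply: (faithful (d := fun u => T u - T' u)).
- exact: star_algB.
- by move=> v; rewrite (linB _ _ (bop_lin zb)) zT zT'.
- by move=> e De; rewrite ipBl hT// hT'// subrr.
Qed.
Lemma cexp_lin a x x' T T' : M x -> M x' -> cexp x T -> cexp x' T' ->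
  cexp (fun u => a *: x u + x' u) (fun u => a *: T u + T' u).
Proof.
move=> Mx Mx' [DT zT hT] [DT' zT' hT']; split; first exact: DC.
- by move=> u; rewrite (bop_lin zb) zT zT'.
- by move=> d Dd; rewrite !ipPl hT// hT'.
Qed.
(** The defining equations test with factors on the right only; traciality carries the left factor
    [d] over to that side. *)
Lemma cexp_mull d x T : D d -> M x -> cexp x T ->
  cexp (fun u => d (x u)) (fun u => d (T u)).
Proof.
move=> Dd Mx [DT zT hT]; split; first exact: Dm.
- by move=> u; rewrite supp_central// zT.
- move=> e De; have Me := DM De.
  rewrite (tr Dd (x := fun u => T (e u))); last by apply: Mm => //; exact: DM.
  rewrite (tr Dd (x := fun u => x (e u))); last exact: Mm.
  exact: hT (Dm De Dd).
Qed.
Lemma cexp_mulr d x T : D d -> cexp x T ->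
  cexp (fun u => x (d u)) (fun u => T (d u)).
Proof.
move=> Dd [DT zT hT]; split; [exact: Dm|by []|].
by move=> e De; apply: hT (Dm Dd De).
Qed.
(* Approximate b y by e y with e in D: by traciality e* y is as close to b y
   as e y. *)
Lemma trace_swap x b : M x -> N b -> adj b b -> (forall u, P (b u) = b u) ->
  ip (x y) (b y) = ip (x (b y)) y.
Proof.
move=> Mx Nb' bb Pbb; apply/eqP; rewrite -subr_eq0; apply/eqP/cn_eq0/eqP.
rewrite eq_le cn_ge0 andbT; apply/ler_addgt0Pr => r r0; rewrite add0r.
pose k := nrm (x y) + nrm (dag x y) + 1.
have k0 : 0 < k by rewrite ltr_wpDl// addr_ge0 ?nrm_ge0.
have : cl (orb D y) (b y) by rewrite -Pbb; apply: hP.1.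
move=> /(_ _ (divr_gt0 r0 k0))[_ [e De ->]]; rewrite ltr_pdivlMr// => er.
have bc T v : D T -> b (T v) = T (b v) by move=> DT; exact: Nc Nb' DT.
have ey : nrm (dag e y - b y) = nrm (b y - e y).
  have h1 : nsq (dag e y) = nsq (e y).
    rewrite /nsq Dr// (tr De (x := dag e)); last by apply/DM/Ds.
    by rewrite Dl//.
  have h2 : ip (dag e y) (b y) = ip (b y) (e y).
    by rewrite -bb bc ?Dl//; exact: Ds.
  by rewrite /nrm !nsqB h1 h2; congr Num.sqrt; ring.
have h1 : ip (x y) (e y) = ip (dag e y) (dag x y).
  by rewrite -Dl// (tr (Ds De))// Mr//.
have -> : ip (x y) (b y) - ip (x (b y)) y =
    ip (x y) (b y - e y) + ip (dag e y - b y) (dag x y).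
  by rewrite -[ip (x (b y)) y]Mr// ipBr ipBl h1; ring.
apply: le_trans (cn_leD _ _) _.
apply: le_trans (lerD (CS _ _) (CS _ _)) _; rewrite ey.
by have := nrm_ge0 (b y - e y); have := nrm_ge0 (x y); have := nrm_ge0 (dag x y);
  rewrite /k in er; nra.
Qed.

(** Both sides lie in the closure of D y. Tested against d y, with [b] commuting with [d], the claim
    is [trace_swap] for d* x. *)
Lemma compress_swap x b : M x -> N b -> adj b b -> (forall u, P (b u) = b u) ->
  (forall u, b (P u) = b u) -> b (P (x y)) = P (x (b y)).
Proof.
move=> Mx Nb' bb Pbb bP; apply: esym; apply: (proj_uniq hP oD).
  by rewrite -Pbb; apply: hP.1.
move=> _ [d Dd ->]; have Md := DM Dd.
rewrite -bb -PP Pbb Nc// -Dr// ipC.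
rewrite (trace_swap (x := fun u => dag d (x u)))//; last by apply: Mm => //; apply/DM/Ds.
by rewrite -ipC Dr//.
Qed.

(** With P e* e P the sum of the A_k^2: |e P x y|^2 is the sum of |A_k P x y|^2 = |P x A_k y|^2 <=
    c^2 |A_k y|^2, and the |A_k y|^2 add up to |e y|^2 since P y = y. *)
Lemma cexp_bound e x c : N e -> M x -> bnd c x ->
  nrm (e (P (x y))) <= c * nrm (e y).
Proof.
move=> Ne Mx [c0 xc]; have Ndag := Ns Ne.
have [A [Ab PA AP Ac hA]] :=
  sos_form (Nb Ne) (dagP (Nb Ne)) PP (proj_idem hP oD).
have NA k : N (A k).
  split=> [|d Dd u]; first by case: (Ab k).
  apply/esym/Ac => [|v|v|v]; first exact/bop_lin/Db.
  - by rewrite (Nc _ PN).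
  - by rewrite (Nc _ Ne).
  - by rewrite (Nc _ Ndag).
rewrite nrm_le_nsq ?mulr_ge0 ?nrm_ge0// exprMn nrm_sqr.
have h1 := hA (P (x y)) (P (x y)); rewrite !(proj_idem hP oD) in h1.
have h2 := hA y y; rewrite !P1 in h2.
apply: clim_le h1 => n; rewrite re_sum.
apply: (@le_trans _ _ (c ^+ 2 * \sum_(k < n) re (ip (A k y) (A k y)))).
  rewrite mulr_sumr; apply: ler_sum => k _; have [_ AA] := Ab k.
  rewrite (compress_swap Mx (NA k) AA (PA k) (AP k)) -!/(nsq _) -!nrm_sqr -exprMn.
  rewrite ler_pXn2r ?nnegrE ?mulr_ge0 ?nrm_ge0//.
  apply: le_trans (xc _); have := (proj_bnd hP).2 (x (A k y)); by rewrite mul1r.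
rewrite ler_wpM2l ?sqr_ge0//.
by apply: hassum_partial_le h2 => k; rewrite re_ge0 ?ip_ge0.
Qed.

Lemma cexp_exists x c : M x -> bnd c x -> exists2 T, cexp x T & bnd c T.
Proof.
move=> Mx xc; have [c0 _] := xc.
have [|||T [lT bT TE T0 Tc]] := @ext_op _ K
    (fun u v => exists e, [/\ N e, u = e y & v = e (P (x y))]) c c0.
- by exists (fun=> 0); split=> //; exact: star_alg0 sN.
- move=> a u u' v v' [e [Ne -> ->]] [e' [Ne' -> ->]].
  exists (fun u => a *: e u + e' u); split=> //.
  by case: sN => _ _ h _ _; apply: h.
- by move=> u u' [e [Ne -> ->]]; exact: cexp_bound Ne Mx xc.
have st X : N X -> forall a b,
    (exists e, [/\ N e, a = e y & b = e (P (x y))]) ->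
    exists e, [/\ N e, X a = e y & X b = e (P (x y))].
  move=> NX a b [e [Ne -> ->]]; exists (fun u => X (e u)); split=> //; exact: Nm.
have DT : D T.
  apply: DD; split=> [|X NX u]; first by split=> //; exists c.
  exact: (Tc X (dag X) (Nb NX) (dagP (Nb NX)) (st _ NX) (st _ (Ns NX))).
(* u - z u is orthogonal to N y, and the extension is 0 there. *)
have Tz u : T (z u) = T u.
  apply/eqP; rewrite eq_sym -subr_eq0 -linB//; apply/eqP/T0 => a b [e [Ne -> _]].
  by rewrite ipBr hz.2 ?subrr//; exists e.
have Ty : T y = P (x y).
  by apply: TE; exists (fun u => u); split=> //; case: sN.
exists T => //; split=> // [u|d Dd]; first by rewrite supp_central.
have Md := DM Dd.
(* <T d y, y> = <d T y, y> = <P x y, d* y> = <x y, d* y> = <d x y, y> = <x d y, y>, with traciality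
   at both ends. *)
rewrite -(tr Dd (DM DT)) Ty -Dr// PP Py; last exact: Ds.
by rewrite Dr// (tr Dd Mx).
Qed.

(* With T = E(x): on a good family, E has the same matrix coefficients as
   the identity. *)
Definition good (I : Type) (b : I -> K) := forall x T, M x -> cexp x T ->
  forall i j, ip (T (b j)) (b i) = ip (x (b j)) (b i).

Let cexpD x T : cexp x T -> D T. Proof. by case. Qed.

Definition dspan (I : finType) (b : I -> K) : K -> Prop := fun u =>
  exists2 d : I -> K -> K, forall i, D (d i) & u = \sum_i d i (b i).

Lemma dspan_lin (I : finType) (b : I -> K) : lin_set (dspan b).
Proof.
split; first by exists (fun _ _ => 0); rewrite ?big1// => _; exact: star_alg0.
move=> a s t [d Dd ->] [e De ->]; exists (fun i u => a *: d i u + e i u).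
  by move=> i; apply: DC.
by rewrite scaler_sumr -big_split.
Qed.
Lemma dspan_mul (I : finType) (b : I -> K) d u : D d -> dspan b u -> dspan b (d u).
Proof.
move=> Dd [e De ->]; exists (fun i u => d (e i u)) => [i|]; first exact: Dm.
by rewrite (lin_sum _ _ (bop_lin (Db Dd))).
Qed.
Lemma dspan_gen (I : finType) (b : I -> K) i : dspan b (b i).
Proof.
exists (fun j u => if j == i then u else 0) => [j|].
  by case: (j == i); [exact: D1|exact: star_alg0].
by rewrite -big_mkcond big_pred1_eq.
Qed.

(** For d, e in [D], the expectation of e* x d is e* T d; goodness applied to these sandwiches
    covers the D-span, and continuity its closure. *)
Lemma good_dspan (I : finType) (b : I -> K) : good b -> forall x T u v,
  M x -> cexp x T -> cl (dspan b) u -> cl (dspan b) v -> ip (T u) v = ip (x u) v.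
Proof.
move=> gb x T u v Mx xT cu cv; have DT := cexpD xT.
apply/eqP; rewrite -subr_eq0 -ipBl; apply/eqP.
rewrite ipC (cl_orth _ cv) ?conjC0// => _ [e De ->] {v cv}.
rewrite ipC ipBl -!Mr//; last exact: DM.
rewrite -ipBr (cl_orth _ cu) ?conjC0// => _ [d Dd ->] {u cu}.
rewrite ipBr !Mr//; last exact: DM.
rewrite !(lin_sum _ _ (bop_lin (Mb _)))//; last exact: DM.
rewrite !ip_suml -sumrB big1// => j _; rewrite !ip_sumr -sumrB big1// => i _.
apply/eqP; rewrite subr_eq0; apply/eqP.
rewrite -!(ip_dagl _ _ (Db (De i))).
apply: (gb (fun u => dag (e i) (x (d j u))) (fun u => dag (e i) (T (d j u)))).
  by apply: Mm; [exact/DM/Ds|apply: Mm => //; exact: DM].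
apply: (cexp_mull (x := fun u => x (d j u))).
- exact: Ds.
- by apply: Mm => //; exact: DM.
- exact: cexp_mulr.
Qed.

(* mu_i is the sum of S_k A_k b_i where the A_k are self-adjoint in N with
   sum A_k^2 = Q e* e Q, Q being the projection on the D-span of the b_i. *)
Lemma good_transfer (I : finType) (b : I -> K) e : good b -> N e ->
  exists2 m : I -> K, good m & forall d, D d -> forall i j,
    ip (d (m j)) (m i) = ip (d (e (b j))) (e (b i)).
Proof.
move=> gb Ne; have [Q hQ] := proj_exists (dspan_lin b).
have oL := dspan_lin b.
have NQ d u : D d -> Q (d u) = d (Q u).
  move=> Dd; apply: (proj_comm hQ oL (Db Dd) (dagP (Db Dd))) => s.
    by move=> ds; apply/sub_cl/dspan_mul.
  by apply: dspan_mul; apply: Ds.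
have [A [Ab QA AQ Ac hA]] :=
  sos_form (Nb Ne) (dagP (Nb Ne)) (proj_adj hQ) (proj_idem hQ oL).
have cA k i : cl (dspan b) (A k (b i)) by rewrite -QA; apply: hQ.1.
have Qb i d : D d -> Q (d (b i)) = d (b i).
  by move=> Dd; apply/(proj_id hQ oL)/sub_cl/dspan_mul => //; apply: dspan_gen.
have Ad d k u : D d -> d (A k u) = A k (d u).
  move=> Dd; apply: Ac => [|v|v|v]; first exact/bop_lin/Db.
  - by rewrite NQ.
  - by rewrite (Nc _ Ne).
  - by rewrite (Nc _ (Ns Ne)).
have /choice[m hm] : forall i, exists m, lim_to (fun n => \sum_(k < n) S k (A k (b i))) m.
  move=> i; pose B := re (ip (e (Q (b i))) (e (Q (b i)))).
  apply: (Ssum_exists SS' (f := fun k => A k (b i)) (B := B)) => n.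
  have := @hassum_partial_le _ _ _ n _ (hA (b i) (b i)).
  by apply=> k; rewrite re_ge0// ip_ge0.
have hs x i j : M x -> hassum (fun k => ip (x (A k (b j))) (A k (b i))) (ip (x (m j)) (m i)).
  move=> Mx; pose f i k := A k (b i).
  exact: (Ssum_ip SS' (f := f j) (g := f i) (Mb Mx) (fun k => MS k Mx) (hm j) (hm i)).
exists m => [x T Mx xT i j|d Dd i j].
  apply: hassum_eq (hs T i j (DM (cexpD xT))) _.
  apply: eq_hassum (hs x i j Mx) => k.
  by rewrite (good_dspan gb Mx xT).
apply: hassum_eq (hs d i j (DM Dd)) _.
have := hA (d (b j)) (b i); rewrite Qb// (Qb i (fun u => u))// Nc//.
by apply: eq_hassum => k; rewrite Ad.
Qed.

Lemma good_base : good (fun _ : unit => y).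
Proof. by move=> x T Mx [_ _ h] _ _; apply: (h (fun u => u)). Qed.

(** Peeling off one term with |a + b|^2 <= 2 |a|^2 + 2 |b|^2 doubles the weight of all later ones.
    The weight of a term does not depend on n. *)
Lemma sum_nsq_le n (f : nat -> K) :
  nsq (\sum_(k < n) f k) <= \sum_(k < n) 2 ^+ k.+1 * nsq (f k).
Proof.
elim: n f => [|n IH] f; first by rewrite !big_ord0 nsq0.
rewrite !big_ord_recl /=; apply: le_trans (nsqD_le _ _) _.
rewrite mulrnDl expr1 [2 * _]mulr_natl lerD2l.
apply: (@le_trans _ _ ((\sum_(k < n) 2 ^+ k.+1 * nsq (f k.+1)) *+ 2)).
  by rewrite lerMn2r; exact: (IH (fun k => f k.+1)).
rewrite -sumrMnl; apply: ler_sum => k _.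
by rewrite -mulrnAl -[2 ^+ _ *+ 2]mulr_natl -exprS.
Qed.

(* Write xi as a fast converging sum of vectors d_k = e_k y, replace each d_k
   by a good vector m_k with the same vector functional on D, and let m be the
   sum of the 2^(k+1) S_k m_k: then |d xi| <= |d m| for d in D. *)
Lemma good_cover xi : cl (orb N y) xi ->
  exists m T, [/\ good (fun _ : unit => m), N T & T m = xi].
Proof.
(* The differences have squared norms of order 16^(-n), which still decay like 4^(-n) after
   multiplication by the weights 4^(n+1). *)
move=> cxi; pose r : R := 4^-1.
have rp n : 0 < r ^+ n by rewrite exprn_gt0// invr_gt0.
have /choice[e he] : forall n, exists e, N e /\ nrm (xi - e y) < r ^+ n.
  by move=> n; have [_ [e Ne ->] h] := cxi _ (rp n); exists e.
pose dl n : K -> K := if n is k.+1 then (fun u => e k.+1 u - e k u) else e 0%N.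
have Ndl n : N (dl n).
  case: n => [|n]; first by case: (he 0%N).
  exact: (star_algB sN (he n.+1).1 (he n).1).
have dlS n u : \sum_(k < n.+1) dl k u = e n u.
  elim: n => [|n IH]; first by rewrite big_ord_recl big_ord0 addr0.
  by rewrite big_ord_recr /= IH addrC subrK.
have dls n : nrm (dl n.+1 y) <= 2 * r ^+ n.
  have [_ h1] := he n; have [_ h2] := he n.+1; have := rp n; move: h2.
  rewrite exprS /= => h2 h0; have := nrmB (e n.+1 y) xi (e n y).
  rewrite [nrm (e n.+1 y - xi)]nrm_distC => h3; apply: le_trans h3 _.
  by rewrite /r in h1 h2 h0 *; lra.
have /choice[m hm] : forall n, exists m, good (fun _ : unit => m) /\
    forall d, D d -> ip (d m) m = ip (d (dl n y)) (dl n y).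
  move=> n; have [m gm hm] := good_transfer good_base (Ndl n).
  exists (m tt); split; first by move=> x T Mx xT _ _; apply: gm.
  by move=> d Dd; apply: hm.
pose al n := toC (2 ^+ n.+1) *: m n.
have al_ip x n : M x -> ip (x (al n)) (al n) = toC (4 ^+ n.+1) * ip (x (m n)) (m n).
  move=> Mx; rewrite /al (linZ _ _ (bop_lin (Mb Mx))) ipZl ipZr toC_conj mulrA.
  by rewrite -toCM -exprMn -natrM.
have nal n : nsq (al n) = 4 ^+ n.+1 * nsq (dl n y).
  rewrite /nsq (al_ip (fun u => u)) ?re_toCM; last exact: DM.
  by case: (hm n) => _ /(_ (fun u => u) D1) ->.
have nalS n : nsq (al n.+1) <= 64 * r ^+ n.
  rewrite nal; apply: (@le_trans _ _ (4 ^+ n.+2 * (2 * r ^+ n) ^+ 2)).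
    by rewrite ler_wpM2l ?exprn_ge0// -nrm_le_nsq// mulr_ge0// ltW.
  have h : 4 ^+ n * r ^+ n = 1 by rewrite -exprMn mulfV ?expr1n.
  have -> : 4 ^+ n.+2 * (2 * r ^+ n) ^+ 2 = 64 * ((4 ^+ n * r ^+ n) * r ^+ n).
    by rewrite !exprS; ring.
  by rewrite h mul1r.
have alB n : \sum_(k < n) nsq (al k) <= nsq (al 0%N) + 128.
  (* 64 r^k <= 128 (r^k - r^(k+1)), and the right-hand sides telescope. *)
  have H : \sum_(k < n.+1) nsq (al k) <= nsq (al 0%N) + 128 - 128 * r ^+ n.
    elim: n => [|n IH]; first by rewrite big_ord_recl big_ord0 addr0 expr0; lra.
    rewrite big_ord_recr /=; apply: le_trans (lerD IH (nalS n)) _.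
    by rewrite exprS; have := rp n; rewrite /r; lra.
  apply: le_trans (mono_sum (fun k => nsq_ge0 (al k)) (leqnSn n)) _.
  by apply: le_trans H _; have := rp n; lra.
have [mu hmu] := Ssum_exists SS' alB.
have hs x : M x -> hassum (fun k => ip (x (al k)) (al k)) (ip (x mu) mu).
  by move=> Mx; exact: (Ssum_ip SS' (Mb Mx) (fun k => MS k Mx) hmu hmu).
have dle d : D d -> nsq (d xi) <= nsq (d mu).
  move=> Dd; have exi : lim_to (fun n => e n y) xi.
    move=> c c0; have r1 : `|r| < 1 by rewrite ger0_norm ?invr_ge0// /r; lra.
    have [Nn hN] := inv_small c0; exists Nn => n /hN; rewrite nrm_distC; apply: le_lt_trans.
    apply: ltW; apply: lt_le_trans (he n).2 _.
    rewrite /r exprVn lef_pV2 ?posrE ?exprn_gt0//.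
    by rewrite -natrX ler_nat ltn_expl.
  have dxi := lim_bop (Db Dd) exi.
  apply: clim_le (lim_ip dxi dxi) => n; rewrite -/(nsq _) -dlS.
  rewrite (lin_sum _ _ (bop_lin (Db Dd))).
  apply: le_trans (sum_nsq_le _ (fun k => d (dl k y))) _.
  have DdD : D (fun u => dag d (d u)) by apply: Dm => //; apply: Ds.
  have := hs _ (DM DdD); rewrite Dl// => hsd.
  have pos k : 0 <= re (ip (dag d (d (al k))) (al k)).
    by rewrite Dl// re_ge0// ip_ge0.
  apply: le_trans (hassum_partial_le n.+1 pos hsd).
  apply: ler_sum => k _; rewrite (al_ip _ _ (DM DdD)) re_toCM.
  have [_ hk] := hm k; rewrite (hk _ DdD) Dl// -/(nsq _).
  by rewrite ler_wpM2r ?nsq_ge0// ler_pXn2r ?nnegrE// ler_nat.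
(* By [dle] the map d mu -> d xi is a contraction; it commutes with [D], so its extension belongs to
   [N], and d = 1 shows that it sends [mu] to [xi]. *)
have [|||T [lT bT TE T0 Tc]] := @ext_op _ K
    (fun u v => exists d, [/\ D d, u = d mu & v = d xi]) 1 ler01.
- by exists (fun=> 0); split=> //; exact: star_alg0.
- move=> a u u' v v' [d [Dd -> ->]] [d' [Dd' -> ->]].
  by exists (fun u => a *: d u + d' u); split=> //; exact: DC.
- move=> u u' [d [Dd -> ->]]; rewrite mul1r nrm_le_nsq ?nrm_ge0// nrm_sqr.
  exact: dle.
have st X : D X -> forall a b, (exists d, [/\ D d, a = d mu & b = d xi]) ->
    exists d, [/\ D d, X a = d mu & X b = d xi].
  move=> DX a b [d [Dd -> ->]]; exists (fun u => X (d u)); split=> //; exact: Dm.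
exists mu, T; split.
- move=> x T' Mx xT' _ _; apply: hassum_eq (hs T' (DM (cexpD xT'))) _.
  apply: eq_hassum (hs x Mx) => k; rewrite !al_ip//; last exact: DM (cexpD xT').
  by have [g _] := hm k; rewrite (g _ _ Mx xT' tt tt).
- split=> [|X DX u]; first by split=> //; exists 1.
  exact: (Tc X (dag X) (Db DX) (dagP (Db DX)) (st _ DX) (st _ (Ds DX))).
- by apply: TE; exists (fun u => u).
Qed.

(** Only the z v_i matter, as T = z T = T z. Each is the image under some T_i in [N] of a good
    vector. Placing these vectors in orthogonal blocks makes them good as a family, since mixed
    coefficients vanish on both sides; the sum of the T_i S'_i lies in [N], maps the family to the z
    v_i, and is absorbed by [good_transfer]. *)
Lemma cexp_vector n (v : 'I_n -> K) : exists m : 'I_n -> K,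
  forall x T, M x -> cexp x T -> forall i j,
    ip (T (v j)) (v i) = ip (x (m j)) (m i).
Proof.
have /choice[p hp] : forall i, exists p : K * (K -> K),
    [/\ good (fun _ : unit => p.1), N p.2 & p.2 p.1 = z (v i)].
  by move=> i; have [m [T h]] := good_cover (hz.1 (v i)); exists (m, T).
pose b (i : 'I_n) := S i (p i).1.
have [Sb Sadj SSd] := SS'.
have gb : good b.
  move=> x T Mx xT i j; have DT := cexpD xT.
  rewrite /b (MS _ (DM DT)) (MS _ Mx) !(isometries_ip SS').
  case: (_ == _ :> nat) / eqP => // /val_inj ->.
  by have [g _ _] := hp i; rewrite (g _ _ Mx xT tt tt).
pose e u := \sum_(i < n) (p i).2 (S' i u).
have Ne : N e.
  apply: star_alg_sum => // i; apply: Nm; first by case: (hp i).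
  split=> [|d Dd u]; first exact: adj_bop (Sadj i) (Sb i).
  have bS' := adj_bop (Sadj i) (Sb i).
  apply: ip_eqP => w; rewrite (adjC (Sadj i)) -!(Dr _ _ Dd).
  by rewrite (adjC (Sadj i)) (MS _ (DM (Ds Dd))).
have eb i : e (b i) = z (v i).
  rewrite /e (bigD1 i)//= /b SSd eqxx big1 ?addr0; first by case: (hp i).
  move=> j ji; rewrite SSd (_ : (_ == _ :> nat) = false); last by apply/negbTE.
  by rewrite (lin0 (bop_lin (Nb _)))//; case: (hp j).
have [m gm hm] := good_transfer gb Ne.
exists m => x T Mx xT i j; rewrite -(gm x T Mx xT) hm; last exact: cexpD xT.
have [DT zT _] := xT; rewrite !eb -zz.
by rewrite -supp_central// zT zT.
Qed.

End Expectation.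

(** * The amplification *)

Section SquareSummable.
Context {R : realType} {V : hilbert R}.
Local Notation C := (Cplx R).

Definition l2pred : {pred nat -> V} :=
  [pred f : nat -> V | `[< exists B : R, forall n, \sum_(k < n) nsq (f k) <= B >]].

Lemma l2predP (f : nat -> V) :
  reflect (exists B : R, forall n, \sum_(k < n) nsq (f k) <= B) (f \in l2pred).
Proof. exact: asboolP. Qed.

Lemma l2_submod_closed : submod_closed l2pred.
Proof.
split=> [|a f g /l2predP[B fB] /l2predP[B' gB]]; apply/l2predP.
  by exists 0 => n; rewrite big1// => k _; rewrite nsq0.
exists ((cn a ^+ 2 * B + B') *+ 2) => n.
apply: (@le_trans _ _ ((cn a ^+ 2 * \sum_(k < n) nsq (f k) +
    \sum_(k < n) nsq (g k)) *+ 2)).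
  rewrite mulr_sumr -big_split /= -sumrMnl; apply: ler_sum => k _.
  by rewrite -nsqZ; apply: nsqD_le.
rewrite lerMn2r /=; apply: lerD (gB n); apply: ler_wpM2l (fB n); exact: sqr_ge0.
Qed.

Record l2 := L2 { l2val :> nat -> V; l2P : l2val \in l2pred }.
HB.instance Definition _ := [isSub for l2val].
HB.instance Definition _ := [Choice of l2 by <:].
HB.instance Definition _ := GRing.isSubmodClosed.Build _ _ l2pred l2_submod_closed.
HB.instance Definition _ := [SubChoice_isSubLmodule of l2 by <:].

Implicit Types (f g : l2) (u v : V).

Lemma l2_ext f g : l2val f =1 l2val g -> f = g.
Proof. by move=> h; apply/val_inj/funext. Qed.
Lemma l2D f g k : l2val (f + g) k = l2val f k + l2val g k. Proof. by []. Qed.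
Lemma l2B f g k : l2val (f - g) k = l2val f k - l2val g k. Proof. by []. Qed.
Lemma l2Z (a : C) f k : l2val (a *: f) k = a *: l2val f k. Proof. by []. Qed.
Lemma nonneg_hassum (x : nat -> R) (B : R) : (forall k, 0 <= x k) ->
  (forall n, \sum_(k < n) x k <= B) -> exists s, hassum (fun k => toC (x k)) s.
Proof.
move=> x0 xB; have [L [_ Lu Ll]] := mono_bounded (mono_sum x0) xB.
exists (toC L) => e e0; have [N hN] := Ll _ e0; exists N => n /hN h.
have -> : \sum_(k < n) toC (x k) - toC L = - toC (L - \sum_(k < n) x k).
  by rewrite toCD toCN opprB /toC rmorph_sum.
by rewrite cnN cn_toC ?subr_ge0//; lra.
Qed.

Lemma polarization u v : ip u v = 4^-1 *
  (ip (u + v) (u + v) - ip (u - v) (u - v)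
   + 'i * (ip (u + 'i *: v) (u + 'i *: v) - ip (u - 'i *: v) (u - 'i *: v))).
Proof.
rewrite !(ipDl, ipNl, ipDr, ipNr, ipZl, ipZr) !conjCi.
have ii : 'i * 'i = -1 :> C by rewrite -expr2 sqrCi.
transitivity (4^-1 * (2 * (1 - 'i * 'i) * ip u v + 2 * (1 + 'i * 'i) * ip v u)).
  by rewrite ii; field.
by congr (_ * _); ring.
Qed.

(** Polarization reduces the mixed series to four diagonal ones, whose partial sums increase and are
    bounded. *)
Lemma l2_ip_exists f g : exists s, hassum (fun k => ip (l2val f k) (l2val g k)) s.
Proof.
have ex (h : l2) : exists s, hassum (fun k => ip (l2val h k) (l2val h k)) s.
  have /l2predP[B hB] := l2P h.
  have [s hs] := nonneg_hassum (fun k => nsq_ge0 (l2val h k)) hB.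
  by exists s; apply: eq_hassum hs => k; rewrite ip_nsq.
have [s1 h1] := ex (f + g); have [s2 h2] := ex (f - g).
have [s3 h3] := ex (f + 'i *: g); have [s4 h4] := ex (f - 'i *: g).
exists (4^-1 * (s1 + -1 * s2 + 'i * (s3 + -1 * s4))).
apply: eq_hassum (hassumZ _ (hassumD (hassumD h1 (hassumZ (-1) h2))
  (hassumZ 'i (hassumD h3 (hassumZ (-1) h4))))) => k.
by rewrite [RHS]polarization !mulN1r.
Qed.

Definition l2ip f g : C :=
  xget 0 [set s | hassum (fun k => ip (l2val f k) (l2val g k)) s].

Lemma l2ipP f g : hassum (fun k => ip (l2val f k) (l2val g k)) (l2ip f g).
Proof.
rewrite /l2ip; have [s hs] := l2_ip_exists f g.
by case: xgetP => [? _ //|/(_ s hs)].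
Qed.
Lemma l2ipE f g s : hassum (fun k => ip (l2val f k) (l2val g k)) s -> l2ip f g = s.
Proof. exact: hassum_eq (l2ipP f g). Qed.

Lemma l2ip_linear (a : C) f g h : l2ip (a *: f + g) h = a * l2ip f h + l2ip g h.
Proof.
apply: l2ipE; apply: eq_hassum (hassumD (hassumZ a (l2ipP f h)) (l2ipP g h)) => k.
by rewrite l2D l2Z ipPl.
Qed.
Lemma l2ip_conj f g : l2ip g f = (l2ip f g)^*.
Proof.
by apply: l2ipE; apply: eq_hassum (hassum_conj (l2ipP f g)) => k; rewrite -ipC.
Qed.
Lemma l2ip_partial f n : \sum_(k < n) nsq (l2val f k) <= re (l2ip f f).
Proof.
by apply: hassum_partial_le (l2ipP f f) => k; apply: nsq_ge0.
Qed.
Lemma l2ip_le f (B : R) : (forall n, \sum_(k < n) nsq (l2val f k) <= B) ->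
  re (l2ip f f) <= B.
Proof. by move=> h; apply: clim_le (l2ipP f f) => n; rewrite re_sum. Qed.
Lemma l2ip_nsq_le f k : nsq (l2val f k) <= re (l2ip f f).
Proof.
apply: le_trans (l2ip_partial f k.+1); rewrite big_ord_recr /= lerDr.
by apply: sumr_ge0 => i _; apply: nsq_ge0.
Qed.
Lemma l2ip_ge0 f : 0 <= l2ip f f.
Proof.
have -> : l2ip f f = toC (re (l2ip f f)) by apply: toC_re_eq; rewrite -l2ip_conj.
by rewrite toC_ge0; apply: le_trans (l2ip_nsq_le f 0); apply: nsq_ge0.
Qed.
Lemma l2ip_def f : l2ip f f = 0 -> f = 0.
Proof.
move=> h; apply: l2_ext => k; apply: nsq_eq0; apply/eqP.
by rewrite eq_le nsq_ge0 andbT; apply: le_trans (l2ip_nsq_le f k) _; rewrite h.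
Qed.

(** The limit is taken coordinate by coordinate; bounds on finite sums of coordinates pass to the
    limit, as in Fatou's lemma, and give membership and convergence. *)
Lemma l2_complete (F : nat -> l2) :
  (forall e : R, 0 < e -> exists N, forall m n, (N <= m)%N -> (N <= n)%N ->
     re (l2ip (F m - F n) (F m - F n)) < e) ->
  exists l, forall e : R, 0 < e -> exists N, forall n, (N <= n)%N ->
    re (l2ip (F n - l) (F n - l)) < e.
Proof.
move=> cF.
have /choice[l hl] : forall k, exists l, lim_to (fun m => l2val (F m) k) l.
  move=> k; apply: complete => e e0.
  have [|N hN] := cF (e ^+ 2); first by rewrite exprn_gt0.
  exists N => m n Nm Nn; rewrite nrm_lt_nsq ?ltW// -l2B.
  exact: le_lt_trans (l2ip_nsq_le _ _) (hN _ _ Nm Nn).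
have part (e : R) m N n : (forall p, (N <= p)%N -> re (l2ip (F m - F p) (F m - F p)) < e) ->
    \sum_(k < n) nsq (l2val (F m) k - l k) <= e.
  move=> h.
  have hk k : lim_to (fun p => l2val (F m) k - l2val (F (N + p)%N) k) (l2val (F m) k - l k).
    move=> d /(hl k)[N' hN']; exists N' => p N'p.
    rewrite opprB addrC addrA subrK nrm_distC; apply: hN'.
    by rewrite (leq_trans N'p)// leq_addl.
  have : clim (fun p => \sum_(k < n) ip (l2val (F m) k - l2val (F (N + p)%N) k)
      (l2val (F m) k - l2val (F (N + p)%N) k))
      (\sum_(k < n) ip (l2val (F m) k - l k) (l2val (F m) k - l k)).
    elim: n => [|n IH].
      by move=> d d0; exists 0%N => p _; rewrite !big_ord0 subrr cn0.
    rewrite big_ord_recr; apply: eq_clim (climD IH (lim_ip (hk n) (hk n))) => p.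
    by rewrite big_ord_recr.
  rewrite -re_sum; apply: clim_le => p; rewrite re_sum.
  apply: le_trans (ltW (h _ (leq_addr p N))).
  exact: (l2ip_partial (F m - F (N + p)%N)).
have [N hN] := cF 1 ltr01.
have hlN : (fun k => l2val (F N) k - l k) \in l2pred.
  by apply/l2predP; exists 1 => n; apply: (part 1 N N) => p Np; apply: hN.
have hlP : l \in l2pred.
  have -> : l = (-1 : C) *: (fun k => l2val (F N) k - l k) + l2val (F N).
    by apply/funext => k; rewrite /= scaleN1r opprB /GRing.add /= subrK.
  exact: l2_submod_closed.2 hlN (l2P _).
exists (L2 hlP) => e e0.
have e2 : 0 < e / 2 by lra.
have [N' hN'] := cF _ e2; exists N' => n N'n.
apply: (@le_lt_trans _ _ (e / 2)); last by lra.
by apply: l2ip_le => m; apply: (part _ _ N') => p Np; apply: hN'.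
Qed.

Definition l2_hilbert : hilbert R :=
  Hilbert l2ip_linear l2ip_conj l2ip_ge0 l2ip_def l2_complete.

End SquareSummable.

(** * Diagonal operators, and copies of the space inside itself *)

Section Amplification.
Context {R : realType} {V : hilbert R}.
Local Notation C := (Cplx R).
Local Notation K := (@l2_hilbert R V).
Implicit Types (x y : K) (u v : V) (T : V -> V).

Definition pr (k : nat) x : V := l2val x k.
Arguments pr : simpl never.
(** The value is 0 if [f] is not square summable. *)
Definition mkl2 (f : nat -> V) : K := insubd (0 : @l2 R V) f.

Lemma mkl2E f k : f \in l2pred -> pr k (mkl2 f) = f k.
Proof. by move=> hf; rewrite /pr /mkl2; congr (_ k); exact: (insubdK (0 : l2)). Qed.
Lemma pr_ext x y : (forall k, pr k x = pr k y) -> x = y.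
Proof. exact: l2_ext. Qed.
Lemma pr_lin (a : C) x y k : pr k (a *: x + y) = a *: pr k x + pr k y.
Proof. by []. Qed.
Lemma prB x y k : pr k (x - y) = pr k x - pr k y. Proof. by []. Qed.
Lemma pr_sum (I : Type) (r : seq I) (F : I -> K) k :
  pr k (\sum_(i <- r) F i) = \sum_(i <- r) pr k (F i).
Proof. by elim/big_rec2: _ => // i s t _ <-. Qed.
Lemma ip_pr x y : hassum (fun k => ip (pr k x) (pr k y)) (ip x y).
Proof. exact: l2ipP. Qed.
Lemma nsq_partial x n : \sum_(k < n) nsq (pr k x) <= nsq x.
Proof. exact: l2ip_partial. Qed.
Lemma nsq_pr_le x (B : R) : (forall n, \sum_(k < n) nsq (pr k x) <= B) -> nsq x <= B.
Proof. exact: l2ip_le. Qed.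
Lemma pr_bop k : bop (pr k).
Proof.
split; first by move=> a x y; rewrite pr_lin.
exists 1; split=> // x; rewrite mul1r nrm_le_nsq ?nrm_ge0// nrm_sqr.
exact: l2ip_nsq_le.
Qed.

Definition amp T x : K := mkl2 (fun k => T (pr k x)).
Definition single (k : nat) u : K := mkl2 (fun j => if j == k then u else 0).

Lemma bnd_nsq (W W' : hilbert R) (c : R) (T : W -> W') w :
  bnd c T -> nsq (T w) <= c ^+ 2 * nsq w.
Proof.
move=> [c0 h]; rewrite -!nrm_sqr -exprMn ler_pXn2r ?nnegrE ?mulr_ge0 ?nrm_ge0//.
Qed.

Lemma amp_bound T c x n : bnd c T ->
  \sum_(k < n) nsq (T (pr k x)) <= c ^+ 2 * nsq x.
Proof.
move=> cT; apply: (@le_trans _ _ (c ^+ 2 * \sum_(k < n) nsq (pr k x))).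
  by rewrite mulr_sumr; apply: ler_sum => k _; apply: bnd_nsq.
by rewrite ler_wpM2l ?sqr_ge0 ?nsq_partial.
Qed.
Lemma ampE T k x : bop T -> pr k (amp T x) = T (pr k x).
Proof.
move=> [_ [c cT]]; rewrite mkl2E//; apply/l2predP; exists (c ^+ 2 * nsq x) => n.
exact: amp_bound.
Qed.
Lemma amp_bnd T c : bop T -> bnd c T -> bnd c (amp T).
Proof.
move=> bT cT; have [c0 _] := cT; split=> // x.
rewrite nrm_le_nsq ?mulr_ge0 ?nrm_ge0// exprMn nrm_sqr; apply: nsq_pr_le => n.
apply: le_trans (amp_bound x n cT); apply: ler_sum => k _; by rewrite ampE.
Qed.
Lemma amp_bop T : bop T -> bop (amp T).
Proof.
move=> bT; have [lT [c cT]] := bT; split; last by exists c; apply: amp_bnd.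
by move=> a x y; apply: pr_ext => k; rewrite pr_lin !ampE// pr_lin lT.
Qed.
Lemma amp_adj S T : bop S -> bop T -> adj S T -> adj (amp S) (amp T).
Proof.
move=> bS bT ST x y; apply: hassum_eq (ip_pr _ _) _.
by apply: eq_hassum (ip_pr x (amp T y)) => k; rewrite !ampE// ST.
Qed.

Lemma injE j k u : pr j (single k u) = if j == k then u else 0.
Proof.
rewrite mkl2E//; apply/l2predP; exists (nsq u) => n.
rewrite (eq_bigr (fun i : 'I_n => if (i : nat) == k then nsq u else 0)); last first.
  by move=> i _; case: eqP; rewrite ?nsq0.
rewrite -big_mkcond /=; case: (ltnP k n) => kn.
  by rewrite (big_pred1 (Ordinal kn)).
rewrite big_pred0 ?nsq_ge0// => i; apply/negbTE.
by rewrite neq_ltn (leq_trans (ltn_ord i) kn).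
Qed.
Lemma ip_inj k u y : ip (single k u) y = ip u (pr k y).
Proof.
apply: hassum_eq (ip_pr _ _) _ => e e0; exists k.+1 => n kn.
rewrite (bigD1 (Ordinal kn))//= injE eqxx big1 ?addr0 ?subrr ?cn0// => j jk.
rewrite injE (_ : (j == k :> nat) = false) ?ip0l//; exact/negbTE.
Qed.
Lemma inj_bop k : bop (single k).
Proof.
split=> [a u v|].
  by apply: pr_ext => j; rewrite pr_lin !injE; case: eqP; rewrite ?scaler0 ?addr0.
exists 1; split=> // u; rewrite mul1r nrm_le_nsq ?nrm_ge0// nrm_sqr.
by rewrite /nsq ip_inj injE eqxx.
Qed.

Lemma finite_dense x : cl (fun y => exists (n : nat) (v : nat -> V),
  y = \sum_(k < n) single k (v k)) x.
Proof.
move=> e e0; have e2 : 0 < e ^+ 2 / 2 by rewrite divr_gt0 ?exprn_gt0.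
have [n hn] := bounded_sum_tail (fun k => nsq_ge0 (pr k x)) (nsq_partial x) e2.
pose y : K := \sum_(k < n) single k (pr k x); exists y; first by exists n, (pr^~ x).
have hy j : pr j y = if (j < n)%N then pr j x else 0.
  rewrite pr_sum (eq_bigr (fun k : 'I_n => if j == k :> nat then pr j x else 0)).
    rewrite -big_mkcond /=; case: ifPn => jn.
      by rewrite (big_pred1 (Ordinal jn))// => i; rewrite eq_sym.
    rewrite big_pred0// => i; apply/negbTE.
    by apply: contra jn => /eqP ->.
  by move=> k _; rewrite injE; case: eqP => // ->.
rewrite nrm_lt_nsq ?ltW//; apply: (@le_lt_trans _ _ (e ^+ 2 / 2)); last first.
  by have := exprn_gt0 2 e0; lra.
apply: nsq_pr_le => N.
rewrite -(big_mkord xpredT (fun k => nsq (pr k (x - y)))).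
have z0 m : (m <= n)%N -> \sum_(0 <= k < m) nsq (pr k (x - y)) = 0.
  move=> mn; rewrite big_nat_cond big1// => k /andP[/andP[_ km] _].
  by rewrite prB hy (leq_trans km mn) subrr nsq0.
case: (leqP N n) => Nn; first by rewrite z0// ltW.
rewrite (big_cat_nat (leq0n n) (ltnW Nn)) /= z0// add0r.
apply: le_trans (ltW (hn n N (leqnn _) (ltnW Nn))).
rewrite big_nat_cond [leRHS]big_nat_cond; apply: ler_sum => k /andP[/andP[nk _] _].
by rewrite prB hy ltnNge nk subr0.
Qed.

Lemma bop_inj_ext (W : hilbert R) (S T : K -> W) : bop S -> bop T ->
  (forall k u, S (single k u) = T (single k u)) -> S =1 T.
Proof.
move=> bS bT h x; apply: bop_ext (finite_dense x) => // _ [n [v ->]].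
rewrite (lin_sum _ _ (bop_lin bS)) (lin_sum _ _ (bop_lin bT)).
exact: eq_bigr.
Qed.

Lemma sum_uniq_le (g : nat -> R) (B : R) (r : seq nat) : uniq r ->
  (forall k, 0 <= g k) -> (forall n, \sum_(k < n) g k <= B) ->
  \sum_(k <- r) g k <= B.
Proof.
move=> ur g0 gB; pose N := (\max_(k <- r) k).+1.
apply: le_trans (gB N); rewrite -(big_mkord xpredT g).
have p : perm_eq r [seq k <- iota 0 N | k \in r].
  apply: uniq_perm => //; first exact: filter_uniq (iota_uniq _ _).
  move=> k; rewrite mem_filter mem_iota /= add0n; case: (boolP (k \in r)) => //= kr.
  by rewrite ltnS leq_bigmax_seq.
rewrite (perm_big _ p) big_filter /= /index_iota subn0 big_mkcond.
by apply: ler_sum => k _; case: ifP.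
Qed.

(** Injectivity places countably many disjoint copies of the index set inside it. *)
Definition pcode (i k : nat) : nat := pickle ((i, k) : nat * nat).
Lemma pcode_eq i k j l : (pcode i k == pcode j l) = (i == j) && (k == l).
Proof. by rewrite (inj_eq (pcan_inj pickleK)) xpair_eqE. Qed.

Definition unembed (i : nat) x : K := mkl2 (fun k => pr (pcode i k) x).

Lemma unembed_bound i x n : \sum_(k < n) nsq (pr (pcode i k) x) <= nsq x.
Proof.
rewrite -(big_mkord xpredT (fun k => nsq (pr (pcode i k) x))).
rewrite -(big_map (fun k => pcode i k) xpredT (fun m => nsq (pr m x))).
apply: sum_uniq_le => [|k|m]; [|exact: nsq_ge0|exact: nsq_partial].
rewrite map_inj_uniq ?iota_uniq// => k k' /eqP.
by rewrite pcode_eq eqxx => /eqP.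
Qed.
Lemma unembedE i k x : pr k (unembed i x) = pr (pcode i k) x.
Proof.
by rewrite mkl2E//; apply/l2predP; exists (nsq x) => n; apply: unembed_bound.
Qed.
Lemma unembed_bop i : bop (unembed i).
Proof.
split; first by move=> a x y; apply: pr_ext => k; rewrite pr_lin !unembedE pr_lin.
exists 1; split=> // x; rewrite mul1r nrm_le_nsq ?nrm_ge0// nrm_sqr.
apply: nsq_pr_le => n; under eq_bigr do rewrite unembedE.
exact: unembed_bound.
Qed.
Lemma unembed_amp i T x : bop T -> unembed i (amp T x) = amp T (unembed i x).
Proof. by move=> bT; apply: pr_ext => k; rewrite unembedE !ampE// unembedE. Qed.

(* The isometry of K onto the coordinates pcode i _: K contains countably many
   orthogonal copies of itself, and amp T acts on each as on K. *)
Definition embed (i : nat) : K -> K := dag (unembed i).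

Lemma embed_inj i k u : embed i (single k u) = single (pcode i k) u.
Proof.
by apply: ip_eqP => w; rewrite ip_dagl ?ip_inj ?unembedE//; exact: unembed_bop.
Qed.
Lemma embed_isometries : isometries embed unembed.
Proof.
have be i : bop (embed i) := dag_bop (unembed_bop i).
split=> // [i|i j]; first exact/adjC/dagP/unembed_bop.
have E k u : unembed i (embed j (single k u)) = if i == j then single k u else 0.
  rewrite embed_inj; apply: pr_ext => m; rewrite unembedE injE.
  rewrite pcode_eq.
  by case: eqP => //= _; rewrite injE.
move=> x; apply: (bop_inj_ext (S := fun x => unembed i (embed j x))
  (T := fun x => if i == j then x else 0)) => //.
  by apply: bop_comp => //; exact: unembed_bop.
by case: (i == j); [exact: bop_id|exact: bop0].
Qed.
Lemma embed_amp i T x : bop T -> amp T (embed i x) = embed i (amp T x).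
Proof.
move=> bT; apply: ip_eqP => w; have bS := unembed_bop i.
have bT' := dag_bop bT; have aT := amp_adj bT bT' (dagP bT).
by rewrite aT !ip_dagl// unembed_amp// aT.
Qed.

Section Algebra.
Variable A : set (V -> V).
Hypothesis sA : star_alg A.

Lemma amp_star_alg : star_alg (amp @` A).
Proof.
have [Ab A1 AD AM As] := sA; split.
- by move=> _ [T AT <-]; apply: amp_bop; exact: Ab.
- exists (fun u => u) => //; apply/funext => x; apply: pr_ext => k.
  by rewrite ampE//; exact: bop_id.
- move=> a _ _ [S AS <-] [T AT <-]; exists (fun u => a *: S u + T u); first exact: AD.
  by apply/funext => x; apply: pr_ext => k; rewrite pr_lin !ampE//; exact: Ab || exact/Ab/AD.
- move=> _ _ [S AS <-] [T AT <-]; exists (fun u => S (T u)); first exact: AM.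
  by apply/funext => x; apply: pr_ext => k; rewrite !ampE//; exact: Ab || exact/Ab/AM.
- move=> _ [S AS <-]; exists (dag S); first exact: As.
  by apply/esym/dagE/amp_adj; [exact: Ab|exact/Ab/As|exact/dagP/Ab].
Qed.

(** Matrix units commute with diagonal operators, so an element of the bicommutant commutes with
    them and is the amplification of its corner [t]. The corner is in the bicommutant of [A] because
    commutants amplify into commutants. *)
Lemma amp_bicommutant : cmt (cmt A) `<=` A -> cmt (cmt (amp @` A)) `<=` amp @` A.
Proof.
have [Ab _ _ _ _] := sA; move=> AA T [bT cT].
pose t u := pr 0 (T (single 0 u)).
have bt : bop t.
  by apply: bop_comp (pr_bop 0) _; apply: bop_comp bT (inj_bop 0).
have unit_cmt k l : cmt (amp @` A) (fun x => single k (pr l x)).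
  split=> [|_ [S AS <-] x]; first exact: bop_comp (inj_bop k) (pr_bop l).
  apply: pr_ext => j; have bS := Ab _ AS.
  by rewrite injE !ampE// injE; case: eqP => //; rewrite (lin0 (bop_lin bS)).
exists t.
  apply: AA; split=> // S [bS cS] u.
  have cS' : cmt (amp @` A) (amp S).
    split=> [|_ [X AX <-] x]; first exact: amp_bop.
    by apply: pr_ext => j; rewrite !ampE ?cS//; exact: Ab.
  rewrite /t (_ : single 0 (S u) = amp S (single 0 u)).
    by rewrite cT// ampE.
  by apply: pr_ext => j; rewrite ampE// !injE; case: eqP => //; rewrite (lin0 (bop_lin bS)).
apply/funext => x; apply: pr_ext => k; rewrite ampE// /t.
rewrite (cT _ (unit_cmt 0%N k)) injE eqxx.
by [].
Qed.

End Algebra.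
End Amplification.

(** * The weak* topology *)

Section Bridge.
Context {R : realType} {H : completeNormedModType (Cplx R)}.
Context (dot : {dot H for Num.conj}).
Hypothesis hp : hilbert_product dot.
Local Notation C := (Cplx R).

Lemma dot_linear (a : C) (u v w : H) : dot (a *: u + v) w = a * dot u w + dot v w.
Proof. by rewrite linearDl linearZl_LR. Qed.
Lemma dot_conj (u v : H) : dot v u = (dot u v)^*.
Proof. by rewrite hermC /= expr0 mul1r. Qed.
Lemma dot_ge0 (u : H) : 0 <= dot u u.
Proof. by rewrite hp exprn_ge0. Qed.
Lemma dot_def (u : H) : dot u u = 0 -> u = 0.
Proof. by rewrite hp => /eqP; rewrite expf_eq0 /= normr_eq0 => /eqP. Qed.

Lemma dot_norm (u : H) : re (dot u u) = cn `|u| ^+ 2.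
Proof.
have -> : dot u u = toC (cn `|u| ^+ 2); last by [].
by rewrite hp expr2 toCM -normE normr_id.
Qed.
Lemma norm_toC (u : H) : `|u| = toC (cn `|u|).
Proof. by rewrite -normE normr_id. Qed.
Lemma toC_lt (a b : R) : (toC a < toC b) = (a < b).
Proof. exact: ltcR. Qed.
Lemma gt0_toC (e : C) : 0 < e -> exists2 r : R, 0 < r & e = toC r.
Proof.
move=> e0; have h := ge0_toC (ltW e0); exists (re e) => //.
by rewrite -toC_lt -h.
Qed.

Lemma dot_complete (f : nat -> H) :
  (forall e : R, 0 < e -> exists N, forall m n, (N <= m)%N -> (N <= n)%N ->
     re (dot (f m - f n) (f m - f n)) < e) ->
  exists l, forall e : R, 0 < e -> exists N, forall n, (N <= n)%N ->
    re (dot (f n - l) (f n - l)) < e.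
Proof.
move=> cf; have : cauchy (f @ \oo).
  apply/cauchy_ballP => e /gt0_toC[r r0 ->]; rewrite near_simpl.
  have [|N hN] := cf (r ^+ 2); first by rewrite exprn_gt0.
  near=> p; rewrite -ball_normE /ball_ /=.
  have := hN p.1 p.2; rewrite dot_norm ltr_pXn2r ?nnegrE ?cn_ge0 ?(ltW r0)//.
  move=> h; rewrite norm_toC toC_lt; apply: h.
    by near: p; apply: (cvg_fst (nbhs_infty_ge N)).
  by near: p; apply: (cvg_snd (nbhs_infty_ge N)).
move=> /cauchy_cvgP fc.
exists (limn f) => e e0.
have se : 0 < Num.sqrt e by rewrite sqrtr_gt0.
have tse : 0 < toC (Num.sqrt e) by rewrite -toC0 toC_lt.
have /cvgrPdist_lt/(_ _ tse)[N _ hN] := fc.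
exists N => n /hN /= h; rewrite dot_norm -(sqr_sqrtr (ltW e0)).
by rewrite ltr_pXn2r ?nnegrE ?cn_ge0 ?ltW// -toC_lt -norm_toC distrC.
Unshelve. all: by end_near. Qed.

Definition dot_hilbert : hilbert R :=
  @Hilbert R H (fun u v => dot u v) dot_linear dot_conj dot_ge0 dot_def dot_complete.
Local Notation V := dot_hilbert.
Local Notation K := (@l2_hilbert R V).

Lemma nrmE (u : V) : nrm u = cn `|u : H|.
Proof. by rewrite /nrm /nsq /= dot_norm sqrtr_sqr ger0_norm ?cn_ge0. Qed.

Lemma bounded_opsP (T : V -> V) : bounded_ops (T : H -> H) <-> bop T.
Proof.
split=> [[lT cT]|[lT [c [c0 cT]]]].
  pose f : {linear H -> H} := HB.pack (T : H -> H) (GRing.isLinear.Build _ _ _ _ (T : H -> H) lT).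
  have /linear_boundedP : bounded_near f (nbhs 0).
    by apply/linear_bounded_continuous.
  move=> /pinfty_ex_gt0[e /gt0_toC[r r0 ->] hr].
  split; first exact: lT.
  exists r; split=> [|u]; first exact: ltW.
  by rewrite !nrmE -toC_le toCM -!norm_toC; exact: hr.
have lT' : linear (T : H -> H) by [].
split=> //.
pose f : {linear H -> H} := HB.pack (T : H -> H) (GRing.isLinear.Build _ _ _ _ (T : H -> H) lT').
suff : continuous f by [].
apply/linear_bounded_continuous/linear_boundedP.
exists (toC c); split; first by rewrite ger0_real// toC_ge0.
move=> r cr u; apply: le_trans (_ : toC c * `|u| <= _); last first.
  by rewrite ler_wpM2r// ltW.
by have := cT u; rewrite !nrmE -toC_le toCM -!norm_toC.
Qed.

Lemma opnorm_bnd (T : V -> V) : bop T -> bnd (opnorm (T : H -> H)) T.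
Proof.
move=> [lT [c [c0 cT]]].
pose S := [set complex.Re `|T u| | u in [set u : H | `|u| <= 1]].
have Sub : has_ubound S.
  exists c => _ [u u1 <-]; rewrite -/(re _) -[re _]/(re `|T u : H|).
  have := cT u; rewrite !nrmE /cn !normr_id => /le_trans; apply.
  rewrite -[leRHS]mulr1; apply: ler_wpM2l => //.
  by rewrite -toC_le -ge0_toC.
have Sle u : `|u : H| <= 1 -> cn `|T u : H| <= opnorm (T : H -> H).
  by move=> u1; apply: ub_le_sup => //; exists u => //; rewrite /cn normr_id.
have o0 : 0 <= opnorm (T : H -> H).
  by apply: le_trans (Sle 0 _); rewrite ?cn_ge0// normr0.
split=> // u; have [u0|u0] := eqVneq (nrm u) 0.
  by rewrite (nrm_eq0 u0) (lin0 lT) nrm0 mulr0.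
have up : 0 < nrm u by rewrite lt_def u0 nrm_ge0.
have := Sle (toC (nrm u)^-1 *: u); rewrite -!nrmE.
rewrite linZ// nrmZ cn_toC ?invr_ge0 ?nrm_ge0// => h.
rewrite -ler_pdivrMr// mulrC; apply: h.
by rewrite norm_toC -nrmE nrmZ cn_toC ?invr_ge0 ?nrm_ge0// mulVf.
Qed.

Lemma bnd_opnorm (T : V -> V) c : bnd c T -> opnorm (T : H -> H) <= c.
Proof.
move=> [c0 cT]; apply: ge_sup.
  by exists (complex.Re `|T 0 : H|), 0 => //=; rewrite normr0.
move=> _ [u u1 <-]; have := cT u; rewrite !nrmE /cn !normr_id.
move=> /le_trans; apply; rewrite -[leRHS]mulr1; apply: ler_wpM2l => //.
by rewrite -toC_le -ge0_toC.
Qed.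

Lemma von_neumannP (A : set (V -> V)) : von_neumann dot (A : set (H -> H)) ->
  star_alg A /\ cmt (cmt A) `<=` A.
Proof.
move=> [[Ab A0 AC AM As] AA].
have cE (B : set (V -> V)) : commutant (B : set (H -> H)) = cmt B.
  apply/seteqP; split=> T [/bounded_opsP bT hT]; split=> //.
    by move=> S BS u; have /(congr1 (fun f => f u)) := hT S BS.
  by move=> S BS; apply/funext => u; apply: hT.
have A1 : A idfun.
  rewrite -AA; split=> [|S _]; last by [].
  by apply/bounded_opsP; exact: bop_id.
split; last by move=> T; rewrite -!cE AA.
split.
- by move=> T /Ab/bounded_opsP.
- exact: A1.
- by move=> a S T AS AT; exact: AC.
- by move=> S T AS AT; exact: AM.
- move=> S AS; have [T AT TS] := As S AS.
  have ST : adj (V := V) (W := V) S T by apply: adjC => u v; exact: TS.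
  by rewrite (dagE ST).
Qed.

Lemma hassum_cvg (F : nat -> C) (s : C) : hassum F s -> series F @ \oo --> s.
Proof.
move=> Fs; apply/cvgrPdist_lt => e /gt0_toC[r r0 ->].
have [N hN] := Fs r r0; exists N => // n /hN.
by rewrite distrC normE toC_lt /series /= big_mkord.
Qed.

Lemma square_summableP (x : nat -> V) :
  square_summable (x : nat -> H) <-> x \in l2pred.
Proof.
have E : (fun n => `|x n : H| ^+ 2 : C) = (fun n => toC (nsq (x n))).
  by apply/funext => n; rewrite -ip_nsq /= hp.
split=> [|/l2predP[B hB]].
  rewrite /square_summable /= E => cv.
  set F := series _ in cv; pose L : C := limn F.
  have {}cv : F @ \oo --> L := cv.
  move/cvgrPdist_lt : cv => /(_ 1 ltr01)[N _ hN]; apply/l2predP.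
  exists (re L + 1) => n; pose m := maxn N n.
  apply: le_trans (mono_sum (fun k => nsq_ge0 (x k)) (leq_maxr N n)) _.
  have := hN m (leq_maxl _ _); rewrite /= -toC1 normE toC_lt /F /series /= big_mkord.
  set Sm := \sum_(k < m) _ => h.
  have -> : \sum_(k < m) nsq (x k) = re Sm by rewrite /Sm re_sum.
  have := re_le_cn (L - Sm); rewrite reB => /ler_normlP[h1 h2]; lra.
have [s hs] := nonneg_hassum (fun k => nsq_ge0 (x k)) hB.
by rewrite /square_summable /= E; apply: (cvgP s); apply: hassum_cvg.
Qed.

Definition of_ss (x : @square_summable R H) : K :=
  L2 (introT idP ((square_summableP (val x)).1 (set_valP x))).

Lemma to_ss (x : K) : exists e : @square_summable R H, of_ss e = x.
Proof.
have sx : square_summable (l2val x : nat -> H) by apply/square_summableP/l2P.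
by exists (exist (fun y : nat -> H => y \in square_summable) (l2val x) (mem_set sx)); apply: l2_ext.
Qed.

(** With [to_ss], this identifies the functionals defining the weak* topology with the matrix
    coefficients of the diagonal action on K. *)
Lemma vector_functionalsE (T : V -> V) e : bop T ->
  vector_functionals dot (T : H -> H) e = ip (amp T (of_ss e.1)) (of_ss e.2).
Proof.
move=> bT; apply: cvg_lim; first exact: norm_hausdorff.
apply: hassum_cvg; apply: eq_hassum (ip_pr _ _) => k.
by rewrite ampE.
Qed.

Lemma cvg_initial (S : choiceType) (T : topologicalType) (f : S -> T)
    (F : set_system S) (s : S) : Filter F -> f @ F --> f s ->
  F --> (s : initial_topology f).
Proof.
move=> FF h A; rewrite nbhsE => -[B [[U oU <-] Bs] BA].
by apply: filterS BA _; apply: h; apply: open_nbhs_nbhs.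
Qed.

Lemma weak_star_cvg (F : set_system (H -> H)) (T : weak_star dot) : Filter F ->
  (forall e, (fun S => vector_functionals dot S e) @ F --> vector_functionals dot T e) ->
  F --> T.
Proof.
move=> FF h; apply: cvg_initial; apply/cvg_sup => e.
apply: cvg_initial; exact: h.
Qed.

Lemma weak_star_eval e :
  continuous (fun S : weak_star dot => vector_functionals dot S e).
Proof.
move=> T; apply: (@continuous_comp (weak_star dot) _ _ (vector_functionals dot)
  (fun f => f e)); first exact: initial_continuous.
exact: (@proj_continuous _ (fun _ => C) e).
Qed.

End Bridge.

(** * Positive operators and the support of a vector *)

Section Positivity.
Context {R : realType} {V : hilbert R}.
Local Notation C := (Cplx R).
Local Notation K := (@l2_hilbert R V).
Implicit Types (T : V -> V) (u v : V).

Definition positive T := forall u, 0 <= ip (T u) u.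

Lemma positive_herm T u v : lin T -> positive T -> ip (T v) u = (ip (T u) v)^*.
Proof.
move=> lT T0; have real x : (ip (T x) x)^* = ip (T x) x.
  by rewrite (ge0_toC (T0 x)) toC_conj.
apply: conj_of_real.
  have -> : ip (T u) v + ip (T v) u = ip (T (u + v)) (u + v) - ip (T u) u - ip (T v) v.
    by rewrite linD// ipDl !ipDr; ring.
  by rewrite !rmorphB /= !real.
have -> : 'i * (ip (T u) v - ip (T v) u) =
    ip (T ('i *: u + v)) ('i *: u + v) - ip (T u) u - ip (T v) v.
  rewrite lT ipPl !ipDr !ipZr conjCi.
  have ii : 'i * 'i = -1 :> C by rewrite -expr2 sqrCi.
  transitivity ('i * (ip (T u) v - ip (T v) u) - ('i * 'i + 1) * ip (T u) u).
    by rewrite ii; ring.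
  by ring.
by rewrite !rmorphB /= !real.
Qed.

Lemma positive_CS T u v : lin T -> positive T ->
  cn (ip (T u) v) ^+ 2 <= re (ip (T u) u) * re (ip (T v) v).
Proof.
move=> lT T0; apply: psd_CS => [||t]; rewrite ?re_ge0//.
have := re_ge0 (T0 (t^* *: v + u)).
rewrite lT ipPl !ipDr !ipZr conjCK (positive_herm u v lT T0).
rewrite mulrDr !reD mulrA [t^* * t]mulrC cnK re_toCM -rmorphM re_conj; lra.
Qed.

Lemma hassum_ge0 (F : nat -> C) (s : C) : (forall k, 0 <= F k) -> hassum F s -> 0 <= s.
Proof.
move=> F0 Fs; have -> : s = toC (re s).
  apply: toC_re_eq; apply: hassum_eq (hassum_conj Fs) _.
  by apply: eq_hassum Fs => k; rewrite (ge0_toC (F0 k)) toC_conj.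
rewrite toC_ge0; apply: clim_ge Fs => n; rewrite re_sum.
by apply: sumr_ge0 => k _; apply: re_ge0.
Qed.

Lemma amp_positive T : bop T -> positive T -> forall x : K, 0 <= ip (amp T x) x.
Proof.
move=> bT T0 x; apply: hassum_ge0 (ip_pr _ _) => k; rewrite ampE//; exact: T0.
Qed.

(** The upper left corner, a left inverse of [amp] on bounded operators; it transports functionals
    from [M] to its amplification. *)
Definition deamp (X : K -> K) : V -> V := fun u => pr 0 (X (single 0 u)).

Lemma amp_inj T k u : bop T -> amp T (single k u) = single k (T u).
Proof.
move=> bT; apply: pr_ext => j; rewrite ampE// !injE.
by case: eqP => // _; rewrite (lin0 (bop_lin bT)).
Qed.
Lemma deampK T : bop T -> deamp (amp T) = T.
Proof. by move=> bT; apply/funext => u; rewrite /deamp amp_inj// injE. Qed.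
Lemma ip_amp_inj T u v : bop T -> ip (amp T (single 0 u)) (single 0 v) = ip (T u) v.
Proof. by move=> bT; rewrite amp_inj// ip_inj injE. Qed.
Lemma ampM (S T : V -> V) x : bop S -> bop T ->
  amp S (amp T x) = amp (fun u => S (T u)) x.
Proof.
move=> bS bT; apply: pr_ext => k; rewrite !ampE//; exact: bop_comp.
Qed.

(** The sum of two vector functionals is again one; this lets neighbourhoods given by single vectors
    be intersected. *)
Lemma ip_embed2 T (x y : K) : bop T ->
  ip (amp T (embed 0 x + embed 1 y)) (embed 0 x + embed 1 y) =
  ip (amp T x) x + ip (amp T y) y.
Proof.
move=> bT; rewrite (linD _ _ (bop_lin (amp_bop bT))) !embed_amp//.
rewrite ipDl !ipDr !(isometries_ip embed_isometries) /=.
by rewrite addr0 add0r.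
Qed.

(** The projection onto the closed orbit of [y] under the commutant lies in the bicommutant of the
    amplified algebra, hence is itself an amplification and descends to [V]. *)
Lemma vector_support (A : set (V -> V)) (y : K) : star_alg A -> cmt (cmt A) `<=` A ->
  exists s, [/\ A s, adj s s, forall u, s (s u) = s u,
    forall T, A T -> amp T y = 0 -> forall u, T (s u) = 0 &
    is_proj (orb (cmt (amp @` A)) y) (amp s)].
Proof.
move=> sA AA; have sK := amp_star_alg sA; have [Ab _ _ _ _] := sA.
have oL := orb_lin y (cmt_alg sK); have [P hP] := proj_exists oL.
have AAK := amp_bicommutant sA AA.
have [s As sP] := supp_in sK AAK hP; have bs := Ab _ As.
have Pi := proj_idem hP oL; have Pa := proj_adj hP; rewrite -sP in hP Pi Pa.
exists s; split=> //.
- by move=> u v; rewrite -(ip_amp_inj u v bs) Pa ipC ip_amp_inj// -ipC.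
- move=> u; have := congr1 (pr 0) (Pi (single 0 u)).
  by rewrite !amp_inj// !injE.
- move=> T AT Ty u; have bT := Ab _ AT.
  have AKT : (amp @` A) (amp T) by exists T.
  have := congr1 (pr 0) (supp_kill sK hP AKT Ty (single 0 u)).
  by rewrite !amp_inj// injE.
Qed.

End Positivity.

(** * From weak* continuity to a vector state *)

Section DominatingVector.
Context {R : realType} {H : completeNormedModType (Cplx R)}.
Context (dot : {dot H for Num.conj}).
Hypothesis hp : hilbert_product dot.
Local Notation C := (Cplx R).
Local Notation V := (dot_hilbert hp).
Local Notation K := (@l2_hilbert R V).
Variables (M : set (V -> V)) (w : (V -> V) -> C).
Hypothesis sM : star_alg M.
Hypothesis wl : linear_on (V := C^o) (M : set (H -> H)) (w : (H -> H) -> C^o).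
Hypothesis w0 : forall T : V -> V, M T -> positive T -> 0 <= w T.
Hypothesis wn : normal_on dot (M : set (H -> H)) (w : (H -> H) -> C).

Let Mb T : M T -> bop T. Proof. by case: sM => h _ _ _ _; apply: h. Qed.
Let M0 : M (fun _ => 0) := star_alg0 sM.

Let wlin a S T : M S -> M T -> w (fun u => a *: S u + T u) = a * w S + w T.
Proof. by move=> MS MT; apply: (wl a MS MT). Qed.
Let w00 : w (fun _ => 0) = 0.
Proof.
have := wlin (-1) M0 M0; rewrite mulN1r addNr => <-; congr w.
by apply/funext => u; rewrite scaleN1r addNr.
Qed.

(* As this filter converges weak* to 0, continuity of w turns into a bound of
   w by a vector functional on the positive operators. *)
Definition small_positive : set_system (H -> H) := [set A | exists x : K,
  forall T : V -> V, M T -> positive T -> re (ip (amp T x) x) < 1 -> A T].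

Lemma small_positive_filter : Filter small_positive.
Proof.
split.
- by exists 0.
- move=> A B [x hx] [y hy]; exists (embed 0 x + embed 1 y) => T MT T0.
  have bT := Mb MT; rewrite ip_embed2// reD => h.
  have := re_ge0 (amp_positive bT T0 x); have := re_ge0 (amp_positive bT T0 y).
  by move=> hy0 hx0; split; [apply: hx => //; lra|apply: hy => //; lra].
- by move=> A B AB [x hx]; exists x => T MT T0 h; apply: AB; apply: hx.
Qed.

(** For positive T, |<T x, y>|^2 <= <T x, x> <T y, y>, so the vectors x and y, rescaled, control the
    coefficient at (x, y). *)
Lemma small_positive_cvg : small_positive --> (0 : weak_star dot).
Proof.
have FF := small_positive_filter.
apply: weak_star_cvg => e; apply/cvgrPdist_lt => eps /gt0_toC[r r0 ->].
have b0 : bop (fun _ : V => 0 : V) := bop0.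
have -> : vector_functionals dot (0 : H -> H) e = 0.
  rewrite (vector_functionalsE (hp := hp) (T := fun _ : V => 0 : V) e b0).
  have -> : amp (fun _ : V => 0 : V) (of_ss hp e.1) = 0.
    by apply: pr_ext => k; rewrite ampE.
  by rewrite ip0l.
(* Chosen so that 1 <= s and 1 <= s r: from s^2 (p + q) < 1 and g <= p + q follows s g < 1 <= s
   r. *)
pose s := r^-1 + 1; have s1 : 1 <= s by rewrite lerDr invr_ge0 ltW.
pose x := of_ss hp e.1; pose y := of_ss hp e.2.
exists (embed 0 (toC s *: x) + embed 1 (toC s *: y)) => T MT T0.
have bT := Mb MT; have baT := amp_bop bT; have aT0 := amp_positive bT T0.
rewrite ip_embed2// !(linZ _ _ (bop_lin baT)) !ipZl !ipZr toC_conj => h.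
rewrite /= (vector_functionalsE e bT) sub0r normrN normE toC_lt -/x -/y.
have h1 := re_ge0 (aT0 x); have h2 := re_ge0 (aT0 y).
have s0 : 0 < s by lra.
have rs : 1 <= s * r by rewrite mulrDl mulVf ?gt_eqF// mul1r; lra.
have {h} : s ^+ 2 * (re (ip (amp T x) x) + re (ip (amp T y) y)) < 1.
  by move: h; rewrite reD !re_toCM; lra.
have CSx := positive_CS x y (bop_lin baT) aT0.
set p := re (ip (amp T x) x) in h1 CSx *.
set q := re (ip (amp T y) y) in h2 CSx *.
set g := cn _ in CSx * => h.
have g0 : 0 <= g := cn_ge0 _.
have pq : p * q <= (p + q) ^+ 2 by nra.
have gpq : g <= p + q.
  by rewrite -(@ler_pXn2r _ 2) ?nnegrE ?addr_ge0//; lra.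
have s2 : s <= s ^+ 2 by rewrite expr2; nra.
have : s * g < s * r; last by rewrite ltr_pM2l.
apply: le_lt_trans (_ : s ^+ 2 * (p + q) < _); last by lra.
by apply: ler_pM => //; lra.
Qed.

(** Continuity at 0 yields a vector x with |w(T)| < 1 whenever <T x, x> < 1. Homogeneity does the
    rest; dividing by t + e instead of t covers t = 0. *)
Lemma dominating_vector : exists x : K, forall T, M T -> positive T ->
  re (w T) <= re (ip (amp T x) x).
Proof.
have FF := small_positive_filter.
have Fw : w @ small_positive --> (0 : C).
  have /(_ (fun _ => 0) M0) := (subspace_continuousP (M : set (weak_star dot)) w).1 wn.
  rewrite w00 => cw A /cw hA.
  have [x hx] := small_positive_cvg hA.
  by exists x => T MT T0 Tx; apply: hx.
move/cvgrPdist_lt : Fw => /(_ 1 ltr01)[x hx]; exists x => T MT T0.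
have bT := Mb MT; have baT := amp_bop bT; have aT0 := amp_positive bT T0.
apply/ler_addgt0Pr => e e0; set t := re (ip _ _).
have t0 : 0 <= t by rewrite re_ge0.
have te : 0 < t + e by lra.
pose c := (t + e)^-1; have c0 : 0 < c by rewrite invr_gt0.
have := hx (fun u => toC c *: T u).
rewrite sub0r normrN normE -toC1 toC_lt.
have -> : w (fun u => toC c *: T u) = toC c * w T.
  rewrite -[RHS]addr0 -w00 -wlin//; congr w; apply/funext => u; by rewrite addr0.
have aE : amp (fun u => toC c *: T u) x = toC c *: amp T x.
  have bcT := bopZ (toC c) bT.
  by apply: pr_ext => k; rewrite (ampE _ _ bcT) (linZ _ _ (bop_lin (pr_bop k))) (ampE _ _ bT).
rewrite aE ipZl re_toCM -/t cnM (cn_toC (ltW c0)) => h.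
have {}h : c * cn (w T) < 1.
  apply: h; first exact: star_algZ.
    by move=> u; rewrite ipZl; apply: mulr_ge0 (T0 u); rewrite toC_ge0 ltW.
  by rewrite /c mulrC ltr_pdivrMr// mul1r; lra.
apply: le_trans (re_le _) _; move: h.
by rewrite /c mulrC ltr_pdivrMr// mul1r => /ltW.
Qed.

Lemma normal_state_vector : exists y : K, forall T, M T -> w T = ip (amp T y) y.
Proof.
have [x hx] := dominating_vector.
have dK T : M T -> deamp (amp T) = T by move=> MT; rewrite deampK//; exact: Mb.
have dpos X : (amp @` M) X -> (forall u : K, 0 <= ip (X u) u) -> positive (deamp X).
  move=> [T MT <-] hT u; rewrite dK//; rewrite -(ip_amp_inj _ _ (Mb MT)); exact: hT.
have [||||||y hy] := @vector_state _ K (amp @` M) (fun X => w (deamp X)) x embed unembed.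
- exact: amp_star_alg.
- move=> a _ _ [S MS <-] [T MT <-]; rewrite (dK S MS) (dK T MT) -wlin//; congr w.
  have [_ _ MD _ _] := sM.
  apply/funext => u; rewrite /deamp pr_lin !amp_inj ?injE//; exact: Mb.
- move=> X MX X0; have := dpos X MX X0; case: MX X0 => T MT <- X0.
  by rewrite dK// => T0; apply: w0.
- move=> X MX X0; have := dpos X MX X0; case: MX X0 => T MT <- X0.
  by rewrite dK// => T0; apply: hx.
- exact: embed_isometries.
- by move=> k _ [T MT <-] u; rewrite embed_amp//; exact: Mb.
by exists y => T MT; rewrite -hy ?dK//; exists T.
Qed.

End DominatingVector.

(** * Order between projections *)

Section Projections.
Context {R : realType} {V : hilbert R}.
Implicit Types p q : V -> V.

Definition projection p := adj p p /\ forall u, p (p u) = p u.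

Lemma projection_diff p q : projection p -> projection q ->
  (forall u, p (q u) = p u) -> forall u, ip (q u - p u) u = toC (nsq (q u - p u)).
Proof.
move=> [pp pi] [qq qi] pq u.
have qp v : q (p v) = p v by apply: ip_eqP => x; rewrite qq !pp pq.
have [lp lq] : lin p /\ lin q by split; [exact: adj_lin pp|exact: adj_lin qq].
rewrite -ip_nsq ipBr.
have -> : ip (q u - p u) (p u) = 0.
  by rewrite -pp linB// pq pi subrr ip0l.
by rewrite subr0 -qq linB// qi qp.
Qed.
Lemma projection_le p q : projection p -> projection q ->
  (forall u, p (q u) = p u) -> forall u, 0 <= ip (q u - p u) u.
Proof. by move=> hp hq pq u; rewrite projection_diff// toC_ge0 nsq_ge0. Qed.
Lemma projection_eq p q : projection p -> projection q ->
  (forall u, p (q u) = p u) -> (forall u, 0 <= ip (p u - q u) u) -> p = q.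
Proof.
move=> hp hq pq h; apply/funext => u; apply/eqP; rewrite eq_sym -subr_eq0.
apply/eqP/nsq_eq0/eqP; rewrite eq_le nsq_ge0 andbT.
have := re_ge0 (h u); rewrite -[p u - q u]opprB ipNl reN projection_diff// toCK; lra.
Qed.
Lemma projection_compl p : projection p -> projection (fun u => u - p u).
Proof.
move=> [pp pi]; have lp := adj_lin pp; split=> [u v|u].
  by rewrite ipBl ipBr pp.
by rewrite (linB _ _ lp) pi subrr subr0.
Qed.

End Projections.

(** * Properties of the expectation *)

Section Main.
Context {R : realType} {H : completeNormedModType (Cplx R)}.
Context (dot : {dot H for Num.conj}).
Hypothesis hp : hilbert_product dot.
Local Notation C := (Cplx R).
Local Notation V := (dot_hilbert hp).
Local Notation K := (@l2_hilbert R V).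
Variables (D M : set (V -> V)) (w : (V -> V) -> C) (z : V -> V) (y : K).
Hypothesis sD : star_alg D.
Hypothesis sM : star_alg M.
Hypothesis DD : cmt (cmt D) `<=` D.
Hypothesis DM : D `<=` M.
Hypothesis wE : forall T, M T -> w T = ip (amp T y) y.
Hypothesis tr : forall a x, D a -> M x ->
  w (fun u => a (x u)) = w (fun u => x (a u)).
Hypothesis zD : D z.
Hypothesis zp : projection z.
Hypothesis zproj : is_proj (orb (cmt (amp @` D)) y) (amp z).

Let Mb T : M T -> bop T. Proof. by case: sM => h _ _ _ _; apply: h. Qed.
Let Db T : D T -> bop T. Proof. by case: sD => h _ _ _ _; apply: h. Qed.
Let D1 : D (fun u => u). Proof. by case: sD. Qed.
Let Dm X Y : D X -> D Y -> D (fun u => X (Y u)).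
Proof. by case: sD => _ _ _ h _; apply: h. Qed.
Let DC a X Y : D X -> D Y -> D (fun u => a *: X u + Y u).
Proof. by case: sD => _ _ h _ _; apply: h. Qed.
Let Mm X Y : M X -> M Y -> M (fun u => X (Y u)).
Proof. by case: sM => _ _ _ h _; apply: h. Qed.
Let MC a X Y : M X -> M Y -> M (fun u => a *: X u + Y u).
Proof. by case: sM => _ _ h _ _; apply: h. Qed.
Let sDK : star_alg (amp @` D) := amp_star_alg sD.
Let sMK : star_alg (amp @` M) := amp_star_alg sM.
Let DMK : amp @` D `<=` amp @` M.
Proof. by move=> _ [T /DM MT <-]; exists T. Qed.
Let DDK : cmt (cmt (amp @` D)) `<=` amp @` D := amp_bicommutant sD DD.
Let iD T : D T -> (amp @` D) (amp T). Proof. by exists T. Qed.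
Let iM T : M T -> (amp @` M) (amp T). Proof. by exists T. Qed.

Let trK a x : (amp @` D) a -> (amp @` M) x -> ip (a (x y)) y = ip (x (a y)) y.
Proof.
move=> [d Dd <-] [T MT <-]; have Md := DM Dd.
have [bd bT] := (Db Dd, Mb MT).
by rewrite (ampM _ bd bT) (ampM _ bT bd) -(wE (Mm Md MT)) -(wE (Mm MT Md)) tr.
Qed.

Let MSK k x : (amp @` M) x -> forall u, x (embed k u) = embed k (x u).
Proof. by move=> [T MT <-] u; rewrite embed_amp//; exact: Mb. Qed.

Lemma z_central d u : D d -> z (d u) = d (z u).
Proof.
move=> Dd; have [bd bz] := (Db Dd, Db zD).
have := supp_central sDK DMK DDK trK zproj (single 0 u) (iD Dd).
move/(congr1 (pr 0)); rewrite !amp_inj// !injE.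
by [].
Qed.
Lemma z_y : amp z y = y. Proof. exact (supp_y sDK zproj). Qed.

Lemma w_z T : M T -> w (fun u => z (T u)) = w T.
Proof.
move=> MT; have Mz := DM zD; have [bT bz] := (Mb MT, Mb Mz).
by rewrite (wE MT) (wE (Mm Mz MT)) -(ampM _ bz bT) (amp_adj bz bz zp.1) z_y.
Qed.

(** The relation [cexp] brought back from K to H, with [w] in place of the vector [y]. *)
Definition expect (x T : V -> V) := [/\ D T, forall u, z (T u) = T u &
  forall d, D d -> w (fun u => T (d u)) = w (fun u => x (d u))].

Lemma expectP x T : M x -> expect x T <->
  D T /\ cexp (amp @` D) y (amp z) (amp x) (amp T).
Proof.
move=> Mx; have bx := Mb Mx; have bz := Db zD; split.
  move=> [DT zT hT]; have bT := Db DT; split=> //; split; first exact: iD.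
    by move=> u; rewrite (ampM _ bz bT); congr (amp _ u); apply/funext.
  move=> _ [d Dd <-]; have Md := DM Dd; have bd := Db Dd.
  rewrite (ampM _ bT bd) (ampM _ bx bd) -(wE (Mm (DM DT) Md)) -(wE (Mm Mx Md)).
  exact: hT.
move=> [DT [_ zT hT]]; have bT := Db DT; split=> //.
  move=> u; have := congr1 (pr 0) (zT (single 0 u)).
  by rewrite !amp_inj// !injE.
move=> d Dd; have Md := DM Dd; have bd := Db Dd.
rewrite (wE (Mm (DM DT) Md)) (wE (Mm Mx Md)) -(ampM _ bT bd) -(ampM _ bx bd).
exact: hT (iD Dd).
Qed.

Lemma expect_uniq x T T' : M x -> expect x T -> expect x T' -> T = T'.
Proof.
move=> Mx /(expectP T Mx)[DT hT] /(expectP T' Mx)[DT' hT'].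
rewrite -(deampK (Db DT)) -(deampK (Db DT')).
by rewrite (cexp_uniq sDK zproj hT hT').
Qed.

Lemma expect_exists x c : M x -> bnd c x -> exists2 T, expect x T & bnd c T.
Proof.
move=> Mx cx; have bx := Mb Mx.
have [P hP] := proj_exists (orb_lin y sDK).
have [X hX cX] := cexp_exists sDK sMK DMK DDK trK hP zproj (iM Mx) (amp_bnd bx cx).
have [[T DT TX] _ _] := hX; exists T.
  by apply/(expectP _ Mx); rewrite TX.
have bT := Db DT; case: cX => c0 cX; split=> // u.
have := cX (single 0 u); rewrite -TX amp_inj//.
have n v : nrm (single 0 v : K) = nrm (v : V) by rewrite /nrm /nsq ip_inj injE.
by rewrite !n.
Qed.

Lemma expect_choice : exists E : (V -> V) -> V -> V, forall x, M x ->
  expect x (E x) /\ forall c, bnd c x -> bnd c (E x).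
Proof.
have /choice[E hE] : forall x, exists T, M x -> expect x T /\ forall c, bnd c x -> bnd c T.
  move=> x; have [Mx|nMx] := pselect (M x); last by exists x.
  have [_ [c cx]] := Mb Mx; have [T hT cT] := expect_exists Mx cx.
  (* Existence produces an operator for each bound; uniqueness shows that it is always the same one,
     so that every bound of [x] is inherited. *)
  exists T => _; split=> // c' /(expect_exists Mx)[T' hT' cT'].
  by rewrite (expect_uniq Mx hT hT').
by exists E.
Qed.

Lemma expect_vector n (v : 'I_n -> K) : exists m : 'I_n -> K,
  forall x T, M x -> expect x T -> forall i j,
    ip (amp T (v j)) (v i) = ip (amp x (m j)) (m i).
Proof.
have [m hm] := cexp_vector sDK sMK DMK DDK trK embed_isometries MSK zproj v.
exists m => x T Mx /(expectP _ Mx)[DT xT] i j; apply: hm => //; exact: iM.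
Qed.

Section Map.
Variable E : (V -> V) -> V -> V.
Hypothesis hE : forall x, M x -> expect x (E x) /\ forall c, bnd c x -> bnd c (E x).

Let ED x : M x -> D (E x). Proof. by case/hE => -[]. Qed.
Let EM x : M x -> M (E x). Proof. by move/ED/DM. Qed.
Let Ez x u : M x -> z (E x u) = E x u. Proof. by case/hE => -[]. Qed.
Let Ew x d : M x -> D d -> w (fun u => E x (d u)) = w (fun u => x (d u)).
Proof. by case/hE => -[_ _ h] _ /h. Qed.
Let Eu x T : M x -> expect x T -> E x = T.
Proof. by move=> Mx; case: (hE Mx) => h _; apply: expect_uniq h. Qed.

Lemma E_linear a S T : M S -> M T ->
  E (fun u => a *: S u + T u) = (fun u => a *: E S u + E T u).
Proof.
move=> MS MT; apply: Eu; first exact: MC.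
have /(expectP _ MS)[DS hS] := (hE MS).1; have /(expectP _ MT)[DT hT] := (hE MT).1.
have MST := MC a MS MT; apply/(expectP _ MST); split; first exact: DC.
have aE X Y : bop X -> bop Y ->
    amp (fun u => a *: X u + Y u) = (fun u => a *: amp X u + amp Y u).
  move=> bX bY; apply/funext => u; apply: pr_ext => k.
  by rewrite pr_lin !ampE//; exact: bop_comb.
rewrite !aE; [|exact: Db|exact: Db|exact: Mb|exact: Mb].
exact: (cexp_lin sDK zproj a (iM MS) (iM MT) hS hT).
Qed.
Lemma E_mull d x : D d -> M x -> E (fun u => d (x u)) = (fun u => d (E x u)).
Proof.
move=> Dd Mx; have Md := DM Dd; apply: Eu; first exact: Mm.
split; first exact: Dm (ED Mx).
  by move=> u; rewrite z_central// Ez.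
move=> e De; have Me := DM De; have MEx := EM Mx.
rewrite (tr Dd (x := fun u => E x (e u))); last exact: Mm.
rewrite (tr Dd (x := fun u => x (e u))); last exact: Mm.
by rewrite (Ew Mx (d := fun u => e (d u)))//; exact: Dm.
Qed.
Lemma E_mulr d x : D d -> M x -> E (fun u => x (d u)) = (fun u => E x (d u)).
Proof.
move=> Dd Mx; have Md := DM Dd; apply: Eu; first exact: Mm.
split; [exact: Dm (ED Mx) Dd|by move=> u; rewrite Ez|].
by move=> e De; rewrite (Ew Mx (d := fun u => d (e u)))//; exact: Dm.
Qed.
Lemma E_w x : M x -> w (E x) = w x.
Proof. by move=> Mx; exact: Ew Mx D1. Qed.
Lemma E_idem x : M x -> E (E x) = E x.
Proof. by move=> Mx; apply: Eu; [exact: EM|split=> [|u|//]; [exact: ED|exact: Ez]]. Qed.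
Lemma E_D d : D d -> E d = (fun u => z (d u)).
Proof.
move=> Dd; have Md := DM Dd; apply: Eu => //; split; first exact: Dm.
  by move=> u; rewrite zp.2.
by move=> e De; rewrite (w_z (T := fun u => d (e u)))//; apply: Mm => //; exact: DM.
Qed.
Lemma E_image T : (E @` M) T <-> exists2 d, D d & T = (fun u => z (d u)).
Proof.
split=> [[x Mx <-]|[d Dd ->]].
  exists (E x); first exact: ED.
  by apply/funext => u; rewrite Ez.
by exists d; [exact: DM|exact: E_D].
Qed.
Lemma E_zD T : D T -> (forall u, z (T u) = T u) -> (E @` M) T.
Proof.
move=> DT zT; apply/E_image; exists T => //; by apply/funext => u; rewrite zT.
Qed.
(** |p y|^2 = w(p) = w(E p) in one direction; in the other, p y = 0 makes w(p d) = <d y, p y> = 0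
    for all d in [D], so 0 is the expectation of [p]. *)
Lemma E_null p : M p -> projection p -> E p = (fun=> 0) <-> amp p y = 0.
Proof.
move=> Mp [pp pi]; have bp := Mb Mp.
have D0 : D (fun=> 0) := star_alg0 sD; have M0 := DM D0.
have am0 x : amp (fun _ : V => 0 : V) x = 0 :> K.
  by apply: pr_ext => k; rewrite ampE//; exact: bop0.
have w00 : w (fun=> 0) = 0 by rewrite (wE M0) am0 ip0l.
have app := amp_adj bp bp pp.
split=> [Ep|py].
  have ppE : (fun u => p (p u)) = p by apply/funext.
  by apply: ip_def; rewrite -app (ampM _ bp bp) ppE -(wE Mp) -(E_w Mp) Ep.
apply: Eu => //; split=> // [u|d Dd]; first by rewrite (lin0 (bop_lin (Db zD))).
have Md := DM Dd.
by rewrite w00 (wE (Mm Mp Md)) -(ampM _ bp (Mb Md)) app py ip0r.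
Qed.

End Map.
End Main.

(** * Support, normality, complete positivity and uniqueness *)

Section Assembly.
Context {R : realType} {H : completeNormedModType (Cplx R)}.
Context (dot : {dot H for Num.conj}).
Hypothesis hp : hilbert_product dot.
Local Notation C := (Cplx R).
Local Notation V := (dot_hilbert hp).
Local Notation K := (@l2_hilbert R V).

Lemma is_projectionP (p : V -> V) : is_projection dot (p : H -> H) <-> projection p.
Proof.
split=> [[pi pp]|[pp pi]]; split=> //; last exact/funext.
by move=> u; have /(congr1 (fun f => f u)) := pi.
Qed.

Lemma projection_le_absorb (p q : V -> V) : projection p -> projection q ->
  (forall u, 0 <= ip (p u - q u) u) -> forall u, p (q u) = q u.
Proof.
move=> [pp pi] [qq qi] h u; apply/eqP; rewrite -subr_eq0; apply/eqP/nsq_eq0/eqP.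
rewrite eq_le nsq_ge0 andbT nsqB.
have h1 : re (ip (p (q u)) (q u)) = nsq (p (q u)) by rewrite /nsq [in RHS]pp pi -pp.
have := re_ge0 (h (q u)); rewrite qi ipBl reB -/(nsq (q u)) h1; lra.
Qed.

(** If p y = 0 then p s = 0, so p = p (1 - s) lies below 1 - s. The map [f] is kept abstract so as
    to be [w] on [D] as well as the expectation on [M]. *)
Lemma largest_null (W : zmodType) (A : set (V -> V)) (f : (V -> V) -> W) (s : V -> V)
    (y : K) : star_alg A ->
  (forall p, A p -> projection p -> f p = 0 <-> amp p y = 0) ->
  A s -> projection s -> amp s y = y ->
  (forall T, A T -> amp T y = 0 -> forall u, T (s u) = 0) ->
  largest_null_projection dot (A : set (H -> H)) (f : (H -> H) -> W)
    (idfun - (s : H -> H)).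
Proof.
move=> sA fA As ps sy sk; have [Ab A1 _ _ _] := sA.
have Aq : A (fun u => u - s u) := star_algB sA A1 As.
have pq := projection_compl ps; have bs := Ab _ As.
split; first exact: Aq.
- by apply/is_projectionP.
- have qy : amp (fun u => u - s u) y = 0.
    apply: pr_ext => k; rewrite (ampE k y (Ab _ Aq)) /= -(ampE k y bs) sy.
    exact: subrr.
  by apply/(fA _ Aq pq).
- suff h (p : V -> V) : A p -> projection p -> f p = 0 -> forall u, 0 <= ip (u - s u - p u) u.
    by move=> p Ap /is_projectionP pp fp; exact: h.
  move=> Ap pp fp; have lp := bop_lin (Ab _ Ap).
  have py : amp p y = 0 by apply/fA.
  have pab u : p (u - s u) = p u by rewrite linB// sk// subr0.
  exact: (projection_le pp pq pab).
Qed.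

Variables (D M : set (V -> V)) (w : (V -> V) -> C) (z : V -> V).
Hypothesis vD : von_neumann dot (D : set (H -> H)).
Hypothesis vM : von_neumann dot (M : set (H -> H)).
Hypothesis DM : D `<=` M.
Hypothesis wl : linear_on (V := C^o) (M : set (H -> H)) (w : (H -> H) -> C^o).
Hypothesis w0 : forall T : V -> V, M T -> positive T -> 0 <= w T.
Hypothesis wn : normal_on dot (M : set (H -> H)) (w : (H -> H) -> C).
Hypothesis zsupp : is_support dot (D : set (H -> H)) (w : (H -> H) -> C^o) (z : H -> H).
Hypothesis tr : forall a x, D a -> M x -> w (a \o x) = w (x \o a).

Let sD : star_alg D := (von_neumannP vD).1.
Let DD : cmt (cmt D) `<=` D := (von_neumannP vD).2.
Let sM : star_alg M := (von_neumannP vM).1.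
Let MM : cmt (cmt M) `<=` M := (von_neumannP vM).2.
Let Mb T : M T -> bop T. Proof. by case: sM => h _ _ _ _; apply: h. Qed.
Let Db T : D T -> bop T. Proof. by case: sD => h _ _ _ _; apply: h. Qed.
Let D1 : D (fun u => u). Proof. by case: sD. Qed.
Let Dm X Y : D X -> D Y -> D (fun u => X (Y u)).
Proof. by case: sD => _ _ _ h _; apply: h. Qed.
Let DC a X Y : D X -> D Y -> D (fun u => a *: X u + Y u).
Proof. by case: sD => _ _ h _ _; apply: h. Qed.
Let Ds X : D X -> D (dag X). Proof. by case: sD => _ _ _ _; apply. Qed.

Section Vector.
Variable y : K.
Hypothesis wE : forall T, M T -> w T = ip (amp T y) y.

Lemma state_null p : M p -> projection p -> w p = 0 <-> amp p y = 0.
Proof.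
move=> Mp [pp pi]; have bp := Mb Mp; rewrite (wE Mp).
split=> [h|->]; last exact: ip0l.
apply: ip_def; rewrite -(amp_adj bp bp pp) (ampM _ bp bp).
by rewrite (_ : (fun u => p (p u)) = p)//; apply/funext.
Qed.

(** The support of [y] in [D] is also the complement of a largest null projection of [w], and two
    largest ones coincide. *)
Lemma support_vector : [/\ D z, projection z &
  is_proj (orb (cmt (amp @` D)) y) (amp z)].
Proof.
have [s [sD' ss si sk sP]] := vector_support y sD DD.
have sy : amp s y = y := supp_y (amp_star_alg sD) sP.
suff -> : z = s by [].
have nullD p (Dp : D p) := state_null (DM Dp).
have [Dq pq' wq lq] := largest_null sD nullD sD' (conj ss si) sy sk.
have [q0 [Dq0 pq0' wq0 lq0] ->] := zsupp.
have /is_projectionP pq0 := pq0'; have /is_projectionP pq := pq'.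
have q0q (u : V) : q0 (u - s u) = q0 u.
  rewrite (linB _ _ (bop_lin (Db Dq0))) sk ?subr0//.
  exact/(state_null (DM Dq0) pq0).
have E : q0 = (fun u => u - s u) :> (V -> V).
  by apply: (projection_eq pq0 pq q0q) => u; apply: (lq0 _ Dq pq' wq).
apply/funext => u; rewrite E.
by rewrite -[LHS]/(u - (u - s u)) opprB addrC subrK.
Qed.

Section Properties.
Variable E : (V -> V) -> V -> V.
Hypothesis hE : forall x, M x ->
  expect D w z x (E x) /\ forall c, bnd c x -> bnd c (E x).

Let zD : D z. Proof. by case: support_vector. Qed.
Let zp : projection z. Proof. by case: support_vector. Qed.
Let zP : is_proj (orb (cmt (amp @` D)) y) (amp z).
Proof. by case: support_vector. Qed.
Let zc d u : D d -> z (d u) = d (z u).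
Proof. exact (z_central sD sM DD DM wE tr zD zP u). Qed.
Let ED x : M x -> D (E x). Proof. by case/hE => -[]. Qed.
Let imE T : (E @` M) T -> D T /\ forall u, z (T u) = T u.
Proof. by case=> x Mx <-; case: (hE Mx) => -[]. Qed.
Let imI T : D T -> (forall u, z (T u) = T u) -> (E @` M) T.
Proof. exact (@E_zD _ _ _ _ _ _ _ _ _ sD sM DM wE zD zp zP _ hE T). Qed.
Let vec n (v : 'I_n -> K) : exists m : 'I_n -> K,
  forall x T, M x -> expect D w z x T -> forall i j,
    ip (amp T (v j)) (v i) = ip (amp x (m j)) (m i).
Proof. exact (expect_vector sD sM DD DM wE tr zD zP v). Qed.

(** [vec] for two vectors: each defining functional of the topology, composed with [E], agrees on
    [M] with another defining functional. *)
Lemma E_normal : normal_on dot (T := weak_star dot) (M : set (H -> H))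
  (E : (H -> H) -> (H -> H)).
Proof.
apply/subspace_continuousP => x Mx; apply: weak_star_cvg => e.
pose v (i : 'I_2) : K := if i == ord0 then of_ss hp e.1 else of_ss hp e.2.
have [m hm] := vec v.
have [e1 he1] := to_ss (m ord0); have [e2 he2] := to_ss (m ord_max).
have key (T : V -> V) : M T ->
    vector_functionals dot (E T : H -> H) e = vector_functionals dot (T : H -> H) (e1, e2).
  move=> MT; rewrite (vector_functionalsE _ (Db (ED MT))) (vector_functionalsE _ (Mb MT)).
  have := hm _ _ MT (hE MT).1 ord_max ord0; rewrite -he1 -he2.
  exact.
move=> A; rewrite (key _ Mx) => /(@weak_star_eval R H dot (e1, e2) x) hA.
suff : nbhs (x : weak_star dot) [set T | M T ->
    A (vector_functionals dot (E T : H -> H) e)] by [].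
apply: (@filterS _ _ (nbhs_filter (x : weak_star dot)) _ _ _ hA) => T hT MT.
by rewrite (key _ MT).
Qed.

(** [vec] removes [E] at the cost of replacing the u_j by vectors m_j of K; coordinate by coordinate
    the resulting sum is the given positive form at the [pr k (m j)]. *)
Lemma E_cp : completely_positive dot (M : set (H -> H)) (E : (H -> H) -> (H -> H)).
Proof.
move=> n x Mx x0 u; pose xx i j : V -> V := x i j.
have [m hm] := vec (fun j : 'I_n => single 0 (u j : V)).
have Mxx i j : M (xx i j) := Mx i j.
have -> : \sum_i \sum_j dot (map_mx E x i j (u j)) (u i) =
    \sum_i \sum_j ip (amp (xx i j) (m j)) (m i).
  apply: eq_bigr => i _; apply: eq_bigr => j _; rewrite mxE.
  rewrite -(hm _ _ (Mxx i j) (hE (Mxx i j)).1) ip_amp_inj//.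
  exact: Db (ED (Mxx i j)).
apply: (@hassum_ge0 _ (fun k => \sum_i \sum_j ip (xx i j (pr k (m j))) (pr k (m i)))).
  by move=> k; exact: (x0 (fun i => pr k (m i))).
apply: hassum_sum => i; apply: hassum_sum => j.
apply: eq_hassum (ip_pr _ _) => k; rewrite ampE//; exact: Mb.
Qed.

Lemma E_image_eq : E @` M = [set z \o d | d in D].
Proof.
apply/seteqP; split=> T.
  by move=> /imE[DT zT]; exists T => //; apply/funext.
move=> [d Dd <-]; apply: imI; first exact: Dm.
by move=> u; exact: zp.2.
Qed.

Lemma E_ideal : is_ideal (D : set (H -> H)) (E @` M : set (H -> H)).
Proof.
have lz := bop_lin (Db zD).
split.
- by move=> T /imE[].
- apply: imI; first exact: (star_alg0 sD).
  by move=> u; exact: (lin0 lz).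
- move=> c S T /imE[DS zS] /imE[DT zT]; apply: imI; first exact: DC.
  by move=> u; have := lz c (S u) (T u); rewrite zS zT.
- move=> d T Dd /imE[DT zT]; split; apply: imI; try exact: Dm.
    by move=> u; rewrite /= zc ?zT.
  by move=> u; rewrite /= zT.
Qed.

Lemma E_star_subalgebra : star_subalgebra dot (E @` M : set (H -> H)).
Proof.
have [iD i0 iC iM] := E_ideal; split=> //.
- by move=> T /iD/Db/bounded_opsP.
- by move=> S T iS iT; exact: (iM S T (iD _ iS) iT).1.
- suff h (S : V -> V) : (E @` M) S -> exists2 T, (E @` M) T & adj T S by exact: h.
  move=> /imE[DS zS]; have bS := Db DS; exists (dag S); last exact/adjC/dagP.
  apply: imI; first exact: Ds.
  move=> u; apply: ip_eqP => v; rewrite zp.1 !ip_dagl// -zc// zS.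
  by [].
Qed.

(** By [E_null] the support is that of [y] in [M]; it lies below [z] because 1 - z kills [y]. *)
Lemma E_support : exists2 s : H -> H, is_support dot (M : set (H -> H)) 
  (E : (H -> H) -> (H -> H)) s & op_le dot s (z : H -> H).
Proof.
have [s [sM' ss si sk sP]] := vector_support y sM MM.
have sy : amp s y = y := supp_y (amp_star_alg sM) sP.
exists (s : H -> H).
  exists (idfun - (s : H -> H)); last first.
    by apply/funext => u; rewrite -[RHS]/(u - (u - s u)) opprB addrC subrK.
  apply: (largest_null sM _ sM' (conj ss si) sy sk) => p Mp pp.
  exact (E_null sD sM DM wE zD zP hE Mp pp).
have Mz := DM zD.
have zs u : z (s u) = s u.
  have Mq : M (fun u => u - z u) by apply: star_algB => //; case: sM.
  have := sk _ Mq _ u; rewrite /= => h; apply/esym/eqP; rewrite -subr_eq0 h//.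
  apply: pr_ext => k; rewrite (ampE k y (Mb Mq)) /= -(ampE k y (Mb Mz)).
  by rewrite (z_y sD zP); exact: subrr.
apply: (projection_le (p := s)) => // u.
by apply: ip_eqP => v; rewrite !ss zp.1 zs.
Qed.

Lemma E_preserving : preserving_normal_projection dot (D : set (H -> H))
  (M : set (H -> H)) (w : (H -> H) -> C) (z : H -> H) (E : (H -> H) -> (H -> H)).
Proof.
split.
- split=> [c S T MS MT|d x Dd Mx].
    exact (E_linear sD sM DM wE zD zP hE c MS MT).
  split; first exact (E_mull sD sM DD DM wE tr zD zP hE Dd Mx).
  exact (E_mulr sD sM DM wE zD zP hE Dd Mx).
- by move=> x Mx; exact (E_w sD hE Mx).
- split; first exact: E_normal.
  by move=> x Mx; apply: bnd_opnorm; apply: (hE Mx).2; apply: opnorm_bnd; exact: Mb.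
- by move=> x Mx; exact (E_idem sD sM DM wE zD zP hE Mx).
- exact: E_support.
Qed.

(** The null projection [p] of E' dominates q = 1 - z, so E'(q) = E'(p q) = E'(p) q = 0. This puts
    the values of E' in z D, and w(E'(x) d) = w(E'(x d)) = w(x d) makes them expectations. *)
Lemma E_unique (E' : (V -> V) -> V -> V) : preserving_normal_projection dot
    (D : set (H -> H)) (M : set (H -> H)) (w : (H -> H) -> C) (z : H -> H)
    (E' : (H -> H) -> (H -> H)) ->
  E' @` M `<=` D -> forall x, M x -> E' x = E x.
Proof.
move=> [[_ mod] w' _ idem [s [p [Mp pp' E'p _] ->] sz]] E'D x Mx.
have /is_projectionP pp := pp'; have Mz := DM zD.
pose q (u : V) := u - z u.
have Dq : D q by apply: star_algB.
have pq : projection q := projection_compl zp.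
have p_q u : p (q u) = q u.
  apply: (projection_le_absorb pp pq) => v.
  have <- : z v - (v - p v) = p v - q v by rewrite /q !opprB addrCA.
  exact: sz v.
have E'q : E' q = (fun=> 0).
  have [_ h] := mod q p Dq Mp.
  have <- : p \o q = q by apply/funext.
  by rewrite h E'p.
pose T := E' x; have DT : D T by apply: E'D; exists x.
have qT u : q (T u) = 0.
  (* E'(q T) in two ways: q E'(T) = q T, as [q] is in [D], and E'(q) T = 0, as [T] is in [D]. *)
  have [h _] := mod q T Dq (DM DT); have [_ h'] := mod T q DT (DM Dq).
  have := congr1 (fun f => f u) h; rewrite h' E'q idem//=.
have zT u : z (T u) = T u.
  by apply/esym/eqP; rewrite -subr_eq0; apply/eqP; exact: qT.
apply/esym; apply: (expect_uniq sD sM DM wE zD zP Mx (hE Mx).1).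
split=> // d Dd; have [_ h] := mod d x Dd Mx.
have Mxd : M (fun u => x (d u)) by case: sM => _ _ _ MMm _; apply: MMm => //; exact: DM.
by have := w' _ Mxd; rewrite -[E' (fun u => x (d u))]/(E' (x \o d)) h.
Qed.

End Properties.
End Vector.

Lemma assembly : exists E : (V -> V) -> V -> V,
  [/\ preserving_normal_projection dot (D : set (H -> H)) (M : set (H -> H))
        (w : (H -> H) -> C) (z : H -> H) (E : (H -> H) -> (H -> H)),
      completely_positive dot (M : set (H -> H)) (E : (H -> H) -> (H -> H)),
      is_ideal (D : set (H -> H)) (E @` M : set (H -> H)),
      E @` M = [set z \o d | d in D]
    & (E @` M `<=` D /\ star_subalgebra dot (E @` M : set (H -> H)))
      /\ forall E' : (V -> V) -> V -> V,
           preserving_normal_projection dot (D : set (H -> H)) (M : set (H -> H))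
             (w : (H -> H) -> C) (z : H -> H) (E' : (H -> H) -> (H -> H)) ->
           E' @` M `<=` D -> forall x, M x -> E' x = E x].
Proof.
have [y wE] := normal_state_vector sM wl w0 wn.
have [zD zp zP] := support_vector wE.
have [E hE] := expect_choice sD sM DD DM wE tr zD zP.
exists E; split.
- exact: (E_preserving wE hE).
- exact: (E_cp wE hE).
- exact: (E_ideal wE hE).
- exact: (E_image_eq wE hE).
split; last by move=> E' hE'; exact: (E_unique wE hE hE').
by split; [have [] := E_ideal wE hE|exact: (E_star_subalgebra wE hE)].
Qed.

End Assembly.

Theorem theorem3p12 (R : realType) (H : completeNormedModType (Cplx R))
    (dot : {dot H for Num.conj}) (D M : set (H -> H))
    (w : (H -> H) -> Cplx R) (z : H -> H) :
  hilbert_product dot ->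
  von_neumann dot D -> von_neumann dot M -> D `<=` M ->
  normal_state dot M w -> is_support dot D w z ->
  (forall a x, D a -> M x -> w (a \o x) = w (x \o a)) ->
  exists E : (H -> H) -> (H -> H),
    [/\ preserving_normal_projection dot D M w z E,
        completely_positive dot M E,
        is_ideal D (E @` M),
        E @` M = [set z \o d | d in D]
      & onto_star_subalgebra dot D M E
        /\ forall E' : (H -> H) -> (H -> H),
             preserving_normal_projection dot D M w z E' ->
             onto_star_subalgebra dot D M E' ->
             forall x, M x -> E' x = E x].
Proof.
move=> hp vD vM DM [wl w0 _ wn] zsupp tr.
have [E [h1 h2 h3 h4 [h5 h6]]] :=
  @assembly R H dot hp D M w z vD vM DM wl w0 wn zsupp tr.
by exists E; split=> //; split=> // E' hE' [E'D _] x Mx; exact: h6.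
Qed.
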